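(* Let $p$ be an odd prime, let $\mathcal{F}$ be a saturated fusion system over a finite $p$-group $P$, and let $D$ be an $\mathcal{F}$-strongly closed subgroup of $P$. Then $\mathcal{F}=\mathcal{F}_P(P)$ if and only if $N_{\mathcal{F}}(Z(J(D)))=\mathcal{F}_P(P)$.
   Context: All groups are finite. Saturated fusion systems over a finite $p$-group are understood in the standard (Puig / Broto–Levi–Oliver / Aschbacher–Kessar–Oliver) sense. $\mathcal{F}_P(P)$ denotes the fusion system over $P$ whose morphisms are exactly the homomorphisms between subgroups of $P$ induced by conjugation by elements of $P$. A subgroup $Q\le P$ is $\mathcal{F}$-strongly closed (in $P$) if no element of $Q$ is $\mathcal{F}$-conjugate to an element of $P\setminus Q$; that is, for every $x\in Q$ and every morphism $\varphi:\langle x\rangle\to P$ in $\mathcal{F}$ one has $\varphi(x)\in Q$. For a finite $p$-group $D$, $J(D)$ denotes the Thompson subgroup of $D$, i.e. the subgroup generated by all abelian subgroups of $D$ of maximal order, and $Z(\cdot)$ denotes the center. For a subgroup $Q\le P$, $N_{\mathcal{F}}(Q)$ is the fusion system over $N_P(Q)$ whose morphisms $R\to S$ (for $R,S\le N_P(Q)$) are the morphisms $\varphi:R\to S$ of $\mathcal{F}$ that extend to a morphism $\hat\varphi:QR\to QS$ in $\mathcal{F}$ with $\hat\varphi(Q)=Q$ and $\hat\varphi|_R=\varphi$. (An $\mathcal{F}$-strongly closed subgroup $D$ is normal in $P$, so $Z(J(D))$ is normal in $P$ and $N_{\mathcal{F}}(Z(J(D)))$ is a fusion system over $P$.) *)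

(* Defs.v *)
From mathcomp Require Import all_boot all_fingroup all_solvable.

Set Implicit Arguments.
Unset Strict Implicit.
Unset Printing Implicit Defensive.

Import GroupScope.

Section Fusion.

Variable gT : finGroupType.
Implicit Types (P Q R T : {group gT}) (f g h : {ffun gT -> gT}).

(* A map with domain Q is represented by the finite function on gT that takes *)
(* the value 1 outside Q, so that maps on Q are equal iff their               *)
(* representatives are, and composition of maps is composition of functions.  *)
Definition restr (Q : {set gT}) (f : gT -> gT) : {ffun gT -> gT} :=
  [ffun x => if x \in Q then f x else 1].

Definition Inj Q R : {set {ffun gT -> gT}} :=
  [set f : {ffun gT -> gT} |
    [&& morphic Q f, dinjectiveb f Q, f @: Q \subset R & f == restr Q f]].

(* A category of maps between subgroups is given by its set of morphisms,     *)
(* (Q, R, f) standing for f : Q -> R. The objects, hence the group over which *)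
(* a fusion system lives, are determined by the identity morphisms.           *)
Definition fusion_data := {set {group gT} * {group gT} * {ffun gT -> gT}}.
Implicit Types F : fusion_data.

Definition Hom F Q R : {set {ffun gT -> gT}} := [set f | (Q, R, f) \in F].

Definition Iso F Q R : {set {ffun gT -> gT}} :=
  [set f in Hom F Q R |
    [exists g in Hom F R Q,
       [forall x in Q, g (f x) == x] && [forall y in R, f (g y) == y]]].

(* F_P(P), with c_g : x |-> x ^ g *)
Definition inner_fusion P : fusion_data :=
  [set u : {group gT} * {group gT} * {ffun gT -> gT} | let: (Q, R, f) := u in
    [&& Q \subset P, R \subset P &
      [exists g in P, (Q :^ g \subset R) && (f == restr Q (conjg^~ g))]]].

Record fusion_system P F : Prop := FusionSystem {
  fusion_obj : forall Q R f, f \in Hom F Q R -> Q \subset P /\ R \subset P;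
  fusion_inj : forall Q R, Hom F Q R \subset Inj Q R;
  fusion_inner : inner_fusion P \subset F;
  fusion_comp : forall Q R T f g,
    f \in Hom F Q R -> g \in Hom F R T -> finfun (g \o f) \in Hom F Q T;
  (* each morphism is an F-isomorphism followed by an inclusion *)
  fusion_factor : forall Q R f, f \in Hom F Q R ->
    exists2 T : {group gT}, T \subset R & f \in Iso F Q T
}.

Definition fconjugate F Q R : Prop := exists f, f \in Iso F Q R.

Definition AutF F Q : {set {perm gT}} :=
  [set a in Aut Q | restr Q a \in Hom F Q Q].

Definition fully_automized p P F Q : bool :=
  p.-Sylow(AutF F Q) (conj_aut Q @* 'N_P(Q)).

(* For f : Q -> R an isomorphism, the set of the g in 'N_P(Q) such that       *)
(* f^-1 c_g f (composed from left to right) is in Aut_P(R).                   *)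
Definition extender P Q R f : {set gT} :=
  [set g in 'N_P(Q) |
    [exists h in 'N_P(R), [forall x in Q, f (x ^ g) == f x ^ h]]].

Lemma group_set_extender P Q R f : group_set (extender P Q R f).
Proof.
apply/group_setP; split=> [|g1 g2].
  rewrite inE group1; apply/exists_inP; exists 1; first exact: group1.
  by apply/forall_inP=> x _; rewrite !conjg1.
rewrite inE => /andP[Ng1 /exists_inP[h1 Nh1 /forall_inP E1]].
rewrite inE => /andP[Ng2 /exists_inP[h2 Nh2 /forall_inP E2]].
rewrite inE groupM //=; apply/exists_inP; exists (h1 * h2); first exact: groupM.
apply/forall_inP=> x Qx.
have Qx1 : x ^ g1 \in Q by case/setIP: Ng1 => _ /memJ_norm->.
by rewrite !conjgM (eqP (E2 _ Qx1)) (eqP (E1 _ Qx)).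
Qed.
Canonical extender_group P Q R f := Group (group_set_extender P Q R f).

Definition receptive P F R : Prop :=
  forall Q f, f \in Iso F Q R ->
    exists2 h, h \in Hom F (extender_group P Q R f) P & {in Q, h =1 f}.

Definition saturated p P F : Prop :=
  forall Q, Q \subset P ->
    exists R, [/\ fconjugate F Q R, fully_automized p P F R & receptive P F R].

Definition strongly_closed P F (D : {group gT}) : Prop :=
  D \subset P /\
  forall x f, x \in D -> f \in Hom F <[x]>%G P -> f x \in D.

(* For R contained in 'N(Q), Q <*> R is the product QR. *)
Definition normalizer_fusion P F Q : fusion_data :=
  [set u : {group gT} * {group gT} * {ffun gT -> gT} | let: (R, T, f) := u in
    [&& R \subset 'N_P(Q), T \subset 'N_P(Q), f \in Hom F R T &
      [exists h in Hom F (Q <*> R)%G (Q <*> T)%G,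
         (h @: Q == Q) && [forall x in R, h x == f x]]]].

Definition max_order_abelian (D A : {group gT}) : bool :=
  [&& A \subset D, abelian A &
    [forall B : {group gT}, (B \subset D) && abelian B ==> (#|B| <= #|A|)]].

Definition thompson (D : {group gT}) : {group gT} :=
  <<\bigcup_(A : {group gT} | max_order_abelian D A) A>>%G.

End Fusion.

(* Main.v *)
Require Import Defs.
From mathcomp Require Import all_boot all_fingroup all_solvable.
From mathcomp Require Import ssrAC ssralg zmodp matrix mxalgebra.
From mathcomp Require Import mxrepresentation mxabelem.

(* Suppose that some N_F(Q), together with everything above Q, has a          *)
(* nontrivial automorphism of order prime to p; we produce one that           *)
(* normalizes ZJ(D). Saturated systems whose objects all contain a normal     *)
(* subgroup Q are stable under passing to a normalizer N_F(Y), Y > Q, and to  *)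
(* the quotient by Q, so one can argue by induction on |P : Q| + |P|. If      *)
(* Q = 1, take Y <> 1 with such an automorphism and |N_P(Y)| maximal, and     *)
(* apply the induction hypothesis to N_F(Y). If Q <> 1 and the quotient       *)
(* fusion system is not trivial, apply induction to the quotient and then to  *)
(* N_F(Y) for Y the preimage of ZJ(DQ/Q). Otherwise Q may be assumed to       *)
(* contain its centralizer and Out_F(Q) has a normal p-complement, by         *)
(* Frobenius' criterion; the Glauberman-Thompson argument applies to the      *)
(* action on Q of an abelian p'-subgroup K of Out_F(Q) normalized by P:       *)
(* elements of P acting quadratically centralize K (p being odd), and         *)
(* Glauberman's replacement theorem supplies the quadratic action.            *)
(* No models of constrained fusion systems are needed: every morphism between *)
(* subgroups of P is a conjugation in the symmetric group on gT, so that all  *)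
(* arguments take place inside that group.                                    *)

(** Since [normalizer_fusion P F Z] with Z = ZJ(D) lies between the inner system and F, only one
    direction has content. F is inner as soon as each p'-automorphism in F of a subgroup of P is
    trivial ([fusion_trivial], an Alperin-style argument). So it is enough that a nontrivial
    p'-automorphism anywhere forces one that stabilizes Z on a subgroup containing Z: the latter
    lies in N_F(Z), and if N_F(Z) is inner its automorphisms have p-power order, a contradiction.

    That implication is [bad_center_thompson], a form for fusion systems of the Glauberman-Thompson
    normal p-complement theorem. Its induction needs saturation of normalizers ([norm_sat]) and of
    quotients ([quo_sat]), and transfer of the nontrivial automorphism back from them
    ([fs_bad_of_norm], [fs_bad_lift]).

    What resists induction is [constrained_bad]. There A / W is Out_F(Q), with A the ambient
    elements acting on Q as F does and W = Q 'C(Q). [pelt_centralize_pcore] gives it a normal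
    p-complement, and coprime action finds inside a nontrivial abelian p'-group H / W normalized by
    P. That H normalizes Z is [center_thompson_invariant]. Oddness of p enters twice: in
    [quadratic_cent], where 2 must be cancelled in a matrix ring, and in [glauberman_commute], where
    a commutator of order at most 2 must vanish.

    Fusion systems become sets of permutations through the regular representation: [rho_realize]
    makes every morphism a conjugation, and [real_fsys] and [real_sat] carry the axioms over. *)

Set Implicit Arguments.
Unset Strict Implicit.
Unset Printing Implicit Defensive.

Import GroupScope.

(** * p-stability for abelian p'-groups *)

Section QuadraticPairs.
Import GRing.Theory.
Local Open Scope ring_scope.

(* The commutation relation reduces to [a b a = - b a b], so that all         *)
(* alternating words of length 4 in a and b vanish.                           *)
Lemma quadratic_pair_nilp (R : nzRingType) (a b : R) :
    (forall r : R, r *+ 2 = 0 -> r = 0) -> a * a = 0 -> b * b = 0 ->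
    GRing.comm ((1 - a) * (1 + b)) ((1 + b) * (1 - a)) ->
  ((1 - a) * (1 + b) - 1) ^+ 4 = 0.
Proof.
move=> two aa bb cww.
have aax r : r * a * a = 0 by rewrite -mulrA aa mulr0.
have bbx r : r * b * b = 0 by rewrite -mulrA bb mulr0.
have exp := (@mulrDl R, @mulrDr R, @mulrN R, @mulNr R, @mulr1 R, @mul1r R,
  @mulrA R, aa, bb, aax, bbx, @mul0r R, @mulr0 R, @oppr0 R, @subr0 R, @sub0r R,
  @addr0 R, @add0r R, @opprD R, @opprK R).
have e1 : (1 - a) * (1 + b) * ((1 + b) * (1 - a)) = 1 - a *+ 2 + b *+ 2 - (a *
  b) *+ 2 - (b * a) *+ 2 + (a * b * a) *+ 2.
  rewrite !mulr2n !exp !addrA.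
  by rewrite (ACl (1*3*7*2*5*4*6*8*10*9*11)%AC).
have e2 : (1 + b) * (1 - a) * ((1 - a) * (1 + b)) = 1 - a *+ 2 + b *+ 2 - (a *
  b) *+ 2 - (b * a) *+ 2 - (b * a * b) *+ 2.
  rewrite !mulr2n !exp !addrA.
  by rewrite (ACl (1*2*5*3*7*8*10*4*6*9*11)%AC).
have Eaba : a * b * a = - (b * a * b).
  apply/eqP; rewrite -addr_eq0; apply/eqP/two.
  move: cww; rewrite /GRing.comm e1 e2 => /addrI/eqP.
  by rewrite -addr_eq0 -mulrnDl => /eqP.
have abab : a * b * a * b = 0 by rewrite Eaba mulNr bbx oppr0.
have baba : b * a * b * a = 0 by move/eqP: Eaba; rewrite -eqr_oppLR => /eqP <-;
  rewrite mulNr aax oppr0.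
have bab : b * a * b = - (a * b * a) by rewrite Eaba opprK.
pose s := b - a - a * b.
have -> : (1 - a) * (1 + b) - 1 = s.
  by rewrite /s !exp !addrA (ACl (1*5*2*3*4)%AC) /= subrr add0r.
have E2 : s * s = (a * b * a) *+ 2 - a * b - b * a.
  by rewrite /s !exp abab bab !exp mulr2n (ACl (2*4*3*1)%AC).
have E3 : s * (s * s) = (a * b * a) *+ 2.
  by rewrite E2 /s mulr2n !exp abab baba bab !exp.

by rewrite !exprS expr0 mulr1 E3 /s mulr2n !exp abab baba !exp.
Qed.

End QuadraticPairs.

Lemma pelt_p'elt_eq1 (p : nat) (gT : finGroupType) (x : gT) :
  p.-elt x -> p^'.-elt x -> x = 1.
Proof.
by move=> px p'x; apply/eqP; rewrite -order_eq1; apply/eqP; apply: pnat_1 p'x.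
Qed.

Section QuadraticAction.
Import GRing.Theory.
Variables (gT : finGroupType) (p : nat).
Implicit Types (V N : {group gT}).

Lemma coprime_expg_mem (H : {group gT}) w m n :
  coprime m n -> w ^+ m \in H -> w ^+ n \in H -> w \in H.
Proof.
move=> co Hm Hn; case: m co Hm => [|m] co Hm.
  by move: co; rewrite /coprime gcd0n => /eqP n1; rewrite -[w]expg1 -n1.
have [km kn e _] := egcdnP n (ltn0Sn m).
rewrite (eqP co) in e.
have: w ^+ (km * m.+1) \in H by rewrite mulnC expgM groupX.
rewrite e expgD expg1 groupMl // mulnC expgM groupX //.
Qed.

(* On V, write x = 1 + a and x ^ k = 1 + b; then w = [~ x, k] and its         *)
(* conjugate under x^-1 commute, so w is unipotent, hence a p-element.        *)
Lemma quadratic_cent V N x :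
    odd p -> p.-abelem V -> N \subset 'N(V) -> x \in 'N(V) -> x \in 'N(N) ->
    {in N &, forall u v, [~ u, v] \in 'C(V)} ->
    {in N, forall u, exists2 m, p^'.-nat m & u ^+ m \in 'C(V)} ->
    {in V, forall v, [~ v, x, x] = 1} ->
  {in N, forall k, [~ k, x] \in 'C(V)}.
Proof.
move=> odd_p abV nVN nVx nNx abN pN quad k Nk.
have [V1 | ntV] := eqsVneq V 1.
  by rewrite V1; apply/centP=> v /set1P->; apply: commute1.
have p_pr := abelem_pgroup abV; have {}p_pr: prime p.
  by have [] := pgroup_pdiv p_pr ntV.
pose X := (N <*> <[x]>)%G.
have nVX: X \subset 'N(V) by rewrite join_subG nVN cycle_subG.
have Xx: x \in X by rewrite mem_gen // inE cycle_id orbT.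
have XN u : u \in N -> u \in X by move=> Nu; rewrite mem_gen // inE Nu.
pose rG := abelem_repr abV ntV nVX.
have rG1P u : u \in X -> (rG u == 1%R) = (u \in 'C(V)).
  move=> Xu; transitivity (u \in rker rG).
    by rewrite inE mul1mx Xu.
  by rewrite rker_abelem inE Xu.
have rGM u v : u \in X -> v \in X -> rG (u * v) = (rG u * rG v)%R.
  by move=> Xu Xv; rewrite repr_mxM.
have Xk := XN k Nk.
pose a := (rG x - 1)%R; pose b := (rG (x ^ k)%g - 1)%R.
have aa : (a * a = 0)%R.
  apply/row_matrixP => i; rewrite row0 rowE; set v := delta_mx _ _.
  apply: (@rVabelem_inj _ _ _ abV ntV).
  have E u : (rVabelem abV ntV (u *m a) = [~ rVabelem abV ntV u, x]).
    rewrite mulmxBr mulmx1 rVabelemD rVabelemN rVabelemJ // commgEl.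
    have [/abelem_abelian/centsP cVV _] := (abV, 0).
    by apply: cVV; rewrite ?groupV ?memJ_norm ?mem_rVabelem.
  rewrite mulmxA !E quad ?mem_rVabelem //.
  by rewrite rVabelem0.
have rGx : rG x = (1 + a)%R by rewrite addrC subrK.
(* 1 - a inverts 1 + a, because a squares to 0. *)
have rGxV : rG x^-1 = (1 - a)%R.
  have U : rG x \is a GRing.unit by apply: (repr_mx_unit rG).
  rewrite (repr_mxV rG Xx). apply: (mulIr U).
  by rewrite mulVr // rGx mulrBl mul1r mulrDr mulr1 aa addr0 addrK.
have rGkk : (rG k^-1%g * rG k = 1)%R by rewrite -rGM ?groupV // mulVg repr_mx1.
have rGkk' : (rG k * rG k^-1%g = 1)%R by rewrite -rGM ?groupV // mulgV repr_mx1.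
have b_def : b = (rG k^-1%g * a * rG k)%R.
  rewrite /a mulrBr mulr1 mulrBl rGkk /b conjgE !rGM ?groupM
    ?groupV // mulrA //.
have bb : (b * b = 0)%R.
  by rewrite b_def !mulrA -[(_ * rG k * _)%R]mulrA rGkk' mulr1 -[(_ * a *
    a)%R]mulrA aa mulr0 mul0r.
have rGxk : rG (x ^ k)%g = (1 + b)%R by rewrite addrC subrK.
pose w := [~ x, k].
have Nw : w \in N.
  by rewrite /w commgEr groupM // memJ_norm ?groupV.
have w_def : w = x^-1 * x ^ k by rewrite /w commgEl.
have Xxk : x ^ k \in X by rewrite groupJ.
pose w' := x ^ k * x^-1.
have Nw' : w' \in N.
  have <- : w ^ x^-1 = w'.
    by rewrite (conjgE w) invgK w_def -(mulgA x^-1) mulKVg.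
  by rewrite memJ_norm ?groupV.
have rw : rG w = ((1 - a) * (1 + b))%R by rewrite w_def rGM
  ?groupV // rGxV rGxk.
have rw' : rG w' = ((1 + b) * (1 - a))%R by rewrite rGM ?groupV // rGxV rGxk.
have Xw := XN _ Nw; have Xw' := XN _ Nw'.
have w_com : [~ k, x] = w^-1 by rewrite invg_comm.
clearbody w w' b.
have cww : GRing.comm (rG w) (rG w').
  have Xc: [~ w, w'] \in X by rewrite groupR.
  have /eqP c1 : rG [~ w, w'] == 1%R by rewrite rG1P ?abN.
  rewrite /GRing.comm -!rGM // [w * w']commgC (rGM (w' * w)) ?groupM ?groupV //.
  exact: etrans (congr1 _ c1) (mulr1 _).
have pcharM : p \in [pchar 'M['F_p]_('dim V)]%R.
  rewrite inE p_pr /=. apply/eqP.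
  by rewrite -[(p%:R)%R]/(1%:M *+ p)%R -raddfMn /= -[(1 *+ p)%R]/(p%:R)%R
    pchar_Fp_0 // raddf0.
have two : forall r : 'M['F_p]_('dim V), (r *+ 2 = 0)%R -> (r = 0)%R.
  move=> r r2; have := mulrn_pchar pcharM r.
  have def_p : p = (2 * p./2).+1 by rewrite mul2n -add1n -{1}(odd_double_half
    p) odd_p.
  by rewrite [X in (_ *+ X)%R]def_p mulrSr mulrnA r2 mul0rn add0r.
have nilp := quadratic_pair_nilp two aa bb.
rewrite -rw -rw' in nilp; have {nilp} := nilp cww.
set s := (rG w - 1)%R => s4.
have rGX n u : u \in X -> rG (u ^+ n) = (rG u ^+ n)%R.
  move=> Xu; elim: n => [|n IHn]; first by rewrite expg0 repr_mx1 expr0.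
  by rewrite expgS rGM ?groupX // IHn exprS.
(* In characteristic p the p-th power is additive on commuting elements, so 1 + s raised to p * p is
   1 plus a power of s with exponent at least 4, which vanishes. *)
have wp2 : w ^+ (p * p) \in 'C(V).
  rewrite -rG1P ?groupX // rGX // -[rG w](subrK 1%R) -/s exprM.
  have F (y : 'M['F_p]_('dim V)) : ((y + 1) ^+ p = y ^+ p + 1)%R.
    by rewrite -[LHS](pFrobenius_autE pcharM) pFrobenius_autD_comm
      ?pFrobenius_aut1 //; apply: commr1.
  rewrite !F -exprM -subr_eq0 addrK.
  have /subnKC <- : 4 <= p * p.
    by apply: (@leq_mul 2 2); apply: prime_gt1.
  by rewrite exprD s4 mul0r.
have [m p'm wm] := pN _ Nw.
rewrite w_com groupV.
apply: (coprime_expg_mem _ wp2 wm).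
by rewrite coprimeMl !prime_coprime // -!p'natE // p'm.
Qed.
End QuadraticAction.

(** * Glauberman's replacement theorem *)

Section Replacement.
Variables (gT : finGroupType).
Implicit Types (A B D : {group gT}).

(** B has class at most 2, so commutators are bilinear on B. With a = [~ x, u] and b = [~ x, v], one
    gets [~ a, b] = [~ b, a], that is, [~ a, b] squares to 1; B has odd order. *)
Lemma glauberman_commute A B x :
    abelian A -> A \subset 'N(B) -> [~: B, B] \subset A ->
    [~: B, B] \subset 'C(B) -> odd #|B| -> x \in B ->
    {in A, forall u, [~ x, u] \in 'N(A)} ->
  {in A &, forall u v, commute [~ x, u] [~ x, v]}.
Proof.
move=> /centsP cAA nBA sB'A cB'B oddB Bx nA u v Au Av.
have R y t : y \in B -> t \in B -> [~ y, t] \in [~: B, B] by apply: mem_commg.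
have cR y t z : y \in B -> t \in B -> z \in B -> [~ y, t] ^ z = [~ y, t].
  move=> By Bt Bz; apply/conjg_fixP/commgP.
  by apply: (centP (subsetP cB'B _ (R _ _ By Bt))).
have Ml y z t : y \in B -> z \in B -> t \in B ->
  [~ y * z, t] = [~ y, t] * [~ z, t].
  by move=> By Bz Bt; rewrite commMgJ cR.
have Mr y z t : y \in B -> z \in B -> t \in B ->
  [~ t, y * z] = [~ t, y] * [~ t, z].
  move=> By Bz Bt; rewrite commgMJ cR //.
  by apply: (centP (subsetP cB'B _ (R _ _ Bt Bz)));
    apply: (subsetP (der_subS 0 B)); apply: R.
have Vl y t : y \in B -> t \in B -> [~ y^-1, t] = [~ y, t]^-1.
  by move=> By Bt; apply/eqP;
    rewrite eq_sym eq_invg_mul -Ml ?groupV // mulgV comm1g.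
have Vr y t : y \in B -> t \in B -> [~ t, y^-1] = [~ t, y]^-1.
  by move=> By Bt; apply/eqP;
    rewrite eq_sym eq_invg_mul -Mr ?groupV // mulgV commg1.
have Bxu w : w \in A -> [~ x, w] \in B.
  by move=> Aw; rewrite commgEl groupM ?groupV // memJ_norm ?(subsetP nBA).
have AB w t : w \in A -> t \in A -> [~ x, w, t] \in A.
  by move=> Aw At; rewrite commgEr groupM // memJ_norm ?nA ?groupV.
have BB w t : w \in A -> t \in A -> [~ x, w, t] \in B.
  by move=> Aw At; rewrite commgEl groupM ?groupV ?memJ_norm ?Bxu
    ?(subsetP nBA).
(* Bilinearity reduces this to [~ a, x ^ t] = [~ a ^ t^-1, x], which holds because t centralizes
   [~: B, B], both lying in the abelian group A. *)
have half w t : w \in A -> t \in A ->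
    [~ [~ x, w], [~ x, t]] = [~ [~ x, w, t], x]^-1.
  move=> Aw At; set a := [~ x, w]; have Ba: a \in B := Bxu w Aw.
  have Bxt : x ^ t \in B by rewrite memJ_norm ?(subsetP nBA).
  have Bat : a ^ t^-1 \in B by rewrite memJ_norm ?groupV ?(subsetP nBA).
  rewrite [[~ x, t]]commgEl Mr ?groupV // Vr //.
  have -> : [~ a, x ^ t] = [~ a ^ t^-1, x].
    rewrite -{1}(conjgKV t a) -conjRg; apply/conjg_fixP/commgP/cAA => //.
    exact: (subsetP sB'A _ (R _ _ Bat Bx)).
  have -> : a ^ t^-1 = a * [~ a, t]^-1.
    apply: (conjg_inj t); rewrite conjgKV conjMg conjVg.
    have -> : [~ a, t] ^ t = [~ a, t] by apply/conjg_fixP/commgP/cAA;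
      rewrite ?AB.
    by rewrite [a ^ t]conjg_mulR mulgK.
  by rewrite (Ml a) ?groupV ?(BB w t) // (Vl [~ a, t]) ?(BB w t) // mulKg.
set a := [~ x, u]; set b := [~ x, v].
have Ba: a \in B := Bxu u Au; have Bb: b \in B := Bxu v Av.
(* Compare the expansions of [~ x, u * v] and [~ x, v * u]. *)
have key : [~ a, v] = [~ a, b] * [~ b, u].
  have e : b * a ^ v = a * b ^ u by rewrite -!commgMJ (cAA u Au v Av).
  apply: (mulgI (b * a)); rewrite -mulgA -conjg_mulR e conjg_mulR.
  by rewrite mulgA (commgC a b) -mulgA.
have e1 := half u v Au Av; have e2 := half v u Av Au; rewrite -/a -/b in e1 e2.
have e3 : [~ a, b] = [~ b, a].
  rewrite e1 e2 key (Ml [~ a, b]) ?(groupR Ba) ?(BB v u) //; congr (_^-1).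
  suff -> : [~ [~ a, b], x] = 1 by rewrite mul1g.
  by apply/eqP/commgP; apply: (centP (subsetP cB'B _ (R _ _ Ba Bb))).
suff ab1 : [~ a, b] = 1 by have := commgC a b; rewrite ab1 mulg1.
have Bab : [~ a, b] \in B by rewrite groupR.
have ab2 : [~ a, b] * [~ a, b] = 1 by rewrite {2}e3 -invg_comm mulVg.
move: [~ a, b] Bab ab2 => z Bz zz.
have oz : coprime #|B| 2 by rewrite coprimen2.
have: z ^+ 2 = 1 ^+ 2 by rewrite expg1n expgS expg1.
by apply: (can_in_inj (expgK oz)).
Qed.

(* Thompson's count: [u |-> [~ x, u] (M :&: A)] separates cosets of 'C_A(M).  *)
Lemma replacement_order A x (M := << [set [~ x, u] | u in A] >>) :
  abelian A -> abelian M -> #|A| <= #|M * 'C_A(M)|.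
Proof.
move=> cAA cMM; have cA := centsP cAA.
have Mx u : u \in A -> [~ x, u] \in M by move=> Au; rewrite mem_gen ?imset_f.
have key u v : u \in A -> v \in A ->
    [~ x, u]^-1 * [~ x, v] \in A -> v * u^-1 \in 'C_A(M).
  move=> Au Av Auv; set w := v * u^-1.
  have Aw : w \in A by rewrite groupM ?groupV.
  have xw : [~ x, u]^-1 * [~ x, v] = [~ x, w] ^ u.
    by rewrite !commgEl conjMg -conjgM mulgKV invMg invgK conjVg !mulgA mulgK.
  have Axw : [~ x, w] \in A by rewrite -(memJ_norm _ (subsetP (normG A) u Au))
    -xw.
  rewrite inE Aw cent_gen; apply/centP=> _ /imsetP[a Aa ->].
  set z := [~ x, w] in xw Axw.
  have xaw : (x ^ a) ^ w = x ^ a * z.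
    rewrite -conjgM (cA a Aa w Aw) conjgM [x ^ w]conjg_mulR conjMg -/z.
    by congr (_ * _); apply/conjg_fixP/commgP/cA.
  apply/commute_sym/commgP/conjg_fixP.
  transitivity ([~ x, a] ^ z).
    rewrite !commgEl conjMg conjVg xaw [x ^ w]conjg_mulR -/z.
    by move: (x ^ a) (z) => y t; rewrite invMg conjgE !mulgA.
  by apply/conjg_fixP/commgP; apply: (centsP cMM); apply: Mx.
pose C := 'C_A(M)%G.
have tiMC : M :&: 'C_A(M) = M :&: A.
  apply/setP=> y; rewrite !inE; case My: (y \in M) => //=;
    case: (y \in A) => //=.
  exact: (subsetP cMM).
pose MA := (<< [set [~ x, u] | u in A] >> :&: A)%G.
have le_idx : #|A : C| <= #|M : MA|.
  pose f (X : {set gT}) := [~ x, repr X] *: MA.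
  have Ar z : z \in A -> repr (C :* z) \in A.
    by move=> Az; case: repr_rcosetP => c /setIP[Ac _]; rewrite groupM.
  have inj : {in rcosets C A &, injective f}.
    move=> _ _ /rcosetsP[u Au ->] /rcosetsP[v Av ->].
    move/lcoset_eqP; rewrite mem_lcoset => /setIP[_ uv].
    have := key _ _ (Ar v Av) (Ar u Au) uv.
    by rewrite -mem_rcoset => /rcoset_eqP; rewrite !rcoset_repr.
  apply: (@leq_trans #|f @: rcosets C A|); first by rewrite card_in_imset.
  rewrite -card_lcosets subset_leq_card //.
  apply/subsetP=> _ /imsetP[_ /rcosetsP[u Au ->] ->].
  by apply/lcosetsP; exists [~ x, repr (C :* u)] => //; apply/Mx/Ar.
have sMAM : MA \subset M := subsetIl _ _.
rewrite -(leq_pmul2r (cardG_gt0 MA)).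
have -> : (#|(M * 'C_A(M))%g| * #|MA| = #|M| * #|C|)%N.
  rewrite -[gval MA]tiMC.
  exact: esym (mul_cardG << [set [~ x, u] | u in A] >> C).
rewrite -(Lagrange (subsetIl A 'C(M))) -(Lagrange sMAM).
rewrite mulnAC [(#|MA| * _ * _)%N]mulnAC [(#|_| * #|MA|)%N]mulnC leq_mul2l.
by rewrite le_idx orbT.
Qed.

(** As A 'N_B(A) is proper in the nilpotent group AB, some x in B outside it normalizes it. Let M be
    generated by the [~ x, v] for v in A: it lies in 'N_B(A) and is abelian by [glauberman_commute].
    The replacement is M 'C_A(M), which by [replacement_order] is at least as large as A. *)
Lemma glauberman_replacement (p : nat) (D A B : {group gT}) :
    p.-group D -> odd p -> max_order_abelian D A -> B <| D ->
    [~: B, B] \subset A -> [~: B, B] \subset 'C(B) -> ~~ (B \subset 'N(A)) ->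
  exists2 A1, max_order_abelian D A1 &
    A :&: B \proper A1 :&: B /\ A1 \subset 'N(A).
Proof.
move=> pD oddp /and3P[sAD cAA /forallP maxA] /andP[sBD nBD] sB'A cB'B not_nAB.
have nBA := subset_trans sAD nBD.
pose N := ('N_B(A))%G; have sNB : N \subset B := subsetIl _ _.
have nNA : A \subset 'N(N) by rewrite normsI ?norms_norm ?normG.
have nAN : N \subset 'N(A) := subsetIr _ _.
pose AN := (A <*> N)%G; pose AB := (A <*> B)%G.
have dAN : AN = A * N :> {set gT} by rewrite /= norm_joinEr.
have dAB : AB = A * B :> {set gT} by rewrite /= norm_joinEl.
have sABD : AB \subset D by rewrite join_subG sAD.
have ltAN : AN \proper AB.
  rewrite properE genS ?setUS //=; apply: contra not_nAB => sABAN.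
  have sBAN : B \subset A * N by rewrite -dAN (subset_trans _ sABAN)
    ?joing_subr.
  by apply: subset_trans sBAN _; rewrite mulG_subG normG.
have := nilpotent_proper_norm (pgroup_nil (pgroupS sABD pD)) ltAN.
case/properP=> _ [y /setIP[ABy nANy] AN'y].
have /mulsgP[u x Au Bx def_y] : y \in A * B by rewrite -dAB.
have ANA u1 : u1 \in A -> u1 \in AN by move=> Au1; rewrite mem_gen // inE Au1.
have nANx : x \in 'N(AN).
  by move: nANy; rewrite def_y (groupMl _ (subsetP (normG AN) u (ANA u Au))).
have AN'x : x \notin AN by move: AN'y; rewrite def_y (groupMl _ (ANA u Au)).
have xN v : v \in A -> [~ x, v] \in N.
  move=> Av; have BR : [~ x, v] \in B.
    by rewrite commgEl groupM ?groupV // memJ_norm ?(subsetP nBA).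
  have : [~ x, v] \in AN by rewrite commgEr (groupMr _ (ANA v Av)) memJ_norm
    // groupV ANA.
  rewrite dAN => /mulsgP[a n Aa Nn def_xv].
  rewrite def_xv groupMr // inE; apply/andP; split;
    last exact: (subsetP (normG A)).
  by rewrite -(groupMr _ (subsetP sNB _ Nn)) -def_xv.
have oddB : odd #|B|.
  by rewrite (odd_pgroup_odd oddp) // (pgroupS sBD).
have comm := glauberman_commute cAA nBA sB'A cB'B oddB Bx.
pose M := << [set [~ x, v] | v in A] >>%G.
have sMN : M \subset N by rewrite gen_subG; apply/subsetP=> _ /imsetP[v Av ->];
  apply: xN.
have cMM : abelian M.
  rewrite /abelian cent_gen gen_subG;
    apply/centsP=> _ /imsetP[v Av ->] _ /imsetP[w Aw ->].
  by apply: comm => // t At; apply: (subsetP nAN); apply: xN.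
have sMB := subset_trans sMN sNB.
pose C := 'C_A(M)%G; have sCA : C \subset A := subsetIl _ _.
have cMC : C \subset 'C(M) := subsetIr _ _.
have dA1 : (M <*> C)%G = M * C :> {set gT} by rewrite /= cent_joinEr.
have sA1D : (M <*> C)%G \subset D by rewrite join_subG (subset_trans sMB)
  // (subset_trans sCA).
have cA1 : abelian (M <*> C)%G.
  by rewrite /= cent_joinEr // abelianM cMM (abelianS sCA cAA) cMC.
exists (M <*> C)%G; last split.
- apply/and3P; split=> //; apply/forallP=> E; apply/implyP=> hE.
  apply: leq_trans (implyP (maxA E) hE) _.
  by rewrite dA1 (@replacement_order A x cAA cMM).
- rewrite properE subsetI subsetIr andbT; apply/andP; split.
    (* A :&: B centralizes M: for t in A :&: B, the commutator [~ x, t] is centralized by both A and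
       B. *)
    apply: subset_trans (joing_subr M C); rewrite subsetI subsetIl /= cent_gen.
    apply/centsP=> t /setIP[At Bt] _ /imsetP[v Av ->].
    apply/commute_sym/commgP/conjg_fixP.
    have Bxt : [~ x, t] \in [~: B, B] by apply: mem_commg.
    rewrite commgEl conjMg conjVg -conjgM (centsP cAA v Av t At) conjgM.
    rewrite [x ^ t]conjg_mulR conjMg.
    have -> : [~ x, t] ^ v = [~ x, t].
      by apply/conjg_fixP/commgP; apply: (centsP cAA) => //;
        apply: (subsetP sB'A).
    have Bxv : x^-1 * x ^ v \in B by rewrite groupM ?groupV // memJ_norm
      ?(subsetP nBA).
    have := centP (subsetP cB'B _ Bxt) _ Bxv.
    move: [~ x, t] (x ^ v) => z w /commute_sym e.
    by rewrite invMg -mulgA (mulgA x^-1) e mulKg.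
  (* If the intersection with B did not grow, M would lie in A, so x would normalize A and belong to
     A 'N_B(A). *)
  apply: contraL AN'x => sub; rewrite negbK mem_gen // inE.
  suff nAx : x \in 'N(A) by rewrite !inE Bx andbC; move: nAx;
    rewrite inE => ->; rewrite orbT.
  rewrite inE; apply/subsetP=> _ /imsetP[v Av ->].
  have : [~ x, v] \in A :&: B.
    apply: (subsetP sub); rewrite inE (subsetP sMB) ?andbT;
      first rewrite mem_gen // inE.
      by rewrite mem_gen ?imset_f.
    by rewrite mem_gen ?imset_f.
  by case/setIP=> Axv _; rewrite conjg_mulR -invg_comm groupM ?groupV.
- by rewrite join_subG (subset_trans sMN nAN) (subset_trans sCA) ?normG.
Qed.
End Replacement.

(** * Frobenius' normal p-complement theorem *)

Section NormalComplement.
Import FiniteModule.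
Variable p : nat.

Lemma pgroup_pelt (gT : finGroupType) (G : {group gT}) :
  {in G, forall x, p.-elt x} -> p.-group G.
Proof.
move=> pG; apply/pgroupP=> q q_pr /(Cauchy q_pr)[x Gx ox].
by have := pG x Gx; rewrite /p_elt ox pnatE.
Qed.

(** N / C is a p-group, so it is the image of any Sylow p-subgroup of N. *)
Lemma pelt_sub_mul_Sylow (gT : finGroupType) (N C S : {group gT}) :
    C <| N -> {in N, forall y, p^'.-elt y -> y \in C} -> p.-Sylow(N) S ->
  N \subset C * S.
Proof.
move=> /andP[sCN nCN] p'C sylS; have [sSN _ _] := and3P sylS.
have nCS := subset_trans sSN nCN.
rewrite -quotientSK //; have <- // : S / C = N / C.
apply: pHall_id (quotient_pHall nCS sylS) _;
  apply: pgroup_pelt => _ /morphimP[y Ny Gy ->].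
have Ny' : y.`_p^' \in 'N(C) by rewrite (subsetP nCN) ?groupX.
rewrite -(consttC p y) morphM ?groupX //= [coset C y.`_p^']coset_id ?mulg1.
  by rewrite morph_p_elt ?p_elt_constt ?groupX.
by rewrite p'C ?p_elt_constt ?groupX.
Qed.

Variable gT : finGroupType.
Implicit Types (G S U V R C : {group gT}).

(** Frobenius' condition that 'N_G(U) / 'C_G(U) is a p-group for every p-subgroup U. *)
Definition pelt_centralize G := forall U y,
  p.-group U -> U \subset G -> y \in 'N_G(U) -> p^'.-elt y -> y \in 'C(U).

(** Induction on #|S| - #|U|. Both U and U :^ g are compared with a conjugate R such that 'N_S(R) is
    Sylow in 'N_G(R); the hypothesis on G then gives 'N_G(R) = 'C_G(R) 'N_S(R). *)
Lemma pelt_centralize_fusion G S : pelt_centralize G -> p.-Sylow(G) S ->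
  forall U g, U \subset S -> g \in G -> U :^ g \subset S ->
  exists2 s, s \in S & {in U, forall u, u ^ g = u ^ s}.
Proof.
move=> pcG sylS; have [sSG pS _] := and3P sylS => U.
have [n] := ubnP (#|S| - #|U|); elim: n U => // n IHn U ltn g sUS Gg sUgS.
have pU := pgroupS sUS pS; have sUG := subset_trans sUS sSG.
have [|T sylT sUT] := @Sylow_superset p _ 'N_G(U) U _ pU;
  first by rewrite subsetI sUG normG.
have [sTN pT _] := and3P sylT.
have [h Gh sThS] := Sylow_Jsub sylS (subset_trans sTN (subsetIl _ _)) pT.
pose R := (U :^ h)%G.
have sRS : R \subset S by rewrite (subset_trans _ sThS) ?conjSg.
have sylR : p.-Sylow('N_G(R)) 'N_S(R).
  have sThN : T :^ h \subset 'N_S(R).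
    by rewrite subsetI sThS normJ conjSg (subset_trans sTN) ?subsetIr.
  have sylTh : p.-Sylow('N_G(R)) (T :^ h).
    by rewrite normJ -{1}(conjGid Gh) -conjIg pHallJ2.
  rewrite (sub_pHall sylTh _ sThN) ?setSI //.
  by apply: pgroupS pS; apply: subsetIl.
have NR : 'N_G(R) \subset 'C_G(R) * 'N_S(R).
  apply: pelt_sub_mul_Sylow sylR => [|y Ny p'y]; first exact: subcent_normal.
  by rewrite inE (subsetP (subsetIl _ _) _ Ny) (pcG R) ?(subset_trans sRS)
    ?(pgroupS sRS).
(* Unless V = S, an element of 'C_G(R) corrects k so that it maps 'N_S(V) into S; this group is
   larger than V and induction applies to it. *)
have claim V k : V \subset S -> k \in G -> V :^ k = R ->
    exists2 s, s \in S & {in V, forall v, v ^ k = v ^ s}.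
  move=> sVS Gk Vk.
  have [eVS | neVS] := eqVneq (V : {set gT}) S.
    have eRS : R = S :> {set gT} by apply/eqP;
      rewrite eqEcard sRS -Vk cardJg eVS leqnn.
    have : k \in 'N_G(R) by rewrite inE Gk inE {1}eRS -eVS Vk subxx.
    case/(subsetP NR)/mulsgP=> c s /setIP[_ cRc] /setIP[Ss _] -> ;
      exists s => // v Vv.
    rewrite conjgM; congr (_ ^ s);
      apply/conjg_fixP/commgP/commute_sym/(centP cRc).
    by rewrite eRS -eVS.
  have ltVN : V \proper 'N_S(V).
    by apply: nilpotent_proper_norm (pgroup_nil pS) _; rewrite properEneq neVS.
  have sNk : 'N_S(V) :^ k \subset 'N_G(R).
    by rewrite -Vk normJ -{1}(conjGid Gk) -conjIg conjSg setSI.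
  have pNk : p.-group ('N_S(V) :^ k) by rewrite pgroupJ (pgroupS (subsetIl _
    _)).
  have [y] := Sylow_Jsub sylR sNk pNk.
  case/(subsetP NR)/mulsgP=> c t /setIP[Gc cRc] NSt -> sub.
  have {}sub : 'N_S(V) :^ (k * c) \subset S.
    rewrite -conjsgM mulgA conjsgM in sub.
    rewrite (subset_trans _ (subsetIl S 'N(R))) //.
    by rewrite -(conjSg _ _ t) (conjGid NSt).
  have [||||s Ss act] := IHn ('N_S(V))%G _ (k * c) => //.
  - apply: leq_trans (ltn_sub2l _ (proper_card ltVN)) _.
      by apply: leq_trans (proper_card ltVN) (subset_leq_card (subsetIl _ _)).
    by rewrite -(cardJg V k) Vk cardJg -ltnS.
  - exact: subsetIl.
  - by rewrite groupM.
  exists s => // v Vv; rewrite -act ?(subsetP (proper_sub ltVN)) // conjgM.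
  apply/esym/conjg_fixP/commgP/commute_sym/(centP cRc).
  by rewrite -Vk memJ_conjg.
have [s1 Ss1 act1] := claim U h sUS Gh (erefl _).
have [||s2 Ss2 act2] := claim (U :^ g)%G (g^-1 * h) sUgS.
- by rewrite groupM ?groupV.
- by rewrite /= -conjsgM mulKVg.
exists (s1 * s2^-1) => [|u Uu]; first by rewrite groupM ?groupV.
apply: (conjg_inj s2); rewrite -act2 ?memJ_conjg // -!conjgM mulgKV mulKVg;
  exact: act1.
Qed.

(* Fusion in G being controlled by S, the transfer G -> S / S^`(1) maps       *)
(* x \in S to the class of x ^+ #|G : S|.                                     *)
Lemma pelt_centralize_pcore G : prime p -> pelt_centralize G ->
  p.-nat #|G : 'O_p^'(G)|.
Proof.
move=> p_pr; have [n] := ubnP #|G|; elim: n G => // n IHn G ltGn pcG.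
have [S sylS] := Sylow_exists p G; have [sSG pS _] := and3P sylS.
have [S1 | ntS] := eqsVneq S 1.
  suff -> : 'O_p^'(G) = G by rewrite indexgg.
  apply: pcore_pgroup_id; rewrite /pgroup -partn_eq1 //.
  by rewrite -(card_Hall sylS) S1 cards1.
pose S' := S^`(1)%G.
have nS'S : S \subset 'N(S') := der_norm 1 S.
pose alpha := restrm_morphism nS'S (coset_morphism S').
have imA : alpha @* S = S / S' by rewrite morphim_restrm setIid.
have abelA : abelian (alpha @* S) by rewrite imA (der_abelian 0).
pose tau := transfer_morphism G abelA; pose N := ('ker tau)%G.
have nsNG : N <| G := ker_normal _.
have kerS x : x \in S -> x \in N -> x \in S'.
  move=> Sx Nx; have Gx := subsetP sSG x Sx.
  have trX := transversalP (rcosets_cycle_partition sSG Gx).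
  have Sax : coset S' x \in alpha @* S by rewrite imA mem_quotient.
  have E : tau x = (fmod abelA (coset S' x) *+ #|G : S|)%R.
    rewrite /= (transfer_cycle_expansion sSG abelA Gx trX).
    rewrite -(sum_index_rcosets_cycle sSG Gx trX) -GRing.sumrMnr.
    apply: eq_bigr => y Xy; set m := #|_ : _|.
    have Gy : y \in G by apply: (subsetP (transversal_sub trX)).
    have Sxm : x ^+ m \in S by rewrite groupX.
    have Sxmy : x ^+ m ^ y^-1 \in S.
      have := mulg_exp_card_rcosets S x y; rewrite -/m mem_rcoset.
      by rewrite conjgE invgK mulgA.
    (* By control of fusion, each factor of the transfer is S-conjugate to x ^+ m, hence equal to it
       modulo S'. *)
    have [||| s Ss act] := @pelt_centralize_fusion G S pcG sylS <[x ^+ m]>%G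
      y^-1.
    - by rewrite cycle_subG.
    - by rewrite groupV.
    - by rewrite -cycleJ cycle_subG.
    rewrite /restrm /= act ?cycle_id // morphJ ?groupX ?(subsetP nS'S) //=.
    have cSS : abelian (S / S') by apply: (der_abelian 0).
    rewrite [X in fmod _ X](_ : _ = coset S' x ^+ m).
      by rewrite fmodX.
    rewrite morphX ?(subsetP nS'S) //; apply/conjg_fixP/commgP.
    by apply: (centsP cSS); rewrite ?groupX ?mem_quotient.
  have := mker Nx; rewrite E -fmodX // => /(congr1 fmval).
  rewrite fmodK ?groupX // -morphX ?(subsetP nS'S) // => /coset_idr xS'.
  apply: (@coprime_expg_mem _ S' x #|S| #|G : S|); last 1 first.
  - by apply: xS'; rewrite groupX // (subsetP nS'S).
  - by apply: pnat_coprime pS _; have [] := and3P sylS.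
  by rewrite expg_cardG.
have sSN : ~~ (S \subset N).
  have := sol_der1_proper (pgroup_sol pS) (subxx S) ntS.
  rewrite properE => /andP[_]; apply: contra => sSN.
  by apply/subsetP=> x Sx; apply: kerS => //; apply: (subsetP sSN).
have ltNG : N \proper G.
  by rewrite properEneq (normal_sub nsNG) andbT; apply: contraNneq sSN => ->.
have pcN : pelt_centralize N.
  move=> U y pU sUN /setIP[Ny nUy]; apply: pcG => //.
    by rewrite (subset_trans sUN) ?normal_sub.
  by rewrite inE nUy (subsetP (normal_sub nsNG)).
have pNK := IHn N (leq_trans (proper_card ltNG) ltGn) pcN.
(* G / N embeds in S / S', so its exponent divides #|S|. *)
have pGN : p.-nat #|G : N|.
  rewrite -card_quotient ?normal_norm //;
    apply: pgroup_pelt => _ /morphimP[y Ny Gy ->].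
  have : coset N y ^+ #|S| == 1.
    rewrite -morphX //= coset_id // inE groupX // inE;
      apply/set1P/(@fmod_inj _ _ abelA).
    rewrite (morphX tau) //.
    transitivity (fmval (tau y) ^+ #|S|); first exact: (fmvalZ #|S| (tau y)).
    apply/eqP; rewrite -order_dvdn.
    apply: dvdn_trans (order_dvdG (fmodP (tau y))) _.
    exact: dvdn_morphim.
  by rewrite -order_dvdn /p_elt => /pnat_dvd; apply.
have sKG : 'O_p^'(N) \subset 'O_p^'(G).
  apply: pcore_max (pcore_pgroup _ _) _; apply: char_normal_trans nsNG;
    exact: pcore_char.
apply: pnat_dvd (indexgS G sKG) _.
by rewrite -(Lagrange_index (normal_sub nsNG) (pcore_sub _ _)) pnatM pGN.
Qed.
End NormalComplement.

(** * The Thompson subgroup *)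

Section Thompson.
Variable gT : finGroupType.
Implicit Types A B D E : {group gT}.

Lemma thompson_sub D : thompson D \subset D.
Proof. by rewrite gen_subG; apply/bigcupsP=> A /and3P[]. Qed.

Lemma max_order_abelian_sub D A : max_order_abelian D A -> A \subset thompson D.
Proof. by move=> mA; rewrite sub_gen // (bigcup_sup A). Qed.

Lemma max_order_abelian_exists D B : B \subset D -> abelian B ->
  exists2 A, max_order_abelian D A & #|B| <= #|A|.
Proof.
move=> sBD cBB; pose aD (A : {group gT}) := (A \subset D) && abelian A.
have aB : aD B by rewrite /aD sBD.
case: (@arg_maxnP _ B aD (fun A => #|A|) aB) => A /andP[sAD cAA] maxA.
exists A; last exact: maxA.
by apply/and3P; split=> //; apply/forallP=> E; apply/implyP=> /maxA.
Qed.

Lemma max_order_abelianJ D A g :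
  max_order_abelian (D :^ g) (A :^ g) = max_order_abelian D A.
Proof.
rewrite /max_order_abelian conjSg abelianJ; congr [&& _, _ & _].
apply/forallP/forallP=> maxA B; apply/implyP=> /andP[sBD cBB].
  by have := implyP (maxA (B :^ g)%G); rewrite /= !cardJg conjSg abelianJ sBD;
    apply.
have := implyP (maxA (B :^ g^-1)%G); rewrite /= !cardJg abelianJ sub_conjgV cBB.
by rewrite sBD; apply.
Qed.

Lemma thompsonJ D g : thompson (D :^ g) = thompson D :^ g :> {set gT}.
Proof.
rewrite /= -genJ; congr <<_>>; apply/setP=> x; rewrite mem_conjg.
apply/bigcupP/bigcupP=> [] [A mA Ax].
  exists (A :^ g^-1)%G; last by rewrite mem_conjg invgK conjgKV.
  rewrite -(max_order_abelianJ _ _ g); have -> // : ((A :^ g^-1) :^ g)%G = A.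
  by apply/group_inj; rewrite /= conjsgKV.
by exists (A :^ g)%G; rewrite ?max_order_abelianJ ?mem_conjg.
Qed.

Lemma norm_center (G : {group gT}) : 'N(G) \subset 'N('Z(G)).
Proof. by rewrite normsI ?norms_cent. Qed.

Lemma norm_thompson D : 'N(D) \subset 'N('Z(thompson D)).
Proof.
apply: subset_trans (norm_center _).
apply/subsetP=> g nDg; apply/normP; rewrite -thompsonJ.
by congr (gval (thompson _)); apply/group_inj/normP.
Qed.

(** A commutes with the center, being inside [thompson D]; their product is thus abelian, and
    maximality of #|A| absorbs it into A. *)
Lemma center_thompson_sub D A :
  max_order_abelian D A -> 'Z(thompson D) \subset A.
Proof.
move=> mA; have [sAD cAA maxA] := and3P mA.
have cAZ : 'Z(thompson D) \subset 'C(A).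
  by rewrite (subset_trans (subsetIr _ _)) // centS // max_order_abelian_sub.
have := implyP (forallP maxA ('Z(thompson D) <*> A)%G).
rewrite /= join_subG sAD (subset_trans (center_sub _)) ?thompson_sub //=.
rewrite [abelian _]/= cent_joinEl // abelianM center_abelian cAA centsC cAZ.
rewrite -cent_joinEl // => /(_ isT) leA.
have /eqP -> : A :==: 'Z(thompson D) <*> A by rewrite eqEcard joing_subr.
exact: joing_subl.
Qed.

(** Since A lies in E, the maximal order of an abelian subgroup is the same in E and in D. *)
Lemma thompsonS D E A : E \subset D -> max_order_abelian D A -> A \subset E ->
  max_order_abelian E A /\ thompson E \subset thompson D.
Proof.
move=> sED /and3P[sAD cAA /forallP maxA] sAE.
have mEA : max_order_abelian E A.
  apply/and3P; split=> //; apply/forallP=> B; apply/implyP=> /andP[sBE cBB].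
  by apply: (implyP (maxA B)); rewrite (subset_trans sBE).
split=> //; rewrite gen_subG; apply/bigcupsP=> B /and3P[sBE cBB /forallP maxB].
apply: max_order_abelian_sub; apply/and3P; split=> //.
  exact: subset_trans sBE sED.
apply/forallP=> X; apply/implyP=> hX; apply: leq_trans (implyP (maxA X) hX) _.
by apply: (implyP (maxB A)); rewrite sAE.
Qed.

Lemma center_thompson_neq1 (p : nat) D : p.-group D -> D :!=: 1 ->
  'Z(thompson D) != 1.
Proof.
move=> pD ntD; have nilJ : nilpotent (thompson D) :=
  pgroup_nil (pgroupS (thompson_sub D) pD).
rewrite center_nil_eq1 //.
have /trivgPn[x Dx ntx] := ntD.
have [||A mA leA] := @max_order_abelian_exists D <[x]>%G;
  rewrite ?cycle_subG ?cycle_abelian //.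
have ntA : A :!=: 1 by rewrite -cardG_gt1 (leq_trans _ leA)
  // cardG_gt1 cycle_eq1.
by apply: contraNneq ntA => /= e; rewrite -subG1 -e;
  apply: max_order_abelian_sub.
Qed.
End Thompson.

(** * The constrained case *)

(* L acts on Q, with 'C_L(Q) absorbed in W; H / W plays the role of an        *)
(* abelian p'-subgroup of Out_F(Q), and regH says that no nontrivial normal   *)
(* subgroup of P / Q has fixed points on it.                                  *)
Section Extremal.
Variables (gT : finGroupType) (p : nat) (P Q H L W : {group gT}).
Hypotheses (p_odd : odd p) (pP : p.-group P).
Hypotheses (sQP : Q \subset P) (nsHL : H <| L) (sPL : P \subset L).
Hypotheses (nQL : L \subset 'N(Q)) (sQW : Q \subset W) (nsWL : W <| L).
Hypothesis (sWH : W \subset H).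
Hypothesis WE : W \subset Q * 'C(Q).
Hypotheses (p'H : p^'.-nat #|H : W|) (abH : [~: H, H] \subset W).
Hypothesis regH : forall N1 : {group gT}, N1 <| P -> Q \proper N1 ->
  {in H, forall y, p^'.-elt y -> [~: [set y], N1] \subset W -> y \in W}.

Let sHL := normal_sub nsHL.
Let nHL := normal_norm nsHL.
Let nWL := normal_norm nsWL.
Let nsWH : W <| H := normalS sWH sHL nsWL.
Let pQ : p.-group Q := pgroupS sQP pP.

(** Coprime action: the fixed points of y on B / B1 are the image of its fixed points on B. *)
Lemma pelt_cent_chain (B B1 : {group gT}) y : p.-group B -> B1 <| B ->
  y \in 'N(B) ->
    y \in 'N(B1) -> p^'.-elt y -> y \in 'C(B1) ->
      {in B, forall b, [~ b, y] \in B1} ->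
  y \in 'C(B).
Proof.
move=> pB /andP[sB1B nB1B] nBy nB1y p'y cB1y sub.
have coBy : coprime #|B| #|<[y]>| := pnat_coprime pB p'y.
have nBy' : <[y]> \subset 'N(B1) by rewrite cycle_subG.
have := coprime_quotient_cent sB1B nBy' coBy (pgroup_sol pB).
have -> : 'C_(B / B1)(<[y]> / B1) = B / B1.
  apply/setIidPl; rewrite quotient_cycle // cent_cycle.
  apply/subsetP=> _ /morphimP[b Nb Bb ->]; apply/cent1P/commgP.
  by rewrite -morphR //= coset_id ?sub.
move=> e; have : B / B1 \subset 'C_B(<[y]>) / B1 by rewrite e.
rewrite quotientSK // mulSGid; last first.
  by rewrite subsetI sB1B /= cent_cycle sub_cent1.
by rewrite subsetI subxx /= cent_cycle sub_cent1.
Qed.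

(* [~: H, A] acts trivially on each factor of the series obtained by          *)
(* iterating B |-> 'Phi(B) <*> [~: B, Q].                                     *)
Lemma quadratic_chain (B A : {group gT}) : B \subset Q -> L \subset 'N(B) ->
  A \subset P ->
    [~: B, A, A] = 1 ->
  exists J : {group gT}, [/\ L \subset 'N(J), W \subset J, [~: H, A] \subset J,
    J \subset H &
    {in J, forall y, p^'.-elt y -> y \in 'C(B)}].
Proof.
have [n] := ubnP #|B|; elim: n B => // n IHn B ltBn sBQ nBL sAP quad.
have sAL := subset_trans sAP sPL; have sQL := subset_trans sQP sPL.
have pB := pgroupS sBQ pQ.
have [B1 | ntB] := eqsVneq B 1.
  exists H; split=> //.
    by rewrite commg_subl (subset_trans sAL).
  by move=> y _ _; rewrite B1; apply/centP => x /set1P->; apply: commute1.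
(* The quotient by B1 is elementary abelian with trivial action of Q; B1 is proper because Q is
   nilpotent and Frattini elements are non-generators. *)
pose B1 := ('Phi(B) <*> [~: B, Q])%G.
have nBQ : Q \subset 'N(B) := subset_trans sQL nBL.
have sBQB : [~: B, Q] \subset B by rewrite commg_subl.
have sB1B : B1 \subset B by rewrite join_subG Phi_sub.
have nB1L : L \subset 'N(B1).
  by rewrite normsY ?normsR // (char_norm_trans (Phi_char B)).
have nB1B : B \subset 'N(B1) by rewrite (subset_trans _ nB1L)
  // (subset_trans sBQ).
have ltB1 : B1 \proper B.
  rewrite properEneq sB1B andbT; apply/eqP=> /Phi_nongen; rewrite genGid => eB.
  have := @nil_comm_properl _ Q B Q (pgroup_nil pQ) sBQ ntB.
  by rewrite subsetI subxx nBQ eB properxx => /(_ isT).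
have quad1 : [~: B1, A, A] = 1.
  by apply/trivgP; rewrite -quad; do 2!apply: commSg.
have [|J1 [nJ1L sWJ1 sHAJ1 sJ1H cJ1]] :=
  IHn B1 _ (subset_trans sB1B sBQ) nB1L sAP quad1.
  by apply: leq_trans (proper_card ltB1) _.
pose V := (B / B1)%G.
have abV : p.-abelem V.
  have sPhi : 'Phi(B) \subset B1 by apply: joing_subl.
  have [f injf <-] := isogP (third_isog sPhi (Phi_normal B) (introT andP (conj
    sB1B nB1B))).
  by rewrite morphim_abelem // quotient_abelem // Phi_quotient_abelem.
pose J := (J1 :&: (coset B1 @*^-1 'C(V)))%G.
have JE y : y \in H -> (y \in coset B1 @*^-1 'C(V)) = (coset B1 y \in 'C(V)).
  move=> Hy; have Ny : y \in 'N(B1) by rewrite (subsetP nB1L) ?(subsetP sHL).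
  by rewrite morphpreE inE Ny inE.
have sWV : {in W, forall w, coset B1 w \in 'C(V)}.
  move=> w /(subsetP WE)/mulsgP[q c Qq cQc ->].
  have Nq := subsetP nB1L q (subsetP sQL q Qq).
  have Nc : c \in 'N(B1).
    by apply: subsetP c cQc; rewrite cents_norm // centS // (subset_trans sB1B).
  rewrite morphM // groupM //; apply/centP=> _ /morphimP[b Nb Bb ->] /=.
    apply/commute_sym/commgP; rewrite -morphR //= coset_id //.
    by rewrite (subsetP (joing_subr 'Phi(B) [~: B, Q])) // mem_commg.
  by rewrite /commute -!morphM // (centP cQc b (subsetP sBQ b Bb)).
exists J; split.
- rewrite normsI //; have nVL :
  L / B1 \subset 'N('C(V)) by rewrite norms_cent ?quotient_norms.
  by apply: subset_trans (morphpre_norms _ nVL); rewrite -sub_quotient_pre.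
- apply/subsetP=> w Ww; rewrite inE (subsetP sWJ1) // JE ?sWV //;
  exact: (subsetP sWH).
- rewrite gen_subG; apply/subsetP=> _ /imset2P[h x Hh Ax ->].
  have Hhx : [~ h, x] \in H.
    by rewrite commgEl groupM ?groupV // memJ_norm
      // (subsetP (subset_trans sAL nHL)).
  rewrite inE (subsetP sHAJ1) ?mem_commg //= JE //.
  have NL l : l \in L -> l \in 'N(B1) by apply: (subsetP nB1L).
  have Lx := subsetP sAL x Ax; have Lh := subsetP sHL h Hh.
  rewrite morphR ?NL //.
  have nVL l : l \in L -> coset B1 l \in 'N(V).
    by move=> Ll; rewrite (subsetP (quotient_norm _ _)) // mem_quotient
      // (subsetP nBL).
  apply: (@quadratic_cent _ p V (H / B1)%G (coset B1 x)) => //.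
  + by apply/subsetP=> _ /morphimP[y _ Hy ->]; rewrite nVL // (subsetP sHL).
  + exact: nVL.
  + by rewrite (subsetP (quotient_norm _ _)) // mem_quotient // (subsetP nHL).
  + move=> _ _ /morphimP[y Ny Hy ->] /morphimP[z Nz Hz ->].
    rewrite -morphR // sWV // (subsetP abH) //; exact: mem_commg.
  + move=> _ /morphimP[y Ny Hy ->]; exists #|H : W| => //.
    rewrite -morphX // sWV // coset_idr ?groupX
      ?(subsetP (normal_norm nsWH)) //.
    rewrite morphX ?(subsetP (normal_norm nsWH)) //= -card_quotient
      ?normal_norm //.
    by rewrite expg_cardG // mem_quotient.
  + move=> _ /morphimP[b Nb Bb ->]; have Lb := subsetP sQL b (subsetP sBQ b Bb).
    rewrite -!morphR ?groupR ?NL //.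
    suff -> : [~ b, x, x] = 1 by rewrite morph1.
    by apply/set1P; rewrite -[[set 1]]quad !mem_commg.
  + by rewrite /= mem_quotient.
- by apply: subset_trans (subsetIl _ _) sJ1H.
- move=> y /setIP[J1y cy] p'y; have Hy := subsetP sJ1H y J1y;
  have Ly := subsetP sHL y Hy.
  have Ny := subsetP nB1L y Ly; have nsB1B : B1 <| B by apply/andP.
  apply: (pelt_cent_chain pB nsB1B) => //; first exact: (subsetP nBL).
    exact: cJ1.
  move=> b Bb; have Nb := subsetP nB1B b Bb; apply: coset_idr;
    first by rewrite groupR.
  rewrite morphR //; apply/eqP/commgP/commute_sym.
  by rewrite JE // in cy; apply: (centP cy); rewrite mem_quotient.
Qed.

(** With J from [quadratic_chain], let N1 be the part of P acting trivially on H / J. It is normal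
    in P and contains Q and A, so it is larger than Q and [regH] leaves it no nontrivial fixed point
    on the p'-group H / W. By coprime action it has none on H / J, which it centralizes; hence H =
    J. *)
Lemma quadratic_stab (B A : {group gT}) : B \subset Q -> L \subset 'N(B) ->
  A \subset P ->
    [~: B, A, A] = 1 -> ~~ (A \subset Q) ->
  {in H, forall y, p^'.-elt y -> y \in 'C(B)}.
Proof.
move=> sBQ nBL sAP quad not_sAQ.
have [J [nJL sWJ sHAJ sJH cJ]] := quadratic_chain sBQ nBL sAP quad.
suff sHJ : H \subset J by move=> y Hy; apply: cJ; apply: (subsetP sHJ).
have nJP := subset_trans sPL nJL; have nJH := subset_trans sHL nJL.
have nHP := subset_trans sPL nHL; have nWP := subset_trans sPL nWL.
pose N1 := (P :&: coset J @*^-1 'C(H / J))%G.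
have sN1P : N1 \subset P := subsetIl _ _.
have sHN1 : [~: H, N1] \subset J.
  rewrite commGC -quotient_cents2 ?(subset_trans sN1P) //.
  by rewrite sub_quotient_pre ?subsetIr // (subset_trans sN1P).
have sub_N1 (X : {group gT}) : X \subset P -> [~: H, X] \subset J ->
  X \subset N1.
  move=> sXP sHX; rewrite subsetI sXP -sub_quotient_pre ?(subset_trans sXP) //.
  by rewrite quotient_cents2 ?(subset_trans sXP) // commGC.
have nsN1 : N1 <| P.
  rewrite /normal sN1P normsI ?normG //.
  have nCP : P / J \subset 'N('C(H / J)) by rewrite norms_cent ?quotient_norms.
  by apply: subset_trans (morphpre_norms _ nCP); rewrite -sub_quotient_pre.
have sQN1 : Q \subset N1.
  apply: sub_N1 => //; apply: subset_trans (subset_trans sQW sWJ).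
  by rewrite commg_subr (subset_trans sHL).
have ltQN1 : Q \proper N1.
  rewrite properE sQN1; apply: contra not_sAQ; apply: subset_trans.
  exact: sub_N1.
clearbody N1.
have nWH := normal_norm nsWH; have nWN1 := subset_trans sN1P nWP.
have coHN : coprime #|H / W| #|N1 / W|.
  rewrite coprime_sym; apply: (@pnat_coprime p); last by rewrite card_quotient.
  exact: quotient_pgroup (pgroupS sN1P pP).
have nHN : N1 / W \subset 'N(H / W) by rewrite quotient_norms
  ?(subset_trans sN1P).
have cHH : abelian (H / W) by rewrite sub_der1_abelian.
have sJWH : J / W \subset H / W by apply: quotientS.
have nJN : N1 / W \subset 'N(J / W) by rewrite quotient_norms
  ?(subset_trans sN1P).
have := coprime_quotient_cent sJWH nJN coHN (abelian_sol cHH).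
have -> : 'C_(H / W)(N1 / W) = 1.
  apply/trivgP/subsetP=> _ /setIP[/morphimP[y Ny Hy ->] cy].
  have Ny' : y.`_p^' \in 'N(W) by rewrite groupX.
  have ey : coset W y = coset W y.`_p^'.
    rewrite -{1}(consttC p y) morphM ?groupX //= [X in X * _](_ :
      _ = 1) ?mul1g //.
    have p'y : p^'.-elt (coset W y.`_p).
      apply: (@mem_p_elt _ p^' _ (H / W)%G);
        first by rewrite /pgroup card_quotient.
      by rewrite mem_quotient // groupX.
    have py : p.-elt (coset W y.`_p) by rewrite morph_p_elt ?groupX
      ?p_elt_constt.
    exact: pelt_p'elt_eq1 py p'y.
  rewrite /= in cy *; rewrite ey coset_id ?group1 // (regH nsN1 ltQN1) ?groupX
    ?p_elt_constt //.
  rewrite -quotient_cents2 ?sub1set //.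
  rewrite quotient_set1 // -ey sub1set //.
have cHJ : (H / W) / (J / W) \subset 'C((N1 / W) / (J / W)).
  by rewrite quotient_cents2r // -quotientR ?quotientS.
rewrite quotient1 (setIidPl cHJ) => /esym/eqP.
rewrite -subG1 quotient_sub1 ?quotient_norms //.
by rewrite quotientSGK.
Qed.

(** Split y in H into its p'-part, which centralizes B, and its p-part, which lies in W \subset Q
    'C(Q) because H / W is a p'-group. *)
Lemma pelt_cent_norm (B X : {group gT}) : B \subset Q -> X \subset B ->
    Q \subset 'N(X) -> {in H, forall y, p^'.-elt y -> y \in 'C(B)} ->
      H \subset 'N(X).
Proof.
move=> sBQ sXB nXQ cB; apply/subsetP=> y Hy; rewrite -(consttC p y) groupM //;
  last first.
  have : y.`_p^' \in 'C(B) by rewrite cB ?groupX ?p_elt_constt.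
  by apply: subsetP; rewrite cents_norm // centS.
have WN : W \subset 'N(X).
  apply: subset_trans WE _; rewrite mul_subG // cents_norm // centS //.
  exact: subset_trans sBQ.
suff: y.`_p \in W by apply: subsetP.
have Ny : y.`_p \in 'N(W) by rewrite (subsetP (normal_norm nsWH)) ?groupX.
apply: coset_idr => //.
have p'y : p^'.-elt (coset W y.`_p).
  apply: (@mem_p_elt _ p^' _ (H / W)%G);
    first by rewrite /pgroup card_quotient ?normal_norm.
  by rewrite mem_quotient // groupX.
have py : p.-elt (coset W y.`_p) by rewrite morph_p_elt ?p_elt_constt.
exact: pelt_p'elt_eq1 py p'y.
Qed.

(* For a minimal B whose intersection with Z = ZJ(D) is not L-invariant, B is *)
(* generated by the conjugates of B :&: Z, and B^`(1) \subset Z. Take A of    *)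
(* maximal order among the abelian subgroups of D, not inside Q, with B :&: A *)
(* maximal. If B normalizes A then A acts quadratically on B; otherwise the   *)
(* replacement of A lies in Q, which forces B into ZJ(D :&: Q).               *)
Lemma center_thompson_invariant (D : {group gT}) :
    D <| P -> L \subset H * P -> H \subset 'N(D :&: Q) ->
    (exists2 y, y \in H & p^'.-elt y && (y \notin 'C(Q))) ->
  'Z(thompson D) \subset Q /\ H \subset 'N('Z(thompson D)).
Proof.
move=> /andP[sDP nDP] sLHP nEH [y Hy /andP[p'y not_cy]].
set Z := 'Z(thompson D)%G; set E := (D :&: Q)%G.
have sQL := subset_trans sQP sPL.
have nZP : P \subset 'N(Z) := subset_trans nDP (norm_thompson D).
have nEL : L \subset 'N(E).
  apply: subset_trans sLHP _; rewrite mul_subG // normsI //.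
  exact: subset_trans sPL nQL.
have sZD : Z \subset D := subset_trans (center_sub _) (thompson_sub D).
have cZZ : abelian Z := center_abelian _.
have sZQ : Z \subset Q.
  case: (boolP (Z \subset Q)) => // not_sZQ.
  (* Z is abelian and normalized by Q, so it acts quadratically; not being inside Q, it would force
     y to centralize Q. *)
  have quad : [~: Q, Z, Z] = 1.
    apply/commG1P; apply: subset_trans (_ : Z \subset _); last exact: cZZ.
    by rewrite commg_subr (subset_trans sQP).
  have := quadratic_stab (subxx Q) nQL (subset_trans sZD sDP) quad not_sZQ Hy
    p'y.
  by rewrite (negPf not_cy).
split=> //; have sZE : Z \subset E by rewrite subsetI sZD.
have [A0 mA0 _] := max_order_abelian_exists (sub1G D) (abelian1 _).
have [sJQ | not_sJQ] := boolP (thompson D \subset Q).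
  (* In this case D and D :&: Q have the same Thompson subgroup, and H normalizes D :&: Q. *)
  have sJE : thompson D \subset E by rewrite subsetI thompson_sub.
  have sED : E \subset D := subsetIl _ _.
  have [mEA0 sJED] := thompsonS sED mA0 (subset_trans (max_order_abelian_sub
    mA0) sJE).
  have eJ : thompson E = thompson D :> {set gT}.
    apply/eqP; rewrite eqEsubset sJED gen_subG; apply/bigcupsP=> A mA.
    apply: max_order_abelian_sub.
    by have [] := thompsonS sED mA (subset_trans (max_order_abelian_sub mA)
      sJE).
  by rewrite /= -eJ; apply: subset_trans (norm_thompson E).
pose bad (A : {group gT}) := max_order_abelian D A && ~~ (A \subset Q).
have [A1 badA1] : exists A, bad A.
  apply/existsP; apply: contraR not_sJQ; rewrite negb_exists => /forallP nobad.
  rewrite gen_subG; apply/bigcupsP=> A mA.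
  by have := nobad A; rewrite /bad mA negbK.
suff claim (B : {group gT}) : B \subset E -> L \subset 'N(B) ->
  L \subset 'N(B :&: Z).
  by have := claim E (subxx _) nEL; rewrite (setIidPr sZE); apply: subset_trans.
have [n] := ubnP #|B|; elim: n B => // n IHn B ltBn sBE nBL.
have sED : E \subset D := subsetIl _ _; have sEQ : E \subset Q := subsetIr _ _.
have sBQ := subset_trans sBE sEQ; have pB := pgroupS sBQ pQ.
have sBD := subset_trans sBE sED.
(* Induction applies to the subgroup B0 generated by these conjugates if it is proper. Otherwise any
   L-invariant subgroup containing B :&: Z contains B; this is [UP]. *)
pose U := \bigcup_(g in L) (B :&: Z) :^ g.
pose B0 := << U >>%G.
have sBZU : B :&: Z \subset U by rewrite -{1}[B :&: Z]conjsg1;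
  apply: bigcup_sup.
have sB0B : B0 \subset B.
  rewrite gen_subG; apply/bigcupsP=> g Lg;
    rewrite -{2}(normsP nBL g Lg) conjSg; exact: subsetIl.
have nB0L : L \subset 'N(B0).
  rewrite norms_gen //; apply/subsetP=> g Lg; rewrite inE;
    apply/subsetP=> _ /imsetP[x /bigcupP[h Lh Ux] ->].
  by apply/bigcupP; exists (h * g);
    [exact: groupM | rewrite conjsgM memJ_conjg].
have eB0 : B0 :&: Z = B :&: Z.
  apply/eqP; rewrite eqEsubset setSI //= subsetI subsetIr andbT.
  exact: subset_trans sBZU (subset_gen _).
have [ltB0 | ] := boolP (B0 \proper B).
  rewrite -eB0; apply: IHn => //; last exact: subset_trans sBE.
  by apply: leq_trans (proper_card ltB0) _.
rewrite properE sB0B negbK => sBB0.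
have UP (X : {group gT}) : L \subset 'N(X) -> B :&: Z \subset X -> B \subset X.
  move=> nXL sX; apply: subset_trans sBB0 _; rewrite gen_subG;
    apply/bigcupsP=> g Lg.
  by rewrite -(normsP nXL g Lg) conjSg.
have [B1 | ntB] := eqsVneq B 1.
  by rewrite B1 (setIidPl (sub1G _)) norms1.
have ltB' : [~: B, B]%G \proper B by rewrite (sol_der1_proper (pgroup_sol pB)).
have sB'B := proper_sub ltB'.
have nB'L : L \subset 'N([~: B, B]) by rewrite normsR.
have IHB' : L \subset 'N([~: B, B] :&: Z).
  apply: (IHn [~: B, B]%G) => //; last exact: subset_trans sBE.
  by apply: leq_trans (proper_card ltB') _.
have sBL := subset_trans sBQ sQL; have sBP := subset_trans sBQ sQP.
(* By induction K = [~: B, B] :&: Z is L-invariant. B :&: Z centralizes B modulo K, so by [UP] B is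
   abelian modulo K. *)
have sB'Z : [~: B, B] \subset Z.
  suff: [~: B, B] \subset [~: B, B] :&: Z by rewrite subsetI => /andP[].
  have nKB := subset_trans sBL IHB'.
  pose K := ([~: B, B] :&: Z)%G; rewrite -[_ :&: _]/(gval K) in nKB IHB' *.
  rewrite -quotient_cents2 // sub_quotient_pre //.
  apply: (UP (coset K @*^-1 'C(B / K))%G) => /=.
    have nCL : L / K \subset 'N('C(B / K)) by rewrite norms_cent
      ?quotient_norms.
    by apply: subset_trans (morphpre_norms _ nCL); rewrite -sub_quotient_pre.
  have nKBZ : B :&: Z \subset 'N(K) by rewrite subIset ?nKB.
  rewrite -sub_quotient_pre // quotient_cents2 //.
  rewrite subsetI commSg ?subsetIl //=.
  apply: subset_trans (commSg B (subsetIr B Z)) _.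
  by rewrite commg_subl (subset_trans sBP).
have cB'B : [~: B, B] \subset 'C(B).
  rewrite centsC; apply: (UP ('C([~: B, B]))%G) => /=;
    first by rewrite norms_cent.
  by rewrite subIset // orbC centsC (subset_trans sB'Z).
case: (@arg_maxnP _ A1 bad (fun A : {group gT} => #|A :&: B|) badA1) =>
  A /andP[mA not_sAQ] maxA.
have [sAD _ _] := and3P mA; have sAP := subset_trans sAD sDP.
have [nAB | not_nAB] := boolP (B \subset 'N(A)).
  have quad : [~: B, A, A] = 1.
    apply/commG1P; have [_ cAA _] := and3P mA; apply: subset_trans cAA.
    by rewrite commg_subr.
  have cB := quadratic_stab sBQ nBL sAP quad not_sAQ.
  apply: subset_trans sLHP _; rewrite mul_subG //; last first.
    by rewrite normsI // (subset_trans sPL).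
  apply: (@pelt_cent_norm B (B :&: Z)%G) => //; first exact: subsetIl.
  by rewrite normsI ?(subset_trans sQL nBL) ?(subset_trans sQP nZP).
have nsBD : B <| D by rewrite /normal sBD (subset_trans sDP)
  // (subset_trans sPL).
have sB'A : [~: B, B] \subset A := subset_trans sB'Z (center_thompson_sub mA).
have [A2 mA2 [ltAA2 nAA2]] :=
  glauberman_replacement (pgroupS sDP pP) p_odd mA nsBD sB'A cB'B not_nAB.
(* By the maximal choice of A among the subgroups not inside Q. *)
have sA2Q : A2 \subset Q.
  apply: contraTT (proper_card ltAA2) => not_sA2Q; rewrite -leqNgt; apply: maxA.
  by rewrite /bad mA2.
have [A2D _ _] := and3P mA2.
have [mEA2 sJED] := thompsonS sED mA2 (introT subsetIP (conj A2D sA2Q)).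
(* As ZJ(E) is L-invariant and contains Z, [UP] puts B into it, hence into A2, which normalizes
   A. *)
have sZX : Z \subset 'Z(thompson E).
  rewrite subsetI (subset_trans (center_thompson_sub mA2))
    ?max_order_abelian_sub //=.
  by apply: subset_trans (subsetIr _ _) _; rewrite centS.
have sBX : B \subset 'Z(thompson E).
  apply: (UP ('Z(thompson E))%G) => /=; last by rewrite subIset // sZX orbT.
  exact: subset_trans nEL (norm_thompson E).
case/negP: not_nAB; apply: subset_trans nAA2.
exact: subset_trans sBX (center_thompson_sub mEA2).
Qed.
End Extremal.

(** * Fusion systems inside an ambient group *)

(* The objects are the subgroups between Q and P, and every morphism on R is  *)
(* the conjugation by an element g of the ambient group; M R is the set of    *)
(* those g, so it is a union of cosets of 'C(R). Morphisms preserve Q.        *)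
Section Fsys.
Variables (p : nat) (gT : finGroupType).
Implicit Types (Q P R S T Y U D : {group gT}) (M : {set gT} -> {set gT}).

Record fsys Q P M : Prop := Fsys {
  fs_sub : Q \subset P;
  fs_dom : forall R g, Q \subset R -> R \subset P -> g \in M R ->
             Q :^ g = Q /\ R :^ g \subset P;
  fs_inn : forall R, Q \subset R -> R \subset P -> P \subset M R;
  fs_cent : forall R, Q \subset R -> R \subset P -> 'C(R) \subset M R;
  fs_mul : forall R g h, Q \subset R -> R \subset P ->
             g \in M R -> h \in M (R :^ g) -> g * h \in M R;
  fs_inv : forall R g, Q \subset R -> R \subset P ->
             g \in M R -> g^-1 \in M (R :^ g);
  fs_res : forall R S, Q \subset S -> S \subset R -> R \subset P ->
             M R \subset M S
}.

(** Generation only makes this a group by construction: for objects of a system it adds nothing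
    ([fs_autP]). *)
Definition fs_aut M (R : {set gT}) : {group gT} :=
  generated_group (M R :&: 'N(R)).

Arguments fs_aut : simpl never.

(* The two halves correspond to "fully automized" and to "receptive": T is a  *)
(* subgroup of the extender of the isomorphism c_g : S -> R, and g * c is an  *)
(* extension of c_g to T.                                                     *)
Definition fs_good Q P M (R : {set gT}) :=
  (exists2 U : {group gT}, p.-Sylow(fs_aut M R) U &
     U \subset 'N_P(R) * 'C(R)) /\
  (forall S T g, Q \subset S -> S \subset T -> T \subset 'N_P(S) ->
     g \in M S -> S :^ g = R -> T :^ g \subset 'N_P(R) * 'C(R) ->
   exists2 c, c \in 'C(R) & g * c \in M T).

Definition fs_sat Q P M := forall R, Q \subset R -> R \subset P ->
  exists2 g, g \in M R & fs_good Q P M (R :^ g).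

(* a induces a nontrivial p'-automorphism of R in the normalizer of Y. *)
Definition bad P M (Y : {set gT}) R a :=
  [/\ Y \subset R, R \subset 'N_P(Y), a \in fs_aut M R, a \in 'N(Y) &
      p^'.-elt a && (a \notin 'C(R))].

Section Basic.
Variables (Q P : {group gT}) (M : {set gT} -> {set gT}).
Hypotheses (fsM : fsys Q P M) (pP : p.-group P).

Lemma fs_normal : Q <| P.
Proof.
rewrite /normal (fs_sub fsM); apply/subsetP=> x Px; apply/normP.
have sQP := fs_sub fsM.
have Mx := subsetP (fs_inn fsM (subxx Q) sQP) x Px.
by have [] := fs_dom fsM (subxx Q) sQP Mx.
Qed.

Lemma fs_im R g : Q \subset R -> R \subset P -> g \in M R ->
  Q \subset R :^ g /\ R :^ g \subset P.
Proof.
by move=> sQR sRP Mg; have [{1}<- ->] := fs_dom fsM sQR sRP Mg; rewrite conjSg.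
Qed.

Lemma fs_autP R : Q \subset R -> R \subset P ->
  fs_aut M R = M R :&: 'N(R) :> {set gT}.
Proof.
move=> sQR sRP; apply: gen_set_id; apply/group_setP; split.
  by rewrite inE group1 andbT (subsetP (fs_inn fsM sQR sRP)).
move=> g h /setIP[Mg Ng] /setIP[Mh Nh]; rewrite inE groupM // andbT.
by apply: (fs_mul fsM) => //; rewrite (normP Ng).
Qed.

Lemma fs_autE R g : Q \subset R -> R \subset P ->
  (g \in fs_aut M R) = (g \in M R) && (g \in 'N(R)).
Proof. by move=> sQR sRP; rewrite fs_autP // inE. Qed.

Lemma fs_aut_norm R : Q \subset R -> R \subset P -> fs_aut M R \subset 'N(R).
Proof. by move=> sQR sRP; rewrite fs_autP // subsetIr. Qed.

Lemma fs_aut_cent R : Q \subset R -> R \subset P -> 'C(R) \subset fs_aut M R.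
Proof. by move=> sQR sRP; rewrite fs_autP // subsetI (fs_cent fsM) // cent_sub.
  Qed.

Lemma fs_cent_aut R : Q \subset R -> R \subset P -> 'C(R) <| fs_aut M R.
Proof.
move=> sQR sRP; rewrite /normal fs_aut_cent //.
by apply: subset_trans (fs_aut_norm sQR sRP) _; rewrite norms_cent.
Qed.

Lemma fs_aut_inn R : Q \subset R -> R \subset P -> 'N_P(R) \subset fs_aut M R.
Proof. by move=> sQR sRP; rewrite fs_autP // setSI // (fs_inn fsM). Qed.

Lemma fs_mem_aut R S g a : Q \subset S -> S \subset P -> g \in M S ->
  S :^ g = R ->
  a \in fs_aut M R -> g * a \in M S /\ S :^ (g * a) = R.
Proof.
move=> sQS sSP Mg eR; have [sQR sRP] := fs_im sQS sSP Mg; rewrite eR in sQR sRP.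
rewrite fs_autE // => /andP[Ma Na]; rewrite conjsgM eR (normP Na); split=> //.
by apply: (fs_mul fsM) => //; rewrite eR.
Qed.

Lemma fs_autJ S g : Q \subset S -> S \subset P -> g \in M S ->
  fs_aut M S :^ g = fs_aut M (S :^ g).
Proof.
suff sub T h : Q \subset T -> T \subset P -> h \in M T ->
  fs_aut M T :^ h \subset fs_aut M (T :^ h).
  move=> sQS sSP Mg; apply/eqP; rewrite eqEsubset sub //.
  have [sQSg sSgP] := fs_im sQS sSP Mg; have Mg' := fs_inv fsM sQS sSP Mg.
  rewrite -sub_conjgV.
  have := sub (S :^ g)%G _ sQSg sSgP Mg'. by rewrite /= conjsgK.
move=> sQT sTP Mh; apply/subsetP=> _ /imsetP[a Aa ->].
have [sQTh sThP] := fs_im sQT sTP Mh.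
rewrite fs_autE // in Aa; case/andP: Aa => Ma Na.
rewrite (@fs_autE (T :^ h)%G) //= normJ memJ_conjg Na andbT conjgE mulgA.
apply: (fs_mul fsM (R := (T :^ h)%G)) => //; last first.
  by rewrite /= -conjsgM mulKVg (normP Na).
apply: (fs_mul fsM (R := (T :^ h)%G)) => //=; first exact: (fs_inv fsM sQT sTP).
by rewrite conjsgK.
Qed.

(** By Sylow's theorem some automorphism of R moves 'N_P(S) :^ g into 'N_P(R) 'C(R), where the
    extension property applies to all of 'N_P(S). *)
Lemma fs_good_ext R S g : fs_good Q P M R -> Q \subset S -> S \subset P ->
  g \in M S ->
  S :^ g = R -> exists2 a, a \in fs_aut M R & g * a \in M 'N_P(S).
Proof.
case=> [[U sylU sU] ext] sQS sSP Mg eR; have [sQR sRP] := fs_im sQS sSP Mg.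
rewrite eR in sQR sRP.
have sNg : 'N_P(S) :^ g \subset fs_aut M R by rewrite -eR -fs_autJ
  // conjSg fs_aut_inn.
have pNg : p.-group ('N_P(S) :^ g) by rewrite pgroupJ (pgroupS (subsetIl _ _)).
have [a Aa sNga] := Sylow_Jsub sylU sNg pNg.
have [Mga eRa] := fs_mem_aut sQS sSP Mg eR Aa.
have sSN : S \subset 'N_P(S) by rewrite subsetI sSP normG.
have [|c Cc Mgac] := ext S 'N_P(S)%G (g * a) sQS sSN (subxx _) Mga eRa.
  by rewrite conjsgM (subset_trans sNga).
exists (a * c); rewrite ?mulgA // groupM // (subsetP (fs_aut_cent sQR sRP)) //.
Qed.

Lemma fs_good_self R : fs_sat Q P M -> Q \subset R -> R \subset P ->
  (forall g, g \in M R -> R :^ g = R) -> fs_good Q P M R.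
Proof. by move=> sM sQR sRP inv; have [g Mg] := sM R sQR sRP; rewrite inv. Qed.

(** Alperin's argument, by induction on #|P| - #|R|. Up to an automorphism of the good target R0, a
    morphism extends to a normalizer in P, where induction applies. The automorphisms of R0 come
    from 'N_P(R0), since the automizer modulo 'C(R0) is a p-group and R0 is good. *)
Lemma fusion_trivial :
    fs_sat Q P M ->
    (forall R a, Q \subset R -> R \subset P -> a \in fs_aut M R ->
      p^'.-elt a -> a \in 'C(R)) ->
  forall R g, Q \subset R -> R \subset P -> g \in M R ->
  exists2 x, x \in P & {in R, forall r, r ^ g = r ^ x}.
Proof.
move=> sM triv R; have [n] := ubnP (#|P| - #|R|);
  elim: n R => // n IHn R ltRn g sQR sRP Mg.
suff claim (V R0 : {group gT}) k : fs_good Q P M R0 -> Q \subset V ->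
  V \subset P -> k \in M V ->
    V :^ k = R0 -> #|V| = #|R| ->
      exists2 x, x \in P & {in V, forall v, v ^ k = v ^ x}.
  have [h Mh gR0] := sM R sQR sRP.
  have [x1 Px1 act1] := claim R (R :^ h)%G h gR0 sQR sRP Mh (erefl _) (erefl _).
  have [sQRg sRgP] := fs_im sQR sRP Mg.
  have Mgh : g^-1 * h \in M (R :^ g).
    by apply: (fs_mul fsM (R := (R :^ g)%G)) => //=;
      rewrite ?conjsgK ?(fs_inv fsM).
  have eRgh : (R :^ g)%G :^ (g^-1 * h) = (R :^ h)%G by rewrite /= -conjsgM
    mulKVg.
  have [x2 Px2 act2] := claim (R :^ g)%G (R :^ h)%G _ gR0 sQRg sRgP Mgh eRgh
    (cardJg _ _).
  exists (x1 * x2^-1) => [|r Rr]; first by rewrite groupM ?groupV.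
  apply: (conjg_inj x2); rewrite -act2 ?memJ_conjg // -!conjgM mulgKV mulKVg;
    exact: act1.
move=> gR0 sQV sVP Mk eR0 oV.
have [sQR0 sR0P] := fs_im sQV sVP Mk; rewrite eR0 in sQR0 sR0P.
have autR0 a : a \in fs_aut M R0 ->
  exists2 y, y \in 'N_P(R0) & {in R0, forall r, r ^ a = r ^ y}.
  move=> Aa; have [[U sylU sU] _] := gR0.
  have p'C : {in fs_aut M R0, forall y, p^'.-elt y -> y \in 'C(R0)}.
    by move=> y Ay; apply: triv.
  have /subsetP/(_ a Aa)/mulsgP[c u Cc Uu ->] :=
    pelt_sub_mul_Sylow (fs_cent_aut sQR0 sR0P) p'C sylU.
  have /mulsgP[y d Ny Cd def_u] := subsetP sU u Uu; exists y => // r Rr.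
  have cR z t : z \in 'C(R0) -> t \in R0 -> t ^ z = t.
    by move=> Cz Rt; apply/conjg_fixP/commgP/commute_sym/(centP Cz).
  rewrite conjgM (cR c) // def_u conjgM (cR d) // memJ_norm //.
  by case/setIP: Ny.
have [a Aa Mka] := fs_good_ext gR0 sQV sVP Mk eR0.
have [y NRy acty] := autR0 a Aa; have [Py Ny] := setIP NRy.
have [eVP | neVP] := eqVneq (V : {set gT}) P.
  have eRP : R0 = V :> {set gT}.
    by apply/eqP; rewrite eqEcard eVP sR0P -eVP -eR0 cardJg leqnn.
  have Ak : k \in fs_aut M R0 by rewrite fs_autE // eRP Mk inE eR0 eRP subxx.
  have [z /setIP[Pz _] actz] := autR0 k Ak.
  by exists z => // v Vv; rewrite actz // eRP.
have ltVN : V \proper 'N_P(V).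
  by apply: nilpotent_proper_norm (pgroup_nil pP) _; rewrite properEneq neVP.
have sVN := proper_sub ltVN.
have [||||x Px actx] := IHn ('N_P(V))%G _ (k * a).
- apply: leq_trans (ltn_sub2l _ (proper_card ltVN)) _.
    by apply: leq_trans (proper_card ltVN) (subset_leq_card (subsetIl _ _)).
  by rewrite oV -ltnS.
- exact: subset_trans sQV sVN.
- exact: subsetIl.
- exact: Mka.
exists (x * y^-1) => [|v Vv]; first by rewrite groupM ?groupV.
apply: (conjg_inj y); rewrite -[RHS]conjgM mulgKV -actx
  ?(subsetP sVN) // conjgM acty //.
by rewrite -eR0 memJ_conjg.
Qed.

(** An isomorphism from Y to a good conjugate can be chosen to extend to 'N_P(Y), which contains R;
    it carries R and a along. *)
Lemma bad_transport Y : fs_sat Q P M -> Q \subset Y -> Y \subset P ->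
    (exists R a, bad P M Y R a) ->
  exists Y' : {group gT}, [/\ fs_good Q P M Y', Q \subset Y' /\ Y' \subset P,
    #|Y'| = #|Y|,
    #|'N_P(Y)| <= #|'N_P(Y')| & exists R a, bad P M Y' R a].
Proof.
move=> sM sQY sYP [R [a [sYR sRN Aa NYa /andP[p'a not_cRa]]]].
have [g Mg gY] := sM Y sQY sYP.
have [b Ab Mk] := @fs_good_ext (Y :^ g)%G _ _ gY sQY sYP Mg (erefl _).
have [_ eY'] := fs_mem_aut sQY sYP Mg (erefl _) Ab.
set k := g * b in Mk eY'.
have sYN : Y \subset 'N_P(Y) by rewrite subsetI sYP normG.
have sNP : 'N_P(Y) \subset P := subsetIl _ _.
have [sQNk sNkP] := fs_im (R := 'N_P(Y)%G) (subset_trans sQY sYN) sNP Mk.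
have sQR := subset_trans sQY sYR; have sRP := subset_trans sRN sNP.
have MRk : k \in M R by apply: (subsetP (fs_res fsM sQR sRN sNP)).
have sNk : 'N_P(Y) :^ k \subset 'N_P(Y :^ g).
  by rewrite subsetI sNkP /= -eY' normJ conjSg subsetIr.
exists (Y :^ g)%G; split=> //.
- by have [] := fs_im sQY sYP Mg.
- by rewrite cardJg.
- by rewrite -(cardJg _ k) subset_leq_card.
exists (R :^ k)%G, (a ^ k); split.
- by rewrite /= -eY' conjSg.
- by apply: subset_trans sNk; rewrite conjSg.
- by rewrite /= -fs_autJ // memJ_conjg.
- by rewrite /= -eY' normJ memJ_conjg.
- by rewrite p_eltJ p'a /= centJ memJ_conjg.
Qed.
End Basic.
End Fsys.

(** * Normalizers of subgroups in a saturated system *)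

Section Norm.
Variables (p : nat) (gT : finGroupType).
Implicit Types (R S T Y U D : {group gT}).
Variables (Q P : {group gT}) (M : {set gT} -> {set gT}).
Hypotheses (fsM : fsys Q P M) (pP : p.-group P).

Definition norm_fs (Y : {set gT}) X := M X :&: 'N(Y).

Lemma norm_fsys Y : Q \subset Y -> Y \subset P -> fsys Y 'N_P(Y) (norm_fs Y).
Proof.
move=> sQY sYP; have sNP : 'N_P(Y) \subset P := subsetIl _ _.
split=> [|R g|R|R|R g h|R g|R S]; first by rewrite subsetI sYP normG.
all: move=> sYR; have sQR := subset_trans sQY sYR.
- move=> sRN /setIP[Mg NYg]; have sRP := subset_trans sRN sNP.
  rewrite (normP NYg); split=> //; have [_ sRgP] := fs_dom fsM sQR sRP Mg.
  rewrite /= subsetI sRgP (_ :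
    'N(Y) = 'N(Y) :^ g) ?conjSg ?(subset_trans sRN) ?subsetIr //.
  by rewrite -normJ (normP NYg).
- move=> sRN; rewrite setSI // (fs_inn fsM) //; exact: subset_trans sRN sNP.
- move=> sRN; rewrite subsetI (fs_cent fsM) ?(subset_trans sRN sNP) //=.
  by rewrite cents_norm // centS.
- move=> sRN /setIP[Mg Ng] /setIP[Mh Nh]; rewrite inE groupM // andbT.
  by apply: (fs_mul fsM) => //; apply: subset_trans sRN sNP.
- move=> sRN /setIP[Mg Ng]; rewrite inE groupV Ng andbT.
  by apply: (fs_inv fsM) => //; apply: subset_trans sRN sNP.
move=> sSR sRN; rewrite setSI // (fs_res fsM) //.
  exact: subset_trans sRN sNP.
Qed.

Lemma mul_cent_group (X R : {group gT}) : X \subset 'N(R) ->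
  X * 'C(R) = X <*> 'C(R).
Proof. by move=> nRX; rewrite norm_joinEl // norms_cent. Qed.

(* With R1 a good conjugate of R, chosen so that 'N_P(R1) contains a Sylow    *)
(* subgroup of the stabilizer in the automizer of R1 of the image Y1 of Y,    *)
(* move Y1 back to Y by a morphism defined on 'N_P(Y1).                       *)
Lemma norm_sat Y : fs_sat p Q P M -> fs_good p Q P M Y -> Q \subset Y ->
  Y \subset P ->
  fs_sat p Y 'N_P(Y)%G (norm_fs Y).
Proof.
move=> sM gY sQY sYP R sYR sRN; have fsN := norm_fsys sQY sYP.
set N := ('N_P(Y))%G in sRN fsN *; have sNP : N \subset P := subsetIl _ _.
have sQR := subset_trans sQY sYR; have sRP := subset_trans sRN sNP.
have [g0 Mg0 gR1] := sM R sQR sRP.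
pose R1 := (R :^ g0)%G; rewrite -[R :^ g0]/(gval R1) in gR1.
have [sQR1 sR1P] : Q \subset R1 /\ R1 \subset P := fs_im fsM sQR sRP Mg0.
have [[U sylU sU] ext] := gR1.
have [S1 sylS1] := Sylow_exists p (fs_aut M R1 :&: 'N(Y :^ g0)).
have [sS1 pS1 _] := and3P sylS1.
have [a Aa sS1a] := Sylow_Jsub sylU (subset_trans sS1 (subsetIl _ _)) pS1.
have [Mg eR1] := fs_mem_aut fsM sQR sRP Mg0 (erefl _ : R :^ g0 = R1) Aa.
set g := g0 * a in Mg eR1; pose Y1 := (Y :^ g)%G; pose B := (S1 :^ a)%G.
have sylB : p.-Sylow(fs_aut M R1 :&: 'N(Y1)) B.
  have -> : fs_aut M R1 :&: 'N(Y1) = (fs_aut M R1 :&: 'N(Y :^ g0)) :^ a.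
    by rewrite conjIg conjGid // -normJ -conjsgM.
  by rewrite pHallJ2.
have sB : B \subset 'N_P(R1) * 'C(R1) := subset_trans sS1a sU.
have sYR1 : Y1 \subset R1 by rewrite -eR1 conjSg.
have [sQY1 sY1P] : Q \subset Y1 /\ Y1 \subset P.
  by apply: (fs_im fsM) => //; apply: (subsetP (fs_res fsM sQY sYR sRP)).
have MgV : g^-1 \in M R1 by rewrite -eR1 (fs_inv fsM).
have MgVY : g^-1 \in M Y1 by apply: (subsetP (fs_res fsM sQY1 sYR1 sR1P)).
(* The return from Y1 to Y is corrected by an automorphism b of Y so as to extend to 'N_P(Y1). Going
   to R1 and back amounts to b, which normalizes Y. *)
have [b Ab Mk] := fs_good_ext fsM pP gY sQY1 sY1P MgVY (conjsgK _ _).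
set k := g^-1 * b in Mk.
have /andP[Mb Nb] : (b \in M Y) && (b \in 'N(Y)) by rewrite -(fs_autE fsM).
have eY1k : Y1 :^ k = Y by rewrite /= -conjsgM mulKVg (normP Nb).
have sRY1 : R1 \subset 'N_P(Y1).
  by rewrite subsetI sR1P -eR1 normJ conjSg (subset_trans sRN) ?subsetIr.
have sN1P : 'N_P(Y1) \subset P := subsetIl _ _.
have MR1k : k \in M R1 by apply: (subsetP (fs_res fsM sQR1 sRY1 sN1P)).
have egk : g * k = b by rewrite mulKVg.
have MRb : b \in M R by rewrite -egk (fs_mul fsM) ?eR1.
exists b; first by rewrite inE MRb.
pose R2 := (R :^ b)%G; rewrite -[R :^ b]/(gval R2).
have eR2 : R1 :^ k = R2 by rewrite -eR1 -conjsgM egk.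
have [sYR2 sR2N] : Y \subset R2 /\ R2 \subset N by apply: (fs_im fsN);
  rewrite // inE MRb.
have sQR2 := subset_trans sQY sYR2; have sR2P := subset_trans sR2N sNP.
have autR2 : fs_aut (norm_fs Y) R2 = (fs_aut M R1 :&: 'N(Y1)) :^ k :> {set gT}.
  rewrite (fs_autP fsN) // conjIg (fs_autJ fsM)
    // -normJ eY1k eR2 (fs_autP fsM) //.
  by rewrite /norm_fs setIAC.
have sylBk : p.-Sylow(fs_aut (norm_fs Y) R2) (B :^ k).
  rewrite -(pHallJ2 _ _ _ k^-1) conjsgK autR2 conjsgK //.
have sN1k : 'N_P(Y1) :^ k \subset P.
  by have [] := fs_im fsM (R := 'N_P(Y1)%G) (subset_trans sQR1 sRY1) sN1P Mk.
have sBk : B :^ k \subset 'N_N(R2) * 'C(R2).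
  apply/subsetP=> _ /imsetP[s Bs ->].
  have /setIP[_ NYs] := subsetP (pHall_sub sylB) s Bs.
  have /mulsgP[m c /setIP[Pm Nm] Cc es] := subsetP sB s Bs.
  have NYc : c \in 'N(Y1) by apply: subsetP Cc; rewrite cents_norm // centS.
  have NYm : m \in 'N(Y1) by rewrite -(groupMr _ NYc) -es.
  rewrite es conjMg mem_mulg //; last by rewrite -eR2 centJ memJ_conjg.
  apply/setIP; split; last by rewrite -eR2 normJ memJ_conjg.
  apply/setIP; split; last by rewrite /= -eY1k normJ memJ_conjg.
  by apply: (subsetP sN1k); rewrite memJ_conjg inE Pm.
split; first by exists (B :^ k)%G.
move=> S T x sYS sST sTNS /setIP[Mx NYx] eSx sTx.
have sTN : T \subset N by apply: subset_trans sTNS (subsetIl _ _).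
have sTP := subset_trans sTN sNP; have sSP := subset_trans sST sTP.
have sQS := subset_trans sQY sYS; have sQT := subset_trans sQS sST.
(* Modulo 'C(R2) the left side is a p-group, and B :^ k is Sylow in it. *)
have sN2 : 'N_N(R2) * 'C(R2) \subset 'C(R2) * B :^ k.
  rewrite mul_cent_group ?subsetIr //.
  apply: (@pelt_sub_mul_Sylow p).
  - rewrite /normal joing_subr join_subG normG norms_cent ?subsetIr //.
  - move=> y Xy p'y; have nC : 'N_N(R2) <*> 'C(R2) \subset 'N('C(R2)).
      by rewrite join_subG normG norms_cent ?subsetIr.
    have p'cy : p^'.-elt (coset 'C(R2) y) by rewrite morph_p_elt ?(subsetP nC).
    have pcy : p.-elt (coset 'C(R2) y).
      apply: (@mem_p_elt _ p _ ('N_N(R2) / 'C(R2))%G).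
        by rewrite quotient_pgroup // (pgroupS _ pP) // subIset // sNP.
      by rewrite /= -quotientYidr ?norms_cent ?subsetIr // mem_quotient.
    apply: coset_idr; first by rewrite (subsetP nC).
    exact: pelt_p'elt_eq1 pcy p'cy.
  - apply: pHall_subl sylBk; first by move: sBk;
    rewrite mul_cent_group ?subsetIr.
    rewrite join_subG (fs_aut_inn fsN) // (fs_aut_cent fsN) //.
have MkV : k^-1 \in M R2 by rewrite -eR2 (fs_inv fsM).
have Mxk : x * k^-1 \in M S by rewrite (fs_mul fsM) ?eSx.
have eSxk : S :^ (x * k^-1) = R1 by rewrite conjsgM eSx -eR2 conjsgK.
(* The morphism is pulled back to the good subgroup R1, extended there to T, and returned by k,
   which is defined on 'N_P(Y1). *)
have [||c Cc My] := ext S T _ sQS sST _ Mxk eSxk.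
- by rewrite subsetI sTP (subset_trans sTNS) ?subsetIr.
- rewrite conjsgM sub_conjgV (subset_trans sTx) // (subset_trans sN2) //.
  have -> : 'C(R2) = 'C(R1) :^ k by rewrite -eR2 centJ.
  rewrite -conjsMg conjSg.
  have -> : 'N_P(R1) * 'C(R1) = 'C(R1) * ('N_P(R1) * 'C(R1)).
    by rewrite mul_cent_group ?subsetIr // mulSGid // joing_subr.
  exact: mulgS.
exists (c ^ k); first by rewrite -eR2 centJ memJ_conjg.
have exck : x * (c ^ k) = (x * k^-1 * c) * k by rewrite conjgE !mulgA.
have NYck : c ^ k \in 'N(Y).
  by rewrite -eY1k normJ memJ_conjg; apply: subsetP Cc;
    rewrite cents_norm // centS.
rewrite inE groupM // andbT exck; set y := x * k^-1 * c in My *.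
have [sQTy sTyP] := fs_im fsM sQT sTP My.
apply: (fs_mul fsM) => //.
have sTy : T :^ y \subset 'N_P(Y1).
  rewrite subsetI sTyP /=.
  have -> : 'N(Y1) = 'N(Y) :^ y.
    rewrite -normJ /y !conjsgM (normP NYx) -[in RHS]eY1k conjsgK (_ :
      Y1 :^ c = Y1) //.
    by apply/normP; apply: subsetP Cc; rewrite cents_norm // centS.
  by rewrite conjSg (subset_trans sTN) ?subsetIr.
exact: (subsetP (fs_res fsM (S := (T :^ y)%G) sQTy sTy sN1P)).
Qed.
End Norm.

(** * Quotient of a saturated system by Q *)

Section Quo.
Variables (p : nat) (gT : finGroupType).
Implicit Types (R S T Y U D : {group gT}).
Variables (Q P : {group gT}) (M : {set gT} -> {set gT}).
Hypotheses (fsM : fsys Q P M) (pP : p.-group P).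

(** The factor 'C(X) secures [fs_cent]: an element of the ambient quotient that centralizes X need
    not come from a morphism upstairs. *)
Definition quo_fs (X : {set coset_of Q}) : {set coset_of Q} :=
  'C(X) * (coset Q @* M (coset Q @*^-1 X)).

Let nsQP : Q <| P := fs_normal fsM.
Let nQP := normal_norm nsQP.

Lemma fs_normQ R g : Q \subset R -> R \subset P -> g \in M R -> g \in 'N(Q).
Proof. by move=> sQR sRP Mg; apply/normP; have [] := fs_dom fsM sQR sRP Mg. Qed.

Lemma fs_nsQ R : Q \subset R -> R \subset P -> Q <| R.
Proof. by move=> sQR sRP; apply: normalS nsQP. Qed.

Lemma quo_fsP R gb : Q \subset R -> R \subset P ->
  reflect (exists z g, [/\ z \in 'C(R / Q), g \in M R & gb = z * coset Q g])
          (gb \in quo_fs (R / Q)).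
Proof.
move=> sQR sRP; rewrite /quo_fs quotientGK ?fs_nsQ //.
apply: (iffP mulsgP) => [[z _ Cz /morphimP[g Ng Mg ->] ->] | [z [g [Cz Mg
  ->]]]].
  by exists z, g.
by exists z (coset Q g) => //; rewrite mem_morphim // (fs_normQ sQR sRP).
Qed.

Lemma quo_fs_coset R g : Q \subset R -> R \subset P -> g \in M R ->
  coset Q g \in quo_fs (R / Q).
Proof.
by move=> sQR sRP Mg; apply/quo_fsP => //; exists 1, g; rewrite group1 mul1g.
Qed.

Lemma quo_conj R z g : Q \subset R -> R \subset P -> g \in M R ->
  z \in 'C(R / Q) ->
  (R / Q) :^ (z * coset Q g) = (R :^ g) / Q.
Proof.
move=> sQR sRP Mg Cz; rewrite conjsgM (normP (subsetP (cent_sub _) z Cz)).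
by rewrite quotientJ // (fs_normQ sQR sRP).
Qed.

Lemma quo_lift (Rb : {group coset_of Q}) : Rb \subset P / Q ->
  exists R : {group gT}, [/\ Rb = (R / Q)%G, Q \subset R & R \subset P].
Proof.
by case/(inv_quotientS nsQP) => R e sQR sRP; exists R; split=> //;
  apply: group_inj.
Qed.

Lemma quo_fsys : fsys 1%G (P / Q)%G quo_fs.
Proof.
split=> [|Rb gb|Rb|Rb|Rb gb hb|Rb gb|Rb Sb]; first exact: sub1G.
- move=> _ /quo_lift[R [-> sQR sRP]] /(quo_fsP _ sQR sRP)[z [g [Cz Mg ->]]].
  rewrite conjs1g quo_conj //; split=> //; rewrite quotientS //.
  by have [] := fs_im fsM sQR sRP Mg.
- move=> _ /quo_lift[R [-> sQR sRP]]; apply/subsetP=> _ /morphimP[x Nx Px ->].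
  by apply: quo_fs_coset => //; apply: (subsetP (fs_inn fsM sQR sRP)).
- move=> _ /quo_lift[R [-> sQR sRP]]; apply/subsetP=> z Cz; apply/quo_fsP=> //.
  exists z, 1; rewrite morph1 mulg1; split=> //.
  by rewrite (subsetP (fs_cent fsM sQR sRP)).
- move=> _ /quo_lift[R [-> sQR sRP]] /(quo_fsP _ sQR sRP)[z [g [Cz Mg ->]]].
  have [sQRg sRgP] := fs_im fsM sQR sRP Mg.
  rewrite quo_conj // => /(@quo_fsP (R :^ g)%G _ sQRg sRgP)[y [h [Cy Mh ->]]].
  have Ng := fs_normQ sQR sRP Mg; have Nh := fs_normQ sQRg sRgP Mh.
  apply/quo_fsP => //; exists (z * (y ^ (coset Q g)^-1)), (g * h); split.
  + by rewrite groupM // -mem_conjg -centJ -quotientJ.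
  + exact: (fs_mul fsM).
  by rewrite morphM // conjgE invgK !mulgA mulgKV.
- move=> _ /quo_lift[R [-> sQR sRP]] /(quo_fsP _ sQR sRP)[z [g [Cz Mg ->]]].
  have [sQRg sRgP] := fs_im fsM sQR sRP Mg; have Ng := fs_normQ sQR sRP Mg.
  rewrite quo_conj //; apply/(@quo_fsP (R :^ g)%G) => //.
  exists (z^-1 ^ coset Q g), g^-1; split.
  + by rewrite /= quotientJ // centJ memJ_conjg groupV.
  + exact: (fs_inv fsM).
  by rewrite morphV // invMg conjgE -!mulgA mulgV mulg1.
move=> _ sSR /quo_lift[R [eR sQR sRP]]; rewrite {Rb}eR in sSR *.
have [S [eS sQS sSP]] := quo_lift (subset_trans sSR (quotientS Q sRP)).
rewrite {Sb}eS in sSR *; apply/subsetP=> _ /(quo_fsP _ sQR sRP)[z [g [Cz Mg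
  ->]]].
have sSR' : S \subset R by rewrite -(quotientSGK _ sQR) // (subset_trans sSP).
apply/quo_fsP => //; exists z, g; split=> //; first by apply: subsetP Cz;
  rewrite centS.
exact: (subsetP (fs_res fsM sQS sSR' sRP)).
Qed.

(** #|A : X| divides the index of B / C in A / C, which is prime to p, so a Sylow subgroup of X is
    one of A. *)
Lemma Sylow_in_index (rT : finGroupType) (A X C B : {group rT}) :
    C <| A -> C \subset X -> X \subset A -> B \subset X ->
      p.-Sylow(A / C) (B / C) ->
  exists2 V : {group rT}, p.-Sylow(A) V & V \subset X.
Proof.
move=> /andP[sCA nCA] sCX sXA sBX /and3P[_ _ p'i].
have [V sylV] := Sylow_exists p X; have [sVX pV p'XV] := and3P sylV;
  exists V => //.
rewrite /pHall (subset_trans sVX)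
  // pV /= -(Lagrange_index sXA sVX) pnatM p'XV andbT.
have -> : #|A : X| = #|A / C : X / C|.
  rewrite index_quotient_eq //; exact: subset_trans (subsetIr _ _) sCX.
by apply: pnat_dvd p'i; rewrite indexgS ?quotientS.
Qed.

Lemma quo_fs_aut R : Q \subset R -> R \subset P ->
  fs_aut quo_fs (R / Q) = 'C(R / Q) * (fs_aut M R / Q) :> {set _}.
Proof.
move=> sQR sRP; have fsQ := quo_fsys;
  have sRPQ : R / Q \subset P / Q by apply: quotientS.
rewrite (fs_autP fsQ) ?sub1G //; apply/setP=> gb; apply/setIP/mulsgP.
  case=> /(quo_fsP _ sQR sRP)[z [g [Cz Mg ->]]] Ng; exists z (coset Q g) => //.
  have NQg := fs_normQ sQR sRP Mg.
  rewrite mem_quotient // (fs_autE fsM) // Mg; apply/normP.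
  have [sQRg sRgP] := fs_im fsM sQR sRP Mg.
  have e : (R :^ g)%G / Q = R / Q by rewrite -(quo_conj sQR sRP Mg Cz) (normP
    Ng).
  by have := quotient_inj (fs_nsQ sQRg sRgP) (fs_nsQ sQR sRP) e.
case=> z _ Cz /morphimP[a Na Aa ->] ->; move: Aa;
  rewrite (fs_autE fsM) // => /andP[Ma NRa].
split; first by apply/quo_fsP => //; exists z, a.
rewrite groupM //; first exact: (subsetP (cent_sub _)).
by rewrite (subsetP (quotient_norm _ _)) // mem_quotient.
Qed.

(* A lift g of an isomorphism can be corrected by an element of the kernel    *)
(* kap of the action on R / Q, by Sylow's theorem in 'N_P(R) kap.             *)
Lemma quo_good R : Q \subset R -> R \subset P -> fs_good p Q P M R ->
  fs_good p 1%G (P / Q)%G quo_fs (R / Q).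
Proof.
move=> sQR sRP [[U sylU sU] ext]; have fsQ := quo_fsys.
have sRPQ : R / Q \subset P / Q by apply: quotientS.
have nsQR := fs_nsQ sQR sRP.
have nQA : fs_aut M R \subset 'N(Q).
  by apply/subsetP=> a; rewrite (fs_autE fsM) // => /andP[Ma _];
    apply: (fs_normQ sQR sRP).
have sCA := fs_aut_cent fsM sQR sRP; have nQC := subset_trans sCA nQA.
have [sUA pU _] := and3P sylU.
have CRQ : 'C(R) / Q \subset 'C(R / Q) by apply: quotient_cent.
have NRQ : 'N_P(R) / Q \subset 'N_(P / Q)(R / Q).
  by rewrite subsetI quotientS ?subsetIl // quotient_norms // subsetIr.
have sNCQ : ('N_P(R) * 'C(R)) / Q \subset 'N_(P / Q)(R / Q) * 'C(R / Q).
  rewrite quotientMl ?mulgSS //; apply: subset_trans nQP; exact: subsetIl.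
have mulX : 'N_(P / Q)(R / Q) * 'C(R / Q) = 'N_(P / Q)(R / Q) <*> 'C(R / Q).
  by rewrite mul_cent_group ?subsetIr.
split.
  pose X := ('N_(P / Q)(R / Q) <*> 'C(R / Q))%G.
  have nCA := fs_cent_aut fsQ (sub1G (R / Q)) sRPQ.
  rewrite mulX; apply: (@Sylow_in_index _ (fs_aut quo_fs (R / Q)) X ('C(R /
    Q))%G (U / Q)%G) => //.
  - exact: joing_subr.
  - by rewrite join_subG (fs_aut_inn fsQ) ?sub1G // (fs_aut_cent fsQ) ?sub1G.
  - by rewrite /X /= -mulX; apply: subset_trans sNCQ; rewrite quotientS.
  rewrite quo_fs_aut // quotientMidl; apply: quotient_pHall.
    rewrite /= (subset_trans (quotientS Q sUA)) //.
    by apply: subset_trans (normal_norm nCA); rewrite quo_fs_aut // mulG_subr.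
  by apply: quotient_pHall => //; apply: subset_trans sUA nQA.
move=> Sb Tb gb _ sST sTN.
have [sTPQ nST] : Tb \subset P / Q /\ Tb \subset 'N(Sb) by apply/andP;
  rewrite -subsetI.
have [S [eS sQS sSP]] := quo_lift (subset_trans sST sTPQ).
have [T [eT sQT sTP]] := quo_lift sTPQ.
rewrite {Sb}eS {Tb}eT in sST nST sTPQ sTN *.
have sSTg : S \subset T by rewrite -(quotientSGK _ sQT) // (subset_trans sSP).
have nSTg : T \subset 'N(S).
  have nQT := subset_trans sTP nQP; have := nST.
  by rewrite -quotient_normG ?fs_nsQ // quotientSGK // (subset_trans sQS)
    ?normG.
case/(quo_fsP _ sQS sSP) => z [g [Cz Mg ->]]; rewrite quo_conj // => eSg sTg.
have sTgj := sTg; rewrite mulX in sTgj.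
have Ng := fs_normQ sQS sSP Mg.
have [sQSg sSgP] := fs_im fsM sQS sSP Mg.
have {}eSg : S :^ g = R := quotient_inj (fs_nsQ sQSg sSgP :
  Q <| (S :^ g)%G) nsQR eSg.
have sTgA : T :^ g \subset fs_aut M R.
  rewrite -eSg -(fs_autJ fsM)
    // conjSg (subset_trans _ (fs_aut_inn fsM sQS sSP)) //.
  by rewrite subsetI sTP.
pose kap := (fs_aut M R :&: coset Q @*^-1 'C(R / Q))%G.
have nkA : fs_aut M R \subset 'N(kap).
  rewrite normsI ?normG //.
  have nCA : fs_aut M R / Q \subset 'N('C(R / Q)).
    by rewrite norms_cent // quotient_norms // (fs_aut_norm fsM).
  by apply: subset_trans (morphpre_norms _ nCA); rewrite -sub_quotient_pre.
have sNA := fs_aut_inn fsM sQR sRP.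
have kapE a : a \in fs_aut M R -> (a \in kap) = (coset Q a \in 'C(R / Q)).
  by move=> Aa; rewrite in_setI Aa /= morphpreE in_setI (subsetP nQA) // inE.
have sCk : 'C(R) \subset kap.
  by apply/subsetP=> c Cc; rewrite kapE
    ?(subsetP sCA) // (subsetP CRQ) // mem_quotient.
pose X := ('N_P(R) <*> kap)%G.
have nkN : 'N_P(R) \subset 'N(kap) := subset_trans sNA nkA.
have dX' : X = 'N_P(R) * kap :> {set gT} by rewrite /= norm_joinEl.
have dX : X = kap * 'N_P(R) :> {set gT} by rewrite dX' normC.
have sXA : X \subset fs_aut M R by rewrite join_subG sNA subsetIl.
have sUX : U \subset X by rewrite dX' (subset_trans sU) // mulgS.
(* Modulo [kap], elements of T :^ g act as elements of 'N_P(R). The hypothesis concerns conjugation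
   by z * coset Q g instead of coset Q g; the commutator [~ coset Q t, z^-1] makes up for it. *)
have sTgX : T :^ g \subset X.
  apply/subsetP=> y Ty; have Ay := subsetP sTgA y Ty.
  have /imsetP[t Tt ey] := Ty.
  have Nt : t \in 'N(Q) by rewrite (subsetP nQP) ?(subsetP sTP).
  have : coset Q y \in 'N_(P / Q)(R / Q) * 'C(R / Q).
    have Tbt : coset Q t \in T / Q by rewrite mem_quotient.
    have eyt : coset Q y = coset Q t ^ coset Q g by rewrite ey morphJ.
    have Cw : [~ coset Q t, z^-1] \in 'C(S / Q).
      rewrite commgEr groupM ?groupV // memJ_norm ?groupV //.
      by rewrite (subsetP (norms_cent nST)) ?groupV.
    have -> : coset Q y = (coset Q t * [~ coset Q t, z^-1]) ^ (z * coset Q g).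
      by rewrite -conjg_mulR eyt -conjgM mulKg.
    rewrite conjMg mulX groupM //.
      by rewrite (subsetP sTgj) // memJ_conjg.
    rewrite (subsetP (joing_subr _ _))
      //= -eSg -(quo_conj sQS sSP Mg Cz) centJ memJ_conjg //.
  case/mulsgP=> nb cb /setIP[/morphimP[m NQm Pm ->] Nm] Cc ey'.
  have NRm : m \in 'N(R).
    have [sQRm sRmP] := fs_im fsM sQR sRP (subsetP (fs_inn fsM sQR sRP) m Pm).
    apply/normP; apply: (quotient_inj (fs_nsQ sQRm sRmP :
      Q <| (R :^ m)%G) nsQR).
    by rewrite /= quotientJ // (normP Nm).
  have NPm : m \in 'N_P(R) by rewrite inE Pm.
  have Am := subsetP sNA m NPm.
  rewrite dX'; apply/mulsgP; exists m (m^-1 * y) => //; last by rewrite mulKVg.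
  rewrite kapE ?groupM ?groupV // morphM ?groupV
    ?(subsetP nQA) // morphV //= ey'.
  by rewrite mulKg.
have pTg : p.-group (T :^ g) by rewrite pgroupJ (pgroupS sTP).
have [b] := Sylow_Jsub (pHall_subl sUX sXA sylU) sTgX pTg.
rewrite dX => /mulsgP[k m /setIP[Ak Ck] NPm ->] sub.
have {}sub : T :^ (g * k) \subset 'N_P(R) * 'C(R).
  have mulR : 'N_P(R) * 'C(R) = 'N_P(R) <*> 'C(R) by rewrite mul_cent_group
    ?subsetIr.
  rewrite -(conjSg _ _ m) -conjsgM -mulgA conjsgM (subset_trans sub)
    // (subset_trans sU) //.
  by rewrite mulR conjGid // (subsetP (joing_subl _ _)).
have [Mgk eR] := fs_mem_aut fsM sQS sSP Mg eSg Ak.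
have sTNS : T \subset 'N_P(S) by rewrite subsetI sTP.
have [c Cc Mgkc] := ext S T (g * k) sQS sSTg sTNS Mgk eR sub.
have NQk := subsetP nQA k Ak; have NQc := subsetP nQC c Cc.
(* The first factor cancels z, leaving the image of g * k * c. *)
exists ((z^-1 ^ coset Q g) * coset Q (k * c)); last first.
  suff -> : z * coset Q g * (z^-1 ^ coset Q g * coset Q (k * c)) = coset Q (g *
    k * c).
    exact: quo_fs_coset.
  rewrite -(mulgA g k c) [in RHS]morphM ?groupM //=.
  move: (coset Q g) (coset Q (k * c)) => u v.
  rewrite [LHS]mulgA -(mulgA z);
    have -> : u * z^-1 ^ u = z^-1 * u by rewrite conjgE mulKVg.
  by rewrite mulKVg.
rewrite groupM //.
  by rewrite /= -eSg quotientJ // centJ memJ_conjg groupV.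
rewrite morphM // groupM //; first by move: Ck; rewrite !inE => /andP[].
by rewrite (subsetP CRQ) // mem_quotient.
Qed.

Lemma quo_sat : fs_sat p Q P M -> fs_sat p 1%G (P / Q)%G quo_fs.
Proof.
move=> sM Rb _ /quo_lift[R [-> sQR sRP]]; have [g Mg gR] := sM R sQR sRP.
have [sQRg sRgP] := fs_im fsM sQR sRP Mg.
exists (coset Q g); first exact: quo_fs_coset.
by have := quo_good sQRg sRgP gR; rewrite /= quotientJ // (fs_normQ sQR sRP).
Qed.
End Quo.
Arguments quo_fs [gT] Q M X.

(** * Nontrivial p'-automorphisms in normalizers and quotients *)

Section Bad.
Variables (p : nat) (gT : finGroupType).
Implicit Types (R S T Y U D : {group gT}).

(** Boolean, so that one can decide it and maximize over it. Q \subset R is required separately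
    because Y, for instance ZJ(D), need not contain Q. *)
Definition fs_bad (Q P : {group gT}) (M : {set gT} -> {set gT})
    (Y : {set gT}) : bool :=
  [exists R : {group gT}, exists a,
    [&& Q \subset R, Y \subset R, R \subset 'N_P(Y), a \in fs_aut M R,
        a \in 'N(Y), p^'.-elt a & a \notin 'C(R)]].

Lemma fs_badP (Q P : {group gT}) M (Y : {set gT}) :
  reflect (exists R a, Q \subset R /\ bad p P M Y R a) (fs_bad Q P M Y).
Proof.
apply: (iffP existsP) => [[R /existsP[a /and5P[sQR sYR sRN Aa /and3P[Na p'a
  Ca]]]] | ].
  by exists R, a; split=> //; split=> //; apply/andP.
case=> R [a [sQR [sYR sRN Aa Na /andP[p'a Ca]]]]; exists R; apply/existsP;
  exists a.
by apply/and5P; split=> //; apply/and3P.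
Qed.

End Bad.

Section Fixed.
Variables (p : nat) (gT : finGroupType).
Implicit Types (R S T Y U D : {group gT}).
Variables (Q P : {group gT}) (M : {set gT} -> {set gT}).
Hypotheses (fsM : fsys Q P M) (pP : p.-group P).

Lemma norm_fs_aut Y R : Q \subset Y -> Y \subset P -> Y \subset R ->
  R \subset 'N_P(Y) ->
  fs_aut (norm_fs M Y) R = fs_aut M R :&: 'N(Y) :> {set gT}.
Proof.
move=> sQY sYP sYR sRN; have sRP : R \subset P :=
  subset_trans sRN (subsetIl _ _).
rewrite (fs_autP (norm_fsys fsM sQY sYP)) // (fs_autP fsM) //
  ?(subset_trans sQY) //.
by rewrite /norm_fs setIAC.
Qed.

Lemma fs_bad_norm Y : Q \subset Y -> Y \subset P -> fs_bad p Q P M Y ->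
  fs_bad p Y ('N_P(Y))%G (norm_fs M Y) Y.
Proof.
move=> sQY sYP /fs_badP[R [a [sQR [sYR sRN Aa Na p'a]]]].
apply/fs_badP; exists R, a; split=> //; split=> //.
  by rewrite subsetI sRN (subset_trans sRN) ?subsetIr.
by rewrite norm_fs_aut // inE Aa.
Qed.

Lemma fs_bad_of_norm Y (X : {set gT}) : Q \subset Y -> Y \subset P ->
  fs_bad p Y ('N_P(Y))%G (norm_fs M Y) X -> fs_bad p Q P M X.
Proof.
move=> sQY sYP /fs_badP[R [a [sYR [sXR sRN Aa Na p'a]]]].
have sRNY : R \subset 'N_P(Y) by apply: subset_trans sRN (subsetIl _ _).
apply/fs_badP; exists R, a; split; [exact: subset_trans sYR | split=> //].
  by apply: subset_trans sRN _; rewrite setSI ?subsetIl.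
by move: Aa; rewrite norm_fs_aut // => /setIP[].
Qed.

Lemma fs_bad_quo R a r : Q \subset R -> R \subset P -> a \in fs_aut M R ->
  p^'.-elt a ->
  r \in R -> [~ r, a] \notin Q -> fs_bad p 1%G (P / Q)%G (quo_fs Q M) 1.
Proof.
move=> sQR sRP Aa p'a Rr not_ra; apply/fs_badP; exists (R / Q)%G, (coset Q a).
have /andP[Ma _] : (a \in M R) && (a \in 'N(R)) by rewrite -(fs_autE fsM).
have NQa := fs_normQ fsM sQR sRP Ma.
have NQr : r \in 'N(Q) by rewrite (subsetP (normal_norm (fs_nsQ fsM sQR sRP))).
split; first exact: sub1G.
split; rewrite ?sub1G //.
- by rewrite norm1 setIT quotientS.
- by rewrite (quo_fs_aut fsM) // (subsetP (mulG_subr _ _)) // mem_quotient.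
- by rewrite norm1 inE.
rewrite morph_p_elt //; apply: contra not_ra => Ca.
apply: coset_idr; first by rewrite groupR.
rewrite morphR //; apply/eqP/commgP/commute_sym/(centP Ca).
by rewrite mem_quotient.
Qed.

(** Lift the automorphism modulo 'C(R / Q) and keep the p'-part of the lift. *)
Lemma fs_bad_lift Y : Q \subset Y -> Y \subset P -> P \subset 'N(Y) ->
  fs_bad p 1%G (P / Q)%G (quo_fs Q M) (Y / Q) -> fs_bad p Q P M Y.
Proof.
move=> sQY sYP nYP /fs_badP[Rb [ab [_ [sYR sRN Aa Na /andP[p'a not_Ca]]]]].
have sRPQ : Rb \subset P / Q by apply: subset_trans sRN (subsetIl _ _).
have [R [eR sQR sRP]] := quo_lift fsM sRPQ;
  rewrite {Rb}eR in sYR sRN Aa not_Ca sRPQ *.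
have sYRg : Y \subset R.
  by rewrite -(quotientSGK _ sQR) // (subset_trans sYP)
    // (normal_norm (fs_normal fsM)).
move: Aa; rewrite /= (quo_fs_aut fsM) // =>
  /mulsgP[z _ Cz /morphimP[a0 NQa0 Aa0 ->] ea].
have /andP[Ma0 NRa0] : (a0 \in M R) && (a0 \in 'N(R)) by rewrite -(fs_autE fsM).
have a0E : coset Q a0 = z^-1 * ab by rewrite ea mulKg.
have NYa0 : a0 \in 'N(Y).
  have MYa0 : a0 \in M Y by apply: (subsetP (fs_res fsM sQY sYRg sRP)).
  have [sQYa sYaP] := fs_im fsM sQY sYP MYa0.
  apply/normP; apply: (quotient_inj (fs_nsQ fsM sQYa sYaP :
    Q <| (Y :^ a0)%G) (fs_nsQ fsM sQY sYP)).
  have Nz : z \in 'N(Y / Q) by apply: subsetP Cz; rewrite cents_norm // centS.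
  by rewrite /= quotientJ // [coset Q a0]a0E conjsgM (normP (groupVr Nz))
    (normP Na).
apply/fs_badP; exists R, a0.`_p^'; split=> //; split=> //.
- by rewrite subsetI sRP (subset_trans sRP).
- exact: groupX.
- exact: groupX.
rewrite p_elt_constt /=; apply: contra not_Ca => Ca.
have nC : fs_aut (quo_fs Q M) (R / Q) \subset 'N('C(R / Q)).
  exact: normal_norm (fs_cent_aut (quo_fsys fsM) (sub1G _) sRPQ).
have NC x : x \in fs_aut M R -> coset Q x \in 'N('C(R / Q)).
  move=> Ax; apply: (subsetP nC);
    rewrite (quo_fs_aut fsM) // (subsetP (mulG_subr _ _)) //.
  rewrite mem_quotient //.
have Nz : z \in 'N('C(R / Q)) by rewrite (subsetP (normG _)).
have Nab : ab \in 'N('C(R / Q)) by rewrite ea groupM ?NC.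
(* If the p'-part of a0 centralized R, then ab would act on R / Q as a p-element, although it is a
   p'-element. *)
have e1 : coset 'C(R / Q) ab = coset 'C(R / Q) (coset Q a0.`_p).
  rewrite ea morphM ?NC //= coset_id // mul1g.
  rewrite -{1}(consttC p a0) morphM ?groupX // morphM ?NC ?groupX //=.
  rewrite [X in _ * X]coset_id ?mulg1 //.
  by rewrite (subsetP (quotient_cent _ _)) // mem_quotient.
apply: coset_idr => //.
have p'c : p^'.-elt (coset 'C(R / Q) ab) by rewrite morph_p_elt.
have pc : p.-elt (coset 'C(R / Q) ab).
  by rewrite e1 morph_p_elt ?NC ?groupX // morph_p_elt ?groupX // p_elt_constt.
exact: pelt_p'elt_eq1 pc p'c.
Qed.

(** The extension property of Q extends y to Y after a correction in 'C(Q). The p'-part of the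
    extension still agrees with y modulo 'C(Q), as y is a p'-element. *)
Lemma ext_pelt Y y : fs_good p Q P M Q -> Q \subset Y -> Y \subset P ->
  'C_P(Q) \subset Y ->
    y \in fs_aut M Q -> p^'.-elt y -> Y :^ y \subset Y * 'C(Q) ->
  exists a d, [/\ a \in fs_aut M Y, p^'.-elt a, d \in 'C(Q) & a = y * d].
Proof.
move=> [_ ext] sQY sYP sCY Ay p'y sYy; have sQP := fs_sub fsM.
have nsQP := fs_normal fsM; have nQP := normal_norm nsQP.
have /andP[My Ny] : (y \in M Q) && (y \in 'N(Q)) by rewrite -(fs_autE fsM).
have sYN : Y \subset 'N_P(Q) by rewrite subsetI sYP (subset_trans sYP).
have [|c Cc Myc] := ext Q Y y (subxx Q) sQY sYN My (normP Ny).
  by apply: subset_trans sYy _; rewrite mulSg.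
have [sQYc sYcP] := fs_im fsM sQY sYP Myc.
have nYC : Y \subset 'N('C(Q)) by rewrite norms_cent // (subset_trans sYP).
have NCc : c \in 'N(Y * 'C(Q)).
  by rewrite mul_cent_group ?(subset_trans sYP) // (subsetP (normG _))
    // (subsetP (joing_subr _ _)).
have sYycY : Y :^ (y * c) \subset Y.
  (* By the modular law this intersection is Y 'C_P(Q) = Y. *)
  apply: subset_trans (_ : P :&: (Y * 'C(Q)) \subset Y).
    by rewrite subsetI sYcP conjsgM -(normP NCc) conjSg.
  by rewrite setIC -group_modl // ['C(Q) :&: P]setIC mulGSid.
have Ayc : y * c \in fs_aut M Y by rewrite (fs_autE fsM) // Myc inE sYycY.
have NC x : x \in fs_aut M Q -> x \in 'N('C(Q)).
  move=> Ax; have := normal_norm (fs_cent_aut fsM (subxx Q) sQP).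
  by move/subsetP=> /(_ x Ax).
have Ac : c \in fs_aut M Q by rewrite (subsetP (fs_aut_cent fsM (subxx Q) sQP)).
exists (y * c).`_p^', (y^-1 * (y * c).`_p^').
rewrite groupX ?p_elt_constt ?mulKVg //; split=> //.
have NCy := NC y Ay; have NCyc : y * c \in 'N('C(Q)) by rewrite groupM ?NC.
have e : coset 'C(Q) (y * c).`_p^' = coset 'C(Q) y.
  rewrite morph_constt //= morphM ?NC //= (coset_id Cc) mulg1.
  by rewrite constt_p_elt // morph_p_elt.
apply: coset_idr; first by rewrite groupM ?groupV ?groupX.
by rewrite morphM ?groupV ?groupX //= e morphV // mulVg.
Qed.
End Fixed.

(* nobad and trivQ express that induction does not apply: no Y > Q normal in  *)
(* P is bad, and the fusion system modulo Q is trivial.                       *)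
Section Constrained.
Variables (p : nat) (gT : finGroupType).
Implicit Types (R S T Y U D : {group gT}).
Variables (Q P : {group gT}) (M : {set gT} -> {set gT}).
Hypotheses (p_pr : prime p) (p_odd : odd p).
Hypotheses (fsM : fsys Q P M) (pP : p.-group P) (gQ : fs_good p Q P M Q).
Hypothesis cQQ : 'C_P(Q) \subset Q.
Hypothesis trivQ : forall R a r, Q \subset R -> R \subset P ->
  a \in fs_aut M R ->
  p^'.-elt a -> r \in R -> [~ r, a] \in Q.
Hypothesis badQ : exists2 a, a \in fs_aut M Q & p^'.-elt a && (a \notin 'C(Q)).
Hypothesis nobad : forall Y, Q \proper Y -> Y \subset P -> P \subset 'N(Y) ->
  ~~ fs_bad p Q P M Y.

Let A := fs_aut M Q.
Let W := (Q <*> 'C(Q))%G.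
Let sQP : Q \subset P := fs_sub fsM.
Let nsQP : Q <| P := fs_normal fsM.
Let nQP : P \subset 'N(Q) := normal_norm nsQP.
Let sPA : P \subset A.
Proof. by rewrite -(setIidPl nQP) (fs_aut_inn fsM). Qed.
Let nQA : A \subset 'N(Q) := fs_aut_norm fsM (subxx Q) sQP.
Let sCA : 'C(Q) \subset A := fs_aut_cent fsM (subxx Q) sQP.
Let dW : W = Q * 'C(Q) :> {set gT}.
Proof. by rewrite mul_cent_group ?normG. Qed.
Let sWA : W \subset A.
Proof. by rewrite join_subG sCA (subset_trans sQP). Qed.
Let nWA : A \subset 'N(W).
Proof. by rewrite normsY // norms_cent. Qed.
Let sCW : 'C(Q) \subset W. Proof. exact: joing_subr. Qed.
Let sQW : Q \subset W. Proof. exact: joing_subl. Qed.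
Let nWP := subset_trans sPA nWA.

(** Q is normal in P, so some Sylow subgroup of A lies in P 'C(Q), and W absorbs 'C(Q). *)
Lemma Sylow_quo : p.-Sylow(A / W) (P / W).
Proof.
have [[U sylU]] := gQ; rewrite (setIidPl nQP) => sU _.
have sUPW : U / W \subset P / W.
  rewrite quotientSK; last exact: subset_trans (pHall_sub sylU) nWA.
  by apply: subset_trans sU _; rewrite normC ?norms_cent // mulSg.
have sylUW := quotient_pHall (subset_trans (pHall_sub sylU) nWA) sylU.
have pPW : p.-group (P / W) by apply: quotient_pgroup.
by rewrite /= (sub_pHall sylUW pPW sUPW (quotientS W sPA)).
Qed.

Lemma sub_mulW Y (X : {set gT}) : Q \subset Y -> X \subset Y * W ->
  X \subset Y * 'C(Q).
Proof.
by move=> sQY; rewrite dW mulgA mulGSid.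
Qed.

(** After conjugation V lies in P / W. A p'-element normalizing V then extends, by [ext_pelt], to a
    p'-automorphism of the preimage R of V in P, and [trivQ] makes it trivial modulo Q. *)
Lemma pelt_centralize_quo : pelt_centralize p (A / W)%G.
Proof.
suff claim (V : {group coset_of W}) yb : V \subset P / W ->
  yb \in 'N_(A / W)(V) ->
    p^'.-elt yb -> yb \in 'C(V).
  move=> V yb pV sVG /setIP[Gy Ny] p'y.
  have [g Gg sVg] := Sylow_Jsub Sylow_quo sVG pV.
  rewrite -(memJ_conjg _ g) -centJ claim ?p_eltJ //.
  by rewrite inE groupJ //= normJ memJ_conjg.
move=> sVP /setIP[/morphimP[y0 NWy0 Ay0 ->] NVy] p'y.
pose y := y0.`_p^'; have Ay : y \in A by rewrite groupX.
have NWA a : a \in A -> a \in 'N(W) by apply: (subsetP nWA).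
have ey : coset W y0 = coset W y.
  by rewrite morph_constt //= constt_p_elt.
pose R := (P :&: coset W @*^-1 V)%G.
have sRP : R \subset P := subsetIl _ _.
have sQR : Q \subset R by rewrite subsetI sQP -sub_quotient_pre
  ?(subset_trans sQP) // quotientS1 // sub1G.
have eV : V = R / W :> {set _}.
  apply/eqP; rewrite eqEsubset; apply/andP; split.
    apply/subsetP=> v Vv; have /morphimP[x NWx Px ev] := subsetP sVP v Vv.
    rewrite ev mem_quotient //; apply/setIP; split=> //=.
    by rewrite morphpreE in_setI NWx inE -ev.
  by rewrite sub_quotient_pre ?subsetIr ?(subset_trans sRP).
have sRyW : R :^ y \subset R * W.
  have sRyA : R :^ y \subset A by rewrite -(conjGid Ay) conjSg (subset_trans
    sRP).
  rewrite normC ?(subset_trans sRP) // -quotientSK ?(subset_trans sRyA) //.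
  by rewrite quotientJ ?NWA // -eV -ey (normP NVy).
have p'y' : p^'.-elt y by apply: p_elt_constt.
have [a [d [Aa p'a Cd ea]]] :=
  ext_pelt fsM gQ sQR sRP (subset_trans cQQ sQR) Ay p'y' (sub_mulW sQR sRyW).
have Aa' : a \in A.
  by rewrite ea groupM // (subsetP sCA).
have eya : coset W y0 = coset W a.
  have Ad : d \in A := subsetP sCA d Cd.
  by rewrite ey ea [RHS]morphM ?NWA //= (coset_id (subsetP sCW d Cd)) mulg1.
rewrite /= eya eV; apply/centP=> _ /morphimP[r NWr Rr ->];
  apply/commute_sym/commgP.
have Na := NWA a Aa'; rewrite -morphR //= coset_id // (subsetP sQW) //.
exact: trivQ Aa p'a Rr.
Qed.

(** The normal p-complement K0 of A / W is nontrivial by [badQ]. It contains a nontrivial abelian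
    subgroup normalized by P, whose preimage H satisfies the hypotheses of
    [center_thompson_invariant]. *)
Lemma constrained_bad D : D <| P -> A \subset 'N(D :&: Q) ->
  fs_bad p Q P M 'Z(thompson D).
Proof.
move=> nsDP nEA; pose K0 := 'O_p^'(A / W)%G.
have pcG := pelt_centralize_pcore p_pr pelt_centralize_quo.
have NWA a : a \in A -> a \in 'N(W) by apply: (subsetP nWA).
have W_pelt y : y \in W -> p^'.-elt y -> y \in 'C(Q).
  move=> Wy p'y; have nCW : W \subset 'N('C(Q)) by rewrite join_subG normG
    norms_cent ?normG.
  have Ny := subsetP nCW y Wy; apply: coset_idr => //.
  have p'c : p^'.-elt (coset 'C(Q) y) by rewrite morph_p_elt.
  have pc : p.-elt (coset 'C(Q) y).
    apply: (@mem_p_elt _ p _ (Q / 'C(Q))%G);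
      first by rewrite quotient_pgroup // (pgroupS sQP).
    by rewrite /= -quotientYidr ?norms_cent ?normG // mem_quotient.
  exact: pelt_p'elt_eq1 pc p'c.
have ntK0 : K0 :!=: 1.
  apply/eqP=> K01; have [a Aa /andP[p'a /negP[]]] := badQ.
  apply: W_pelt => //; apply: coset_idr; first exact: NWA.
  have pG : p.-group (A / W) by rewrite /pgroup -(indexg1 (A / W)) -K01.
  have pc : p.-elt (coset W a) by apply: mem_p_elt pG _; rewrite mem_quotient.
  have p'c : p^'.-elt (coset W a) by rewrite morph_p_elt ?NWA.
  exact: pelt_p'elt_eq1 pc p'c.
have p'K0 : p^'.-group K0 := pcore_pgroup _ _.
have nK0P : P / W \subset 'N(K0).
  by apply: subset_trans (normal_norm (pcore_normal _ _)); rewrite quotientS.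
have pPW : p.-group (P / W) := quotient_pgroup W pP.
have coKP : coprime #|K0| #|P / W| by rewrite coprime_sym (pnat_coprime pPW).
(* Any prime divisor would do: coprime action yields a Sylow q-subgroup of K0 normalized by P / W,
   and its center is abelian and nontrivial. *)
pose q := pdiv #|K0|.
have [Kq sylKq nKqP] := sol_coprime_Sylow_exists q (pgroup_sol pPW) nK0P coKP.
have [sKqK0 qKq _] := and3P sylKq.
have ntKq : Kq :!=: 1.
  rewrite -rank_gt0 (rank_Sylow sylKq) p_rank_gt0 pi_pdiv cardG_gt1 //.
pose K := 'Z(Kq)%G.
have ntK : K :!=: 1 by rewrite /= center_nil_eq1 ?(pgroup_nil qKq).
have nKP : P / W \subset 'N(K).
  by apply: subset_trans (norm_center Kq).
have sKK0 : K \subset K0 := subset_trans (center_sub _) sKqK0.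
have sKG : K \subset A / W := subset_trans sKK0 (pcore_sub _ _).
have nsWA : W <| A by rewrite /normal sWA.
have [H eH sWH sHA] := inv_quotientS nsWA sKG.
have nHP : P \subset 'N(H).
  have nsWH : W <| H by rewrite /normal sWH (subset_trans sHA).
  rewrite -(quotientGK nsWH) -eH.
  by apply: subset_trans (morphpre_norms _ nKP); rewrite -sub_quotient_pre.
pose L := (H <*> P)%G.
have dL : L = H * P :> {set gT} by rewrite /= norm_joinEr.
have sLA : L \subset A by rewrite join_subG sHA.
have nsHL : H <| L by rewrite /normal joing_subl join_subG normG.
have sPL : P \subset L := joing_subr _ _.
have nsWL : W <| L by rewrite /normal (subset_trans sWH)
  ?joing_subl // (subset_trans sLA).
have nWH : H \subset 'N(W) := subset_trans sHA nWA.
have p'K : p^'.-group K := pgroupS sKK0 p'K0.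
have p'H : p^'.-nat #|H : W| by rewrite -card_quotient // -eH.
have abH : [~: H, H] \subset W by rewrite -quotient_cents2
  // -eH -/(abelian _) center_abelian.
(* If y centralizes N1 modulo W, it extends to N1 by [ext_pelt]; for y outside W the extension would
   make N1 bad, against [nobad]. *)
have regH (N1 : {group gT}) : N1 <| P -> Q \proper N1 ->
    {in H, forall y, p^'.-elt y -> [~: [set y], N1] \subset W -> y \in W}.
  move=> /andP[sN1P nN1P] ltQN1 y Hy p'y yN1; have sQN1 := proper_sub ltQN1.
  have Ay := subsetP sHA y Hy.
  have sNyW : N1 :^ y \subset N1 * W.
    rewrite normC ?(subset_trans sN1P) //; apply/subsetP=> _ /imsetP[x N1x ->].
    have -> : x ^ y = [~ y, x^-1] * x by rewrite commgEl !conjgE invgK !mulgA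
      mulgKV.
    apply: mem_mulg => //; apply: (subsetP yN1); apply: mem_commg;
      first exact: set11.
    by rewrite groupV.
  have [a [d [Aa p'a Cd ea]]] :=
    ext_pelt fsM gQ sQN1 sN1P (subset_trans cQQ sQN1) Ay p'y (sub_mulW sQN1
    sNyW).
  apply: contraR (nobad ltQN1 sN1P nN1P) => not_Wy.
  apply/fs_badP; exists N1, a; split=> //; split=> //.
  - by rewrite subsetI sN1P normG.
  - by apply: subsetP Aa; apply: (fs_aut_norm fsM).
  rewrite p'a; apply: contra not_Wy => Ca; apply: (subsetP sCW).
  have : a \in 'C(Q) by apply: subsetP Ca; rewrite centS.
  by rewrite ea groupMr.
have [k Kk ntk] := trivgPn _ ntK.
have : k \in H / W by rewrite -eH.
case/morphimP=> h NWh Hh ek; pose y := h.`_p^'.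
have Hy : y \in H by rewrite groupX.
have p'y : p^'.-elt y := p_elt_constt _ _.
have eky : k = coset W y.
  by rewrite /y morph_constt //= -ek constt_p_elt // (mem_p_elt p'K).
have not_Cy : y \notin 'C(Q).
  by apply: contra ntk => Cy; rewrite eky coset_id ?(subsetP sCW).
have sWQC : W \subset Q * 'C(Q) by rewrite dW.
have ex_y : exists2 y0, y0 \in H & p^'.-elt y0 && (y0 \notin 'C(Q)).
  by exists y; rewrite // p'y.
have sLHP : L \subset H * P by rewrite dL.
have nEH := subset_trans sHA nEA.
have [sZQ nZH] := center_thompson_invariant p_odd pP sQP nsHL sPL (subset_trans
  sLA nQA) sQW nsWL sWH sWQC p'H abH regH nsDP sLHP nEH ex_y.
have Ay := subsetP sHA y Hy.
apply/fs_badP; exists Q, y; split=> //; split=> //.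
- rewrite subsetI sQP (subset_trans sQP) //;
  apply: subset_trans (norm_thompson D).
  exact: normal_norm.
- exact: (subsetP nZH).
- by rewrite p'y.
Qed.
End Constrained.

(** * The main induction *)

(** Induction on #|P : Q| + #|P|. Passing to N_F(Y) with Y > Q lowers the index without raising the
    order; passing to the quotient by Q <> 1 lowers the order and keeps the index. *)
Lemma bad_center_thompson (p : nat) (p_pr : prime p) (p_odd : odd p)
    (gT : finGroupType) (Q P D : {group gT}) (M : {set gT} -> {set gT}) :
    p.-group P -> fsys Q P M -> fs_sat p Q P M -> D <| P ->
    (forall (R : {group gT}) g, Q \subset R -> R \subset P -> g \in M R ->
      (D :&: R) :^ g \subset D) ->
  fs_bad p Q P M Q -> fs_bad p Q P M 'Z(thompson D).
Proof.
have [n] := ubnP (#|P : Q| + #|P|).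
elim: n gT Q P D M => // n IHn gT Q P D M ltPn pP fsM sM nsDP scD badQ.
have sQP := fs_sub fsM; have nsQP := fs_normal fsM;
  have nQP := normal_norm nsQP.
have [sDP nDP] := andP nsDP; have pQ := pgroupS sQP pP.
have nZP : P \subset 'N('Z(thompson D)) := subset_trans nDP (norm_thompson D).
have gQ : fs_good p Q P M Q.
  apply: (fs_good_self sM) => // g Mg;
    by have [] := fs_dom fsM (subxx Q) sQP Mg.
have scN (Y : {group gT}) : Q \subset Y -> Y \subset P ->
    forall (R : {group gT}) g, Y \subset R -> R \subset 'N_P(Y) ->
      g \in norm_fs M Y R ->
    (D :&: 'N_P(Y) :&: R) :^ g \subset D :&: 'N_P(Y).
  move=> sQY sYP R g sYR sRN NMg; have /setIP[Mg _] := NMg.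
  have sRP : R \subset P := subset_trans sRN (subsetIl _ _).
  rewrite -setIA (setIidPr sRN) subsetI scD ?(subset_trans sQY) //=.
  have [_ sRg] := fs_im (norm_fsys fsM sQY sYP) sYR sRN NMg.
  by apply: subset_trans sRg; rewrite conjSg subsetIr.
have ltN (Y : {group gT}) : Q \proper Y -> Y \subset P ->
  #|'N_P(Y) : Y| + #|'N_P(Y)| < n.
  move=> ltQY sYP; have [sQY _] := andP ltQY; apply: leq_trans (ltPn : _ <= n).
  have sNP : 'N_P(Y) \subset P := subsetIl _ _.
  rewrite -addSn leq_add ?subset_leq_card //.
  apply: (@leq_ltn_trans #|P : Y|).
    by rewrite dvdn_leq // indexSg // subsetI sYP normG.
  by rewrite -(Lagrange_index sYP sQY) ltn_Pmulr // indexg_gt1 proper_subn.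
(* A good conjugate Y' of Y is still normal in P, so N_F(Y') lives over P and induction there
   concerns D itself. *)
have step1 (Y : {group gT}) : Q \proper Y -> Y \subset P -> P \subset 'N(Y) ->
  fs_bad p Q P M Y ->
    fs_bad p Q P M 'Z(thompson D).
  move=> ltQY sYP nYP /fs_badP[R [a [_ badR]]]; have sQY := proper_sub ltQY.
  have [Y' [gY' [sQY' sY'P] oY' leN badY']] :=
    bad_transport fsM pP sM sQY sYP (ex_intro _ R (ex_intro _ a badR)).
  have eN : 'N_P(Y') = P.
    by apply/eqP; rewrite eqEcard subsetIl; move: leN; rewrite (setIidPl nYP).
  have eNG : ('N_P(Y'))%G = P by apply: group_inj.
  have ltQY' : Q \proper Y' by rewrite properEcard sQY' oY' proper_card.
  have badN : fs_bad p Y' ('N_P(Y'))%G (norm_fs M Y') Y'.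
    apply: (fs_bad_norm fsM) => //; have [R' [a' bR']] := badY'.
    apply/fs_badP; exists R', a'; split=> //.
    by have [sYR _ _ _ _] := bR'; apply: subset_trans sYR.
  apply: (fs_bad_of_norm fsM sQY' sY'P).
  have := IHn _ Y' ('N_P(Y'))%G D (norm_fs M Y') (ltN _ ltQY' sY'P).
  apply => //.
  - exact: pgroupS (subsetIl _ _) pP.
  - exact: (norm_fsys fsM sQY' sY'P).
  - exact: (norm_sat fsM pP sM gY').
  - by rewrite eNG.
  move=> R0 g sYR0 sRN NMg; have := scN _ sQY' sY'P R0 g sYR0 sRN NMg.
  by rewrite eN (setIidPl sDP).
have [sDQ | not_sDQ] := boolP (D \subset Q).
  (* Every object contains D, so every automorphism normalizes D and with it ZJ(D): the given pair
     serves. *)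
  have /fs_badP[R [a [sQR [_ sRN Aa _ p'a]]]] := badQ.
  have sRP : R \subset P := subset_trans sRN (subsetIl _ _).
  have sDR := subset_trans sDQ sQR.
  apply/fs_badP; exists R, a; split=> //; split=> //.
  - by apply: subset_trans sDR;
    rewrite (subset_trans (center_sub _)) ?thompson_sub.
  - by rewrite subsetI sRP (subset_trans sRP).
  apply: (subsetP (norm_thompson D)).
  have Ma : a \in M R by move: Aa; rewrite (fs_autE fsM) // => /andP[].
  by rewrite inE; have := scD R a sQR sRP Ma; rewrite (setIidPl sDR).
have ntD : D :!=: 1 by apply: contraNneq not_sDQ => ->; apply: sub1G.
have pD := pgroupS sDP pP.
have [Q1 | ntQ] := eqsVneq Q 1.
  pose bad1 (Y : {group gT}) := [&& Y :!=: 1, Y \subset P & fs_bad p Q P M Y].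
  have [R bad1R] : exists R, bad1 R.
    have /fs_badP[R [a [sQR [_ sRN Aa Na /andP[p'a not_Ca]]]]] := badQ.
    have sRP : R \subset P := subset_trans sRN (subsetIl _ _).
    exists R; apply/and3P; split=> //.
      by apply: contraNneq not_Ca => ->; apply/centP=> x /set1P->;
        apply: commute1.
    apply/fs_badP; exists R, a; split=> //; split=> //; last by rewrite p'a.
      by rewrite subsetI sRP normG.
    by apply: subsetP Aa; apply: (fs_aut_norm fsM).
  case: (@arg_maxnP _ R bad1 (fun Y : {group gT} => #|'N_P(Y)|) bad1R) =>
    Y /and3P[ntY sYP badY] maxY.
  have sQ (X : {group gT}) : Q \subset X by rewrite Q1 sub1G.
  have [|Y' [gY' [_ sY'P] oY' leN badY']] :=
    bad_transport fsM pP sM (sQ Y) sYP _.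
    by have /fs_badP[R0 [a [_ bR]]] := badY; exists R0, a.
  pose T := ('N_P(Y'))%G; have sTP : T \subset P := subsetIl _ _.
  have ntY' : Y' :!=: 1 by rewrite -cardG_gt1 oY' cardG_gt1.
  have ltQY' : Q \proper Y' by rewrite Q1 proper1G.
  have badN : fs_bad p Y' T (norm_fs M Y') Y'.
    apply: (fs_bad_norm fsM) => //; have [R' [a' bR']] := badY'.
    by apply/fs_badP; exists R', a'.
  have badT : fs_bad p Q P M 'Z(thompson (D :&: T)).
    apply: (fs_bad_of_norm fsM (sQ Y') sY'P).
    apply: (IHn _ Y' T (D :&: T)%G (norm_fs M Y') (ltN _ ltQY' sY'P)) => //.
    - exact: pgroupS sTP pP.
    - exact: (norm_fsys fsM (sQ Y') sY'P).
    - exact: (norm_sat fsM pP sM gY').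
    - by rewrite /normal subsetIr normsI ?normG // (subset_trans sTP).
    exact: scN (sQ Y') sY'P.
  have [eTP | neTP] := eqVneq (T : {set gT}) P.
    by have <- : (D :&: T)%G = D by apply: group_inj;
      rewrite /= -/(gval T) eTP (setIidPl sDP).
  (* ZJ(D :&: T) is also a candidate for Y, and 'N_P(T) > T normalizes it, against the maximal
     choice. *)
  have ltTN : T \proper 'N_P(T).
    by apply: nilpotent_proper_norm (pgroup_nil pP) _; rewrite properEneq neTP.
  (* 'Z(P) centralizes Y', so it lies in T, and it meets the normal subgroup D nontrivially. *)
  have ntDT : (D :&: T)%G :!=: 1.
    apply: contraNneq (_ : D :&: 'Z(P) != 1) => [e|].
      have {}e : D :&: T = 1 := e.
      rewrite -subG1; apply: subset_trans (_ : D :&: T \subset _);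
        last by rewrite e.
      rewrite setIS // subsetI center_sub /=.
      by rewrite cents_norm // centsC (subset_trans sY'P) // centsC subsetIr.
    exact: (meet_center_nil (pgroup_nil pP) nsDP ntD).
  pose X := 'Z(thompson (D :&: T))%G.
  have bad1X : bad1 X.
    apply/and3P; split=> //.
      apply: (center_thompson_neq1 (p := p)) ntDT;
        exact: pgroupS (subsetIl _ _) pD.
    by rewrite (subset_trans (center_sub _))
      // (subset_trans (thompson_sub _)) // subIset // sDP.
  have := leq_ltn_trans (leq_trans (maxY X bad1X) leN) (proper_card ltTN).
  rewrite ltnNge => /negP[]; apply: subset_leq_card;
    rewrite subsetI subsetIl /=.
  apply: subset_trans (norm_thompson (D :&: T)).
  by rewrite normsI ?subsetIr // (subset_trans (subsetIl _ _)).
case: (boolP (fs_bad p Q P M 'Z(thompson D))) => // not_badZ; exfalso.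
have nobad (Y : {group gT}) : Q \proper Y -> Y \subset P -> P \subset 'N(Y) ->
  ~~ fs_bad p Q P M Y.
  by move=> ltQY sYP nYP; apply: contra not_badZ; apply: step1.
(* Otherwise induction in the quotient makes ZJ(DQ / Q) bad; its preimage is normal in P, larger
   than Q and bad, against [nobad]. *)
have trivQ (R : {group gT}) a r : Q \subset R -> R \subset P ->
  a \in fs_aut M R -> p^'.-elt a ->
    r \in R -> [~ r, a] \in Q.
  move=> sQR sRP Aa p'a Rr; apply/negPn/negP=> not_ra.
  have badb1 := fs_bad_quo fsM sQR sRP Aa p'a Rr not_ra.
  have ntDQ : (D / Q)%G :!=: 1 by rewrite -subG1 quotient_sub1
    // (subset_trans sDP).
  have pDQ : p.-group (D / Q) by rewrite quotient_pgroup.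
  have sZPQ : 'Z(thompson (D / Q)) \subset P / Q.
    by rewrite (subset_trans (center_sub _))
      // (subset_trans (thompson_sub _)) // quotientS.
  have [Y [eY sQY sYP]] := quo_lift fsM sZPQ.
  have nYP : P \subset 'N(Y).
    rewrite -(quotientGK (fs_nsQ fsM sQY sYP)).
    have nYQ : P / Q \subset 'N(Y / Q).
      rewrite -[Y / Q]/(gval (Y / Q)%G) -eY /=;
        apply: subset_trans (norm_thompson _).
      by rewrite quotient_norms.
    by apply: subset_trans (morphpre_norms _ nYQ); rewrite -sub_quotient_pre.
  have ltQY : Q \proper Y.
    rewrite properE sQY; apply: contraNN (center_thompson_neq1 pDQ ntDQ) => sYQ.
    by rewrite -[X in X == 1]/(gval ('Z(thompson (D / Q)))%G) eY /= -subG1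
      quotient_sub1 // (subset_trans sYP).
  case/negP: (nobad Y ltQY sYP nYP); apply: (fs_bad_lift fsM) => //.
  have := IHn _ 1%G (P / Q)%G (D / Q)%G (quo_fs Q M).
  rewrite -[Y / Q]/(gval (Y / Q)%G) -eY; apply=> //.
  - apply: leq_trans (ltPn : _ <= n);
    rewrite indexg1 card_quotient // -addnS leq_add2l.
    by rewrite -card_quotient // ltn_quotient.
  - by rewrite quotient_pgroup.
  - exact: quo_fsys.
  - exact: quo_sat.
  - exact: quotient_normal.
  move=> Rb gb _ /(quo_lift fsM)[R0 [-> sQR0 sR0P]] /(quo_fsP fsM _ sQR0
    sR0P)[z [g [Cz Mg ->]]].
  apply/subsetP=> _ /imsetP[xb /setIP[Dx Rx] ->].
  have : xb \in (D :&: R0) / Q by rewrite quotientIG //; apply/setIP.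
  case/morphimP=> x NQx /setIP[Dx' R0x] ex.
  rewrite conjgM (_ : xb ^ z = xb); last first.
    by apply/conjg_fixP/commgP/commute_sym/(centP Cz).
  have NQg := fs_normQ fsM sQR0 sR0P Mg.
  rewrite ex /= -morphJ //= mem_quotient // (subsetP (scD R0 g sQR0 sR0P Mg))
    //.
  by rewrite memJ_conjg inE Dx'.
(* An automorphism trivial both on Q and, by [trivQ], on R / Q would be trivial on R. *)
have badA : exists2 a, a \in fs_aut M Q & p^'.-elt a && (a \notin 'C(Q)).
  have /fs_badP[R [a [sQR [_ sRN Aa Na /andP[p'a not_Ca]]]]] := badQ.
  have sRP : R \subset P := subset_trans sRN (subsetIl _ _).
  exists a.
    rewrite (fs_autE fsM) // Na andbT.
    have : a \in M R by move: Aa; rewrite (fs_autE fsM) // => /andP[].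
    by apply: (subsetP (fs_res fsM (subxx Q) sQR sRP)).
  rewrite p'a; apply: contra not_Ca => Ca.
  apply: (pelt_cent_chain (pgroupS sRP pP) (fs_nsQ fsM sQR sRP)) => //.
    by apply: subsetP Aa; apply: (fs_aut_norm fsM).
  by move=> r Rr; apply: trivQ Aa p'a Rr.
(* Otherwise a extends to Q 'C_P(Q), which is normal in P and larger than Q, and makes it bad. *)
have cQQ : 'C_P(Q) \subset Q.
  apply/negPn/negP=> not_cQQ; have [a Aa /andP[p'a not_Ca]] := badA.
  pose Y := (Q <*> 'C_P(Q))%G.
  have ltQY : Q \proper Y by rewrite properE joing_subl join_subG subxx.
  have sYP : Y \subset P by rewrite join_subG sQP subsetIl.
  have nYP : P \subset 'N(Y) by rewrite normsY // normsI ?normG ?norms_cent.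
  have sQY := proper_sub ltQY; have sCY : 'C_P(Q) \subset Y := joing_subr _ _.
  have Na : a \in 'N(Q) by apply: subsetP Aa; apply: (fs_aut_norm fsM).
  have sYa : Y :^ a \subset Y * 'C(Q).
    rewrite /= norm_joinEr ?subIset ?cent_sub ?orbT // conjsMg (normP Na).
    rewrite -mulgA mulgS // (subset_trans _ (mulG_subr _ _)) //.
    have NCa : a \in 'N('C(Q)) := subsetP (norms_cent (subxx 'N(Q))) a Na.
    apply: subset_trans (_ : 'C(Q) :^ a \subset _); last by rewrite (normP NCa).
    by rewrite conjSg subsetIr.
  have [b [d [Ab p'b Cd eb]]] := ext_pelt fsM gQ sQY sYP sCY Aa p'a sYa.
  case/negP: (nobad Y ltQY sYP nYP); apply/fs_badP; exists Y, b; split=> //;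
    split=> //.
  - by rewrite subsetI sYP normG.
  - by apply: subsetP Ab; apply: (fs_aut_norm fsM).
  rewrite p'b; apply: contra not_Ca => Cb.
  have : b \in 'C(Q) by apply: subsetP Cb; rewrite centS.
  by rewrite eb groupMr.
case/negP: not_badZ; apply: (constrained_bad p_pr p_odd fsM pP gQ cQQ trivQ
  badA nobad nsDP).
apply/subsetP=> a Aa; have Na : a \in 'N(Q) by apply: subsetP Aa;
  apply: (fs_aut_norm fsM).
have Ma : a \in M Q by move: Aa; rewrite (fs_autE fsM) // => /andP[].
by rewrite inE subsetI (scD Q) //= -{2}(normP Na) conjSg subsetIr.
Qed.

(** * Realizing morphisms by conjugation in the symmetric group *)

Section Regular.
Variable gT : finGroupType.
Implicit Types (R S T P : {group gT}) (x y : gT) (s t : {perm gT}).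

(** The right regular representation. *)
Definition rho x : {perm gT} := perm (@mulIg gT x).

Lemma rhoE x y : rho x y = y * x. Proof. by rewrite permE. Qed.

Lemma rhoM : {in [set: gT] &, {morph rho : x y / x * y}}.
Proof. by move=> x y _ _; apply/permP=> z; rewrite permM !rhoE mulgA. Qed.

Canonical rho_morphism := Morphism rhoM.

Lemma injm_rho : 'injm rho.
Proof.
apply/injmP=> x y _ _ e; have := congr1 (fun s : {perm gT} => s 1) e.
by rewrite !rhoE !mul1g.
Qed.

Lemma rho_inj : injective rho.
Proof. by move=> x y; apply: (injmP injm_rho); rewrite ?inE. Qed.

Lemma rhoJ x y : rho (x ^ y) = rho x ^ rho y.
Proof. by rewrite morphJ ?inE. Qed.

Lemma mem_rho R x : (rho x \in rho @* R) = (x \in R).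
Proof.
apply/idP/idP=> [/morphimP[y _ Ry /rho_inj->] //|Rx].
by rewrite mem_morphim ?inE.
Qed.

Lemma rho_conjP x y s : reflect (forall t :
  gT, s (t * x) = s t * y) (rho x ^ s == rho y).
Proof.
apply: (iffP eqP) => [e t | e].
  have /permP/(_ t) : rho x * s = s * rho y by rewrite -e -conjgC.
  by rewrite !permM !rhoE.
apply: (mulgI s); rewrite -conjgC; apply/permP=> t.
by rewrite !permM !rhoE e.
Qed.

(* Both R and its image act freely on gT by right translation, with equally   *)
(* many orbits; s maps each R-orbit to an orbit of the image.                 *)
Lemma rho_realize R (f : gT -> gT) : {in R &, {morph f : x y / x * y}} ->
  {in R &, injective f} -> exists s, {in R, forall x, rho x ^ s = rho (f x)}.
Proof.
move=> fM injf; pose S := (Morphism fM @* R)%G.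
have dS : S = f @: R :> {set gT} by rewrite /= morphimEdom.
have oS : #|S| = #|R| by rewrite dS card_in_imset.
pose X := enum (lcosets R [set: gT]); pose Y := enum (lcosets S [set: gT]).
have sXY : size X = size Y.
  rewrite -!cardE !card_lcosets; apply/eqP; rewrite -(eqn_pmul2l (cardG_gt0 R)).
  by rewrite Lagrange ?subsetT // -oS Lagrange ?subsetT.
have XR y : y *: R \in X by rewrite mem_enum; apply/lcosetsP; exists y;
  rewrite ?inE.
pose b (y : gT) := repr (nth set0 Y (index (y *: R) X)).
have b_inj y z : (b y)^-1 * b z \in S -> y *: R = z *: R.
  have szy w : index (w *: R) X < size Y by rewrite -sXY index_mem.
  have bE w : b w *: S = nth set0 Y (index (w *: R) X).
    have : nth set0 Y (index (w *: R) X) \in lcosets S setT by rewrite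
      -mem_enum mem_nth.
    by rewrite /b => /lcosetsP[v _ ->]; apply/lcoset_eqP;
      apply: mem_repr (lcoset_refl S v).
  rewrite -mem_lcoset => /lcoset_eqP; rewrite !bE => /eqP.
  rewrite nth_uniq ?enum_uniq // => /eqP e.
  by rewrite -(nth_index set0 (XR y)) -e nth_index.
have bR y x : x \in R -> b (y * x) = b y.
  by move=> Rx; rewrite /b lcosetM lcoset_id.
pose r y := (repr (y *: R))^-1 * y.
have rR y : r y \in R.
  have := mem_repr _ (lcoset_refl R y); rewrite mem_lcoset => Ry.
  by rewrite -groupV invMg invgK.
have rM y x : x \in R -> r (y * x) = r y * x.
  by move=> Rx; rewrite /r lcosetM lcoset_id // mulgA.
pose h y := b y * f (r y).
have h_inj : injective h.
  move=> y z e; have fS w : w \in R -> f w \in S by move=> Rw;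
    rewrite dS imset_f.
  have eyz : y *: R = z *: R.
    apply: b_inj; rewrite -(mulgK (f (r z)) (b z)) -[b z * _]/(h z) -e /h.
    by rewrite -mulgA mulKg groupM ?groupV ?fS.
  have eb : b y = b z by rewrite /b eyz.
  move: e; rewrite /h eb => /mulgI/injf; rewrite !rR => /(_ isT isT).
  by rewrite /r eyz => /mulgI.
exists (perm h_inj) => x Rx; apply/eqP/rho_conjP => t.
by rewrite !permE /h bR // rM // fM // mulgA.
Qed.
End Regular.
Arguments rho {gT} x.

Section Realize.
Variables (gT : finGroupType) (P : {group gT}) (F : fusion_data gT).
Hypothesis F_fusion : fusion_system P F.
Implicit Types (R S T D : {group gT}) (f g h : {ffun gT ->
  gT}) (s t : {perm gT}).

Lemma HomP R S f : f \in Hom F R S ->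
  [/\ R \subset P, S \subset P, {in R &, {morph f : x y / x * y}},
      {in R &, injective f} & {in R, forall x, f x \in S}].
Proof.
move=> Ff; have [sRP sSP] := fusion_obj F_fusion Ff.
have := subsetP (fusion_inj F_fusion R S) f Ff;
  rewrite inE => /and4P[/morphicP fM /dinjectiveP injf sfS _].
by split=> // x Rx; rewrite (subsetP sfS) ?imset_f.
Qed.

Lemma Hom_out R S f x : f \in Hom F R S -> x \notin R -> f x = 1.
Proof.
move=> Ff /negPf nRx; have := subsetP (fusion_inj F_fusion R S) f Ff.
by rewrite inE => /and4P[_ _ _ /eqP->]; rewrite ffunE nRx.
Qed.

Lemma Hom_inner R S (g : gT) : R \subset P -> S \subset P -> g \in P ->
  R :^ g \subset S ->
  restr R (conjg^~ g) \in Hom F R S.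
Proof.
move=> sRP sSP Pg sRgS; rewrite inE; apply: (subsetP (fusion_inner F_fusion)).
rewrite inE sRP sSP; apply/exists_inP; exists g => //.
by rewrite sRgS /=.
Qed.

Lemma Hom_incl R S : R \subset S -> S \subset P ->
  exists2 f, f \in Hom F R S & {in R, f =1 id}.
Proof.
move=> sRS sSP; exists (restr R (conjg^~ 1)).
  by apply: Hom_inner; rewrite ?group1 ?conjsg1 // (subset_trans sRS).
by move=> x Rx; rewrite ffunE Rx conjg1.
Qed.

Lemma Hom_comp R S T f h : f \in Hom F R S -> h \in Hom F S T ->
  exists2 k, k \in Hom F R T & {in R, forall x, k x = h (f x)}.
Proof.
move=> Ff Fh; exists (finfun (h \o f));
  first exact: (fusion_comp F_fusion Ff Fh).
by move=> x _; rewrite ffunE.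
Qed.

(** R is determined by X, since [rho] is injective; the set is empty if X is not the image of a
    subgroup. *)
Definition real (X : {set {perm gT}}) : {set {perm gT}} :=
  [set s | [exists R : {group gT}, (rho @* R == X) &&
     [exists f in Hom F R P, [forall x in R, rho x ^ s == rho (f x)]]]].

Lemma realP R s : reflect (exists2 f, f \in Hom F R P &
  {in R, forall x, rho x ^ s = rho (f x)})
   (s \in real (rho @* R)).
Proof.
rewrite inE; apply: (iffP existsP) => [[R' /andP[/eqP e]] | [f Ff fs]].
  have -> : R' = R by apply/group_inj/(injm_morphim_inj (injm_rho gT) _ _ e);
    apply: subsetT.
  case/exists_inP=> f Ff /forall_inP fs; exists f => // x Rx; exact/eqP/fs.
exists R; rewrite eqxx; apply/exists_inP; exists f => //;
  apply/forall_inP=> x Rx.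
by rewrite fs.
Qed.

Lemma realE R s : s \in real (rho @* R) ->
  exists f (T : {group gT}), [/\ f \in Hom F R P, {in R, forall x, rho x ^ s =
    rho (f x)},
    f \in Iso F R T & (rho @* R) :^ s = rho @* T].
Proof.
case/realP=> f Ff fs; have [T sTP If] := fusion_factor F_fusion Ff.
exists f, T; split=> //; have := If.
rewrite inE => /andP[Ff' /exists_inP[g Fg /andP[/forall_inP gf /forall_inP
  fg]]].
have [_ _ _ _ fT] := HomP Ff'; have [_ _ _ _ gR] := HomP Fg.
apply/setP=> y; apply/imsetP/morphimP=> [[_ /morphimP[x _ Rx ->] ->] | [x _ Tx
  ->]].
  by exists (f x); rewrite ?inE ?fT // fs.
by exists (rho (g x)); rewrite ?mem_rho ?gR // fs ?gR // (eqP (fg x Tx)).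
Qed.

Lemma IsoP R T f : f \in Iso F R T -> [/\ f \in Hom F R T, f \in Hom F R P &
  exists2 g, g \in Hom F T P & {in R, forall x, g (f x) = x} /\ {in T, forall
    y, f (g y) = y /\ g y \in R}].
Proof.
rewrite inE => /andP[Ff' /exists_inP[g Fg /andP[/forall_inP gf /forall_inP
  fg]]].
have [sRP sTP _ _ fT] := HomP Ff'; have [_ _ _ _ gR] := HomP Fg.
split=> //.
  have [i Fi iE] := Hom_incl sTP (subxx P); have := fusion_comp F_fusion Ff' Fi.
  suff -> : finfun (i \o f) = f by [].
  apply/ffunP=> x; rewrite ffunE /=; have [Rx | nRx] := boolP (x \in R);
    first by rewrite iE ?fT.
  by rewrite (Hom_out Ff' nRx) iE.
have [i Fi iE] := Hom_incl sRP (subxx P); have [k Fk kE] := Hom_comp Fg Fi.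
exists k => //; split=> [x Rx | y Ty].
  by rewrite kE ?fT // iE ?gR ?fT // (eqP (gf x Rx)).
by rewrite kE // iE ?gR // (eqP (fg y Ty)).
Qed.

Let P' := (rho @* P)%G.

Lemma rho_lift (X : {group {perm gT}}) : X \subset P' ->
  exists R : {group gT}, X = (rho @* R)%G /\ R \subset P.
Proof.
move=> sXP; exists (rho @*^-1 X)%G; split.
  apply: group_inj; rewrite /= morphpreK //.
  by rewrite (subset_trans sXP) // morphimS ?subsetT.
by rewrite -(injmSK (injm_rho gT))
  ?subsetT // morphpreK // (subset_trans sXP) // morphimS ?subsetT.
Qed.

Lemma real_fsys : fsys 1%G P' real.
Proof.
split=> [|X s|X|X|X s t|X s|X Y]; first exact: sub1G.
- move=> _ /rho_lift[R [-> sRP]] /realE[f [T [_ _ If ->]]]; rewrite conjs1g;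
  split=> //.
  have [Ff _ _] := IsoP If; have [_ sTP _ _ _] := HomP Ff; exact: morphimS.
- move=> _ /rho_lift[R [-> sRP]]; apply/subsetP=> _ /morphimP[g _ Pg ->].
  apply/realP; exists (restr R (conjg^~ g)).
    by apply: Hom_inner => //; rewrite -(conjGid Pg) conjSg.
  by move=> x Rx; rewrite ffunE Rx rhoJ.
- move=> _ /rho_lift[R [-> sRP]]; apply/subsetP=> s Cs.
  have [i Fi iE] := Hom_incl sRP (subxx P); apply/realP; exists i => // x Rx.
  by rewrite iE //; apply/conjg_fixP/commgP/commute_sym/(centP Cs);
    rewrite mem_rho.
- move=> _ /rho_lift[R [-> sRP]] /realE[f [T [_ fs If ->]]] /realP[h Fh ht].
  have [Ff _ _] := IsoP If; have [_ _ _ _ fT] := HomP Ff.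
  have [k Fk kE] := Hom_comp Ff Fh; apply/realP; exists k => // x Rx.
  by rewrite conjgM fs // ht ?fT // kE.
- move=> _ /rho_lift[R [-> sRP]] /realE[f [T [_ fs If ->]]].
  have [_ _ [g Fg [gf fg]]] := IsoP If; apply/realP; exists g => // y Ty.
  have [e Rgy] := fg y Ty; apply: (conjg_inj s).
  by rewrite conjgKV fs // e.
move=> _ sYX /rho_lift[R [eX sRP]]; rewrite {X}eX in sYX *.
have [S [eY sSP]] := rho_lift (subset_trans sYX (morphimS _ sRP));
  rewrite {Y}eY in sYX *.
have sSR : S \subset R by rewrite -(injmSK (injm_rho gT)) ?subsetT.
apply/subsetP=> s /realP[f Ff fs]; apply/realP.
have [i Fi iE] := Hom_incl sSR sRP; have [k Fk kE] := Hom_comp Fi Ff.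
by exists k => // x Sx; rewrite kE // iE // fs // (subsetP sSR).
Qed.

Lemma real_Hom R S f : f \in Hom F R S -> S \subset P ->
  exists2 s, s \in real (rho @* R) & {in R, forall x, rho x ^ s = rho (f x)}.
Proof.
move=> Ff sSP; have [_ _ fM injf _] := HomP Ff;
  have [s sE] := rho_realize fM injf.
have [i Fi iE] := Hom_incl sSP (subxx P); have [k Fk kE] := Hom_comp Ff Fi.
exists s => //; apply/realP; exists k => // x Rx.
have [_ _ _ _ fS] := HomP Ff.
by rewrite sE // kE // iE ?fS.
Qed.

Lemma real_autP R s : R \subset P -> s \in fs_aut real (rho @* R) ->
  exists2 a, a \in AutF F R & {in R, forall x, rho x ^ s = rho (a x)}.
Proof.
move=> sRP; rewrite (fs_autE real_fsys (R := (rho @* R)%G)) ?sub1G ?morphimS //.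
case/andP=> /realE[f [T [_ fs If eT]]] Ns.
have {eT} eTR : T = R.
  rewrite (normP Ns) in eT; apply/group_inj/esym.
  exact: (injm_morphim_inj (injm_rho gT) (subsetT _) (subsetT _) eT).
rewrite {T}eTR in If; have [Ff _ _] := IsoP If;
  have [_ _ fM injf fR] := HomP Ff.
have stab : f @: R \subset R by apply/subsetP=> _ /imsetP[x Rx ->]; apply: fR.
have aE x : x \in R -> perm_in injf stab x = f x by apply: perm_inE.
exists (perm_in injf stab) => [|x Rx]; last by rewrite aE // fs.
rewrite inE; apply/andP; split.
  rewrite inE perm_in_on; apply/morphicP=> x y Rx Ry.
  by rewrite !aE ?groupM // fM.
rewrite (_ : restr R _ = f) //; apply/ffunP=> x; rewrite ffunE.
by case: (boolP (x \in R)) => [/aE // | /(Hom_out Ff)].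
Qed.

Lemma real_aut_exists R a : R \subset P -> a \in AutF F R ->
  exists2 s, s \in fs_aut real (rho @* R) & {in R, forall x, rho x ^ s = rho (a
    x)}.
Proof.
move=> sRP; rewrite inE => /andP[Aa Fa]; have [s Ms sE] := real_Hom Fa sRP.
have {}sE x : x \in R -> rho x ^ s = rho (a x) by move=> Rx;
  rewrite sE // ffunE Rx.
exists s => //; rewrite (fs_autE real_fsys (R :=
  (rho @* R)%G)) ?sub1G ?morphimS // Ms.
rewrite inE; apply/subsetP=> _ /imsetP[_ /morphimP[x _ Rx ->] ->].
by rewrite sE // mem_rho Aut_closed.
Qed.
End Realize.

(** * Saturation of the realized system *)

Section RealSat.
Variables (p : nat) (gT : finGroupType) (P : {group gT}) (F : fusion_data gT).
Hypothesis F_fusion : fusion_system P F.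
Implicit Types (R S T D : {group gT}) (f g h : {ffun gT ->
  gT}) (s t : {perm gT}).
Local Notation real := (real P F).
Local Notation P' := (rho @* P)%G.
Let fsR := real_fsys F_fusion.

Section Automizer.
Variable R : {group gT}.
Hypothesis sRP : R \subset P.
Let A := fs_aut real (rho @* R).
Let sRP' : rho @* R \subset P' := morphimS _ sRP.

(* The automorphism of R in F induced by s; 1 is a junk value, which is never *)
(* taken as a default on A.                                                   *)
Definition psi s : {perm gT} :=
  odflt 1 [pick a in AutF F R | [forall x in R, rho x ^ s == rho (a x)]].

Lemma psiP s : s \in A -> psi s \in AutF F R /\
  {in R, forall x, rho x ^ s = rho (psi s x)}.
Proof.
move=> As; rewrite /psi; case: pickP => [a /andP[Fa /forall_inP aE] | none].
  by split=> // x Rx; apply/eqP/aE.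
have [a Fa aE] := real_autP F_fusion sRP As; have /idP[] := none a.
by rewrite Fa; apply/forall_inP=> x Rx; rewrite aE.
Qed.

Lemma psi_uniq s a : s \in A -> a \in Aut R ->
  {in R, forall x, rho x ^ s = rho (a x)} ->
  psi s = a.
Proof.
move=> As Aa aE; have [] := psiP As; rewrite inE => /andP[Ap _] pE.
by apply: eq_Aut Ap Aa _ => x Rx; apply: rho_inj; rewrite -aE // -pE.
Qed.

Lemma psi_Aut s : s \in A -> psi s \in Aut R.
Proof. by case/psiP; rewrite inE => /andP[]. Qed.

Lemma psiM : {in A &, {morph psi : s t / s * t}}.
Proof.
move=> s t As At; apply: psi_uniq; rewrite ?groupM ?psi_Aut // => x Rx.
have [_ sE] := psiP As; have [_ tE] := psiP At.
by rewrite conjgM sE // tE ?permM // Aut_closed ?psi_Aut.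
Qed.
Canonical psi_morphism := Morphism psiM.

Lemma im_psi : psi @* A = AutF F R.
Proof.
apply/setP=> a; apply/morphimP/idP=> [[s _ As ->] | Fa];
  first by case: (psiP As).
have [s As sE] := real_aut_exists F_fusion sRP Fa; exists s => //.
by apply/esym/psi_uniq => //; move: Fa; rewrite inE => /andP[].
Qed.

Lemma ker_psi : 'ker psi \subset 'C(rho @* R).
Proof.
apply/subsetP=> s /morphpreP[As /set1P s1];
  apply/centP=> _ /morphimP[x _ Rx ->].
apply/commute_sym/commgP/conjg_fixP; have [_ sE] := psiP As.
by rewrite sE // s1 perm1.
Qed.

Lemma psi_inn : conj_aut R @* 'N_P(R) \subset psi @* 'N_P'(rho @* R).
Proof.
apply/subsetP=> _ /morphimP[g Ng /setIP[Pg _] ->].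
have NPg : rho g \in 'N_P'(rho @* R).
  rewrite inE mem_rho Pg (subsetP (morphim_norm (rho_morphism gT) R)) //.
  by rewrite mem_morphim ?inE //; move: Ng; rewrite inE.
have Ag : rho g \in A by apply: subsetP NPg;
  apply: (fs_aut_inn fsR) (sub1G _) sRP'.
apply/morphimP; exists (rho g) => //; apply/esym/psi_uniq => //.
  by apply: (subsetP (Aut_conj_aut R 'N(R))); rewrite mem_morphim.
by move=> x Rx; rewrite norm_conj_autE // rhoJ.
Qed.

(** The kernel of [psi] lies in 'C(rho @* R), so the index of 'N_P(R) 'C(R), read through [rho], can
    be computed in [AutF F R]. *)
Lemma real_automized : fully_automized p P F R ->
  exists2 U : {group {perm gT}}, p.-Sylow(A) U & U \subset 'N_P'(rho @* R) *
    'C(rho @* R).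
Proof.
case/and3P=> _ _; rewrite -im_psi => p'i.
rewrite mul_cent_group ?subsetIr //;
  pose X := ('N_P'(rho @* R) <*> 'C(rho @* R))%G.
have sXA : X \subset A.
  by rewrite join_subG (fs_aut_inn fsR) ?(fs_aut_cent fsR) ?sub1G.
have [U sylU] := Sylow_exists p X; have [sUX pU p'XU] := and3P sylU;
  exists U => //.
rewrite /pHall (subset_trans sUX)
  // pU /= -(Lagrange_index sXA sUX) pnatM p'XU andbT.
rewrite -(index_morphim_ker psi_morphism sXA (subxx A)).
have /eqP -> : #|'ker_A psi : X| == 1%N.
  rewrite indexg_eq1 (subset_trans (subsetIr _ _)) // (subset_trans ker_psi) //.
  exact: joing_subr.
rewrite muln1; apply: pnat_dvd p'i;
  apply: (@indexgS _ (psi @* A)%G (conj_aut R @* 'N_P(R))%G (psi @* X)%G).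
apply: subset_trans psi_inn _; apply: morphimS; exact: joing_subl.
Qed.
End Automizer.

(** Elements of 'C(rho @* R) do not affect the action on R, so the condition on Y :^ s says that T,
    the preimage of Y, lies in the extender of f. The extension of f is then realized by some r, and
    c = s^-1 * r. *)
Lemma real_receptive R : R \subset P -> receptive P F R ->
  forall (X Y : {group {perm gT}}) s, X \subset Y -> Y \subset 'N_P'(X) ->
     s \in real X -> X :^ s = rho @* R ->
     Y :^ s \subset 'N_P'(rho @* R) * 'C(rho @* R) ->
   exists2 c, c \in 'C(rho @* R) & s * c \in real Y.
Proof.
move=> sRP rec X Y s sXY sYN Ms eX sYs.
have sYP' : Y \subset P' := subset_trans sYN (subsetIl _ _).
have [S [eS sSP]] := rho_lift (subset_trans sXY sYP').
have [T [eT sTP]] := rho_lift sYP';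
  rewrite {X}eS {Y}eT in sXY sYN sYP' Ms eX sYs *.
have [f [S1 [Ff fs If eS1]]] := realE F_fusion Ms.
have eSR : S1 = R.
  apply/group_inj/(injm_morphim_inj (injm_rho gT)); rewrite ?subsetT //.
  by rewrite -eS1 -eX.
rewrite {S1 eS1}eSR in If; have [Ff' _ _] := IsoP F_fusion If.
have [_ _ _ _ fR] := HomP F_fusion Ff'.
have [h Fh hf] := rec S f If.
have sTE : T \subset extender P S R f.
  apply/subsetP=> t Tt; have rTt : rho t \in rho @* T by rewrite mem_rho.
  have := subsetP sYN _ rTt; rewrite -(injm_subnorm (injm_rho gT))
    ?subsetT // mem_rho => NSt.
  rewrite inE NSt; apply/exists_inP.
  have : rho t ^ s \in (rho @* T) :^ s by rewrite memJ_conjg.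
  move/(subsetP sYs)/mulsgP=> [_ c /setIP[/morphimP[n _ Pn ->] Nn] Cc e].
  have NRn : n \in 'N_P(R).
    by rewrite -mem_rho injm_subnorm ?injm_rho ?subsetT // inE mem_rho Pn.
  exists n => //; apply/forall_inP=> x Sx; apply/eqP/rho_inj.
  have Nt : t \in 'N(S) by case/setIP: NSt.
  rewrite rhoJ -[rho (f _)]fs ?memJ_norm // -fs // rhoJ conjJg e conjgM.
  have Rz : (rho x ^ s) ^ rho n \in rho @* R.
    by rewrite memJ_norm // fs // mem_rho fR.
  by apply/conjg_fixP/commgP/commute_sym/(centP Cc).
have sEP : extender_group P S R f \subset P.
  by apply/subsetP=> y; rewrite inE => /andP[/setIP[]].
have [i Fi iE] := Hom_incl F_fusion sTE sEP;
  have [k Fk kE] := Hom_comp F_fusion Fi Fh.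
have [r Mr rE] := real_Hom F_fusion Fk (subxx P).
have sST : S \subset T by rewrite -(injmSK (injm_rho gT)) ?subsetT.
exists (s^-1 * r); last by rewrite mulKVg.
rewrite -eX; apply/centP=> _ /imsetP[_ /morphimP[x _ Sx ->] ->].
have Tx := subsetP sST x Sx.
apply/commute_sym/commgP/conjg_fixP; rewrite -conjgM mulKVg rE //.
by rewrite kE // iE // hf // fs.
Qed.

Lemma real_sat : saturated p P F -> fs_sat p 1%G P' real.
Proof.
move=> F_sat X _ /(@rho_lift _ P)[S [-> sSP]].
have [R [[f If] autR recR]] := F_sat S sSP; have [Ff Ff' _] := IsoP F_fusion If.
have [s Ms sE] := real_Hom F_fusion Ff' (subxx P); exists s => //.
have [_ sRP _ _ fR] := HomP F_fusion Ff.
have -> : (rho @* S) :^ s = rho @* R.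
  have [_ _ [g Fg [gf fg]]] := IsoP F_fusion If.
  apply/setP=> y; apply/imsetP/morphimP=> [[_ /morphimP[x _ Rx ->] ->] | [x _
    Tx ->]].
    by exists (f x); rewrite ?inE ?fR // sE.
  have [e Sg] := fg x Tx.
  by exists (rho (g x)); rewrite ?mem_rho // sE // e.
split; first exact: real_automized.
by move=> X0 Y0 t _ sXY sYN Mt eX sYt; apply: (@real_receptive R) eX sYt.
Qed.
End RealSat.

Section RhoThompson.
Variable gT : finGroupType.
Implicit Types (A B D : {group gT}).

Lemma max_order_abelian_rho D A :
  max_order_abelian (rho @* D) (rho @* A) = max_order_abelian D A.
Proof.
rewrite /max_order_abelian injmSK ?injm_rho ?subsetT // injm_abelian ?injm_rho
  ?subsetT //.
congr [&& _, _ & _]; apply/forallP/forallP=> maxA B;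
  apply/implyP=> /andP[sBD cBB].
  have := implyP (maxA (rho @* B)%G).
  rewrite /= !card_injm ?injm_rho ?subsetT // injm_abelian ?injm_rho
    ?subsetT //.
  by rewrite morphimS //; apply.
have [E [eB sED]] := rho_lift sBD; rewrite {B}eB in sBD cBB *.
rewrite /= !card_injm ?injm_rho ?subsetT //.
rewrite /= injm_abelian ?injm_rho ?subsetT // in cBB.
by apply: (implyP (maxA E)); rewrite sED.
Qed.

Lemma thompson_rho D : thompson (rho @* D) = rho @* thompson D :> {set _}.
Proof.
apply/eqP; rewrite eqEsubset gen_subG; apply/andP; split.
  apply/bigcupsP=> X mX; have [sXD _ _] := and3P mX.
  have [A [eX _]] := rho_lift sXD; rewrite eX in mX *.
  by apply/morphimS/max_order_abelian_sub; rewrite -max_order_abelian_rho.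
rewrite sub_morphim_pre ?subsetT // gen_subG; apply/bigcupsP=> A mA.
rewrite -sub_morphim_pre ?subsetT //;
  apply: (@max_order_abelian_sub _ _ (rho @* A)%G).
by rewrite max_order_abelian_rho.
Qed.

Lemma center_thompson_rho D : 'Z(thompson (rho @* D)) = rho @* 'Z(thompson D).
Proof. by rewrite thompson_rho injm_center ?injm_rho ?subsetT. Qed.
End RhoThompson.

(** * The equivalence for fusion systems *)

Lemma inner_sub_normalizer (gT : finGroupType) (P Z : {group gT}) (F :
  fusion_data gT) :
    fusion_system P F -> Z <| P ->
      inner_fusion P \subset normalizer_fusion P F Z.
Proof.
move=> F_fusion /andP[sZP nZP]; apply/subsetP=> [[[R T] f]].
rewrite !inE => /and3P[sRP sTP /exists_inP[g Pg /andP[sRgT /eqP ef]]].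
rewrite !subsetI sRP sTP (subset_trans sRP nZP) (subset_trans sTP nZP) /=.
have Zg := normP (subsetP nZP g Pg).
apply/andP; split; first by have := Hom_inner F_fusion sRP sTP Pg sRgT;
  rewrite -ef inE.
apply/exists_inP; exists (restr (Z <*> R)%G (conjg^~ g)).
  apply: (Hom_inner F_fusion) => //; rewrite ?join_subG ?sZP ?sRP ?sTP //=.
  by rewrite -genJ genS // conjUg Zg setUS.
have sZ : Z \subset Z <*> R := joing_subl _ _;
  have sR : R \subset Z <*> R := joing_subr _ _.
apply/andP; split.
  rewrite -[X in _ == X]Zg; apply/eqP/eq_in_imset=> z Zz.
  by rewrite ffunE (subsetP sZ).
by apply/forall_inP=> x Rx; rewrite ffunE (subsetP sR) // ef ffunE Rx.
Qed.

Theorem theoremA (gT : finGroupType) (p : nat) (P D : {group gT})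
    (F : fusion_data gT) (p_prime : prime p) (p_odd : odd p)
    (P_pgroup : p.-group P) (F_fusion : fusion_system P F)
    (F_sat : saturated p P F) (D_closed : strongly_closed P F D) :
  F = inner_fusion P <->
  normalizer_fusion P F ('Z(thompson D))%G = inner_fusion P.
Proof.
have [sDP scD] := D_closed; set Z := ('Z(thompson D))%G.
have nsDP : D <| P.
  rewrite /normal sDP; apply/subsetP=> g Pg; rewrite inE;
    apply/subsetP=> _ /imsetP[x Dx ->].
  have sxP : <[x]> \subset P by rewrite cycle_subG (subsetP sDP).
  have := scD x _ Dx (Hom_inner F_fusion (R := <[x]>%G) sxP (subxx P) Pg _).
  by rewrite ffunE cycle_id; apply; rewrite -(conjGid Pg) conjSg.
have nsZP : Z <| P.
  rewrite /normal (subset_trans (center_sub _))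
    ?(subset_trans (thompson_sub _)) //.
  by apply: subset_trans (norm_thompson D); apply: normal_norm.
have sub_inner := inner_sub_normalizer F_fusion nsZP.
split=> [eF | eN].
  apply/eqP; rewrite eqEsubset sub_inner andbT -eF; apply/subsetP=> [[[R T] f]].
  by rewrite !inE => /and4P[].
have fsR := real_fsys F_fusion; have satR := real_sat F_fusion F_sat.
have pP' : p.-group (rho @* P) by rewrite morphim_pgroup.
have not_bad : ~~ fs_bad p 1%G (rho @* P)%G (real P F) 1.
  apply/negP=> bad1; pose D' := (rho @* D)%G.
  have nsD'P : D' <| (rho @* P)%G by apply: morphim_normal.
  have scD' (X : {group {perm gT}}) s : 1%G \subset X ->
    X \subset (rho @* P)%G -> s \in real P F X ->
      (D' :&: X) :^ s \subset D'.
    move=> _ /rho_lift[R [-> sRP]] /realP[f Ff fs].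
    apply/subsetP=> _ /imsetP[_ /setIP[/morphimP[x _ Dx ->]] + ->].
    rewrite mem_rho => Rx; rewrite fs // mem_rho.
    have sxR : <[x]> \subset R by rewrite cycle_subG.
    have [i Fi iE] := Hom_incl F_fusion (R := <[x]>%G) sxR sRP.
    have [k Fk kE] := Hom_comp F_fusion Fi Ff.
    by have := scD x k Dx Fk; rewrite kE ?cycle_id // iE ?cycle_id.
  have := bad_center_thompson p_prime p_odd pP' fsR satR nsD'P scD' bad1.
  case/fs_badP=> X [s [_ [sZX sXN As Ns /andP[p's not_Cs]]]].
  have [R [eX sRP]] := rho_lift (subset_trans sXN (subsetIl _ _)).
  rewrite {X sXN}eX in sZX As not_Cs; rewrite center_thompson_rho in sZX Ns.
  have sZR : Z \subset R by rewrite -(injmSK (injm_rho gT)) ?subsetT.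
  (* The automorphism a induced by s stabilizes Z, so it belongs to N_F(Z) and is conjugation by
     some g in P. Modulo the centralizer, s is then both a p-element and a p'-element. *)
  have [a Fa sE] := real_autP F_fusion sRP As.
  have := Fa; rewrite inE => /andP[Aa Fa'].
  have /subsetP/(_ (R, R, restr R a)) :
    normalizer_fusion P F Z \subset inner_fusion P by rewrite eN.
  have -> : (R, R, restr R a) \in normalizer_fusion P F Z.
    rewrite inE subsetI sRP (subset_trans sRP (normal_norm nsZP)) Fa' /=.
    have eZR : (Z <*> R)%G = R by apply: group_inj; apply/joing_idPr.
    apply/exists_inP; exists (restr R a); first by rewrite eZR.
    apply/andP; split; last by apply/forall_inP.
    rewrite eqEcard; apply/andP; split.
      apply/subsetP=> _ /imsetP[z Zz ->]; have Rz := subsetP sZR z Zz.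
      rewrite ffunE Rz -mem_rho -sE // memJ_norm // mem_rho //.
    rewrite card_in_imset // => y z Zy Zz; rewrite !ffunE !(subsetP sZR) //.
    exact: perm_inj.
  rewrite inE => /(_ isT)/and3P[_ _ /exists_inP[g Pg /andP[_ /eqP eg]]].
  case/negP: not_Cs.
  have eag x : x \in R -> rho x ^ s = rho x ^ rho g.
    move=> Rx; rewrite sE // -rhoJ; congr (rho _).
    by have /ffunP/(_ x) := eg; rewrite !ffunE Rx.
  have Cd : s * (rho g)^-1 \in 'C(rho @* R).
    apply/centP=> _ /morphimP[x _ Rx ->]; apply/commute_sym/commgP/conjg_fixP.
    by rewrite conjgM eag // conjgK.
  have NCs : s \in 'N('C(rho @* R)).
    have := fs_aut_norm fsR (sub1G (rho @* R)%G) (morphimS _ sRP :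
      _ \subset (rho @* P)%G).
    by move/norms_cent/subsetP; apply.
  have NCd : s * (rho g)^-1 \in 'N('C(rho @* R)) by rewrite (subsetP (normG _)).
  have NCg : rho g \in 'N('C(rho @* R)).
    by rewrite -groupV -(groupMl _ NCs).
  have es : coset 'C(rho @* R) s = coset 'C(rho @* R) (rho g).
    rewrite -[s in LHS](mulgKV (rho g)) morphM //= (coset_id Cd) mul1g //.
  apply: coset_idr => //.
  have pc : p.-elt (coset 'C(rho @* R) s).
    by rewrite es morph_p_elt // (mem_p_elt pP') // mem_rho.
  have p'c : p^'.-elt (coset 'C(rho @* R) s) by rewrite morph_p_elt.
  exact: pelt_p'elt_eq1 pc p'c.
apply/eqP; rewrite eqEsubset (fusion_inner F_fusion) andbT.
apply/subsetP=> [[[R T] f]] Ff0; have Ff : f \in Hom F R T by rewrite inE.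
have [sRP sTP _ _ fT] := HomP F_fusion Ff.
have [s Ms sE] := real_Hom F_fusion Ff sTP.
(* Everything normalizes the trivial subgroup, so any nontrivial p'-automorphism would make it
   bad. *)
have triv (X : {group {perm gT}}) a : 1%G \subset X -> X \subset (rho @* P)%G ->
    a \in fs_aut (real P F) X -> p^'.-elt a -> a \in 'C(X).
  move=> _ sXP Aa p'a; apply: contraR not_bad => not_Ca.
  apply/fs_badP; exists X, a; split; first exact: sub1G.
  by split; rewrite ?sub1G ?norm1 ?setIT ?inE ?p'a.
have sRP' : rho @* R \subset (rho @* P)%G := morphimS _ sRP.
have [_ /morphimP[g _ Pg ->] act] :=
  fusion_trivial fsR pP' satR triv (sub1G (rho @* R)%G) sRP' Ms.
have fg x : x \in R -> f x = x ^ g.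
  by move=> Rx; apply: rho_inj; rewrite -sE // act ?mem_rho // rhoJ.
rewrite inE sRP sTP; apply/exists_inP; exists g => //; apply/andP; split.
  by apply/subsetP=> _ /imsetP[x Rx ->]; rewrite -fg // fT.
apply/eqP/ffunP=> x; rewrite ffunE; case: (boolP (x \in R)) => [/fg // | nRx].
exact: (Hom_out F_fusion Ff nRx).
Qed.
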